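(* Let $\Omega=\mathbb{R}^3/\mathbb{Z}^3$ and let $\mathbf{u}_0\in H^s(\Omega;\mathbb{R}^3)$, with $s\geq 3$, satisfy $\nabla\cdot\mathbf{u}_0=0$ and $\int_\Omega \mathbf{u}_0(\mathbf{x})\,d\mathbf{x}=0$. For each $\alpha>0$, let $\mathbf{u}^\alpha$ be the corresponding unique (global in time) solution of the 3D Euler-Voigt equations on $\Omega$, $$-\alpha^2\partial_t\nabla^2\mathbf{u}^\alpha+\partial_t\mathbf{u}^\alpha+(\mathbf{u}^\alpha\cdot\nabla)\mathbf{u}^\alpha+\nabla p^\alpha=0,\qquad \nabla\cdot\mathbf{u}^\alpha=0,\qquad \mathbf{u}^\alpha(\mathbf{x},0)=\mathbf{u}_0(\mathbf{x}).$$ Suppose that for some $T>0$, $$\limsup_{\alpha\to0^+}\ \sup_{t\in[0,T]}\ \alpha\,\|\nabla\mathbf{u}^\alpha(t)\|_{L^2(\Omega)}>0.$$ Then the unique solution $\mathbf{u}$ of the 3D incompressible Euler equations on $\Omega$, $$\partial_t\mathbf{u}+(\mathbf{u}\cdot\nabla)\mathbf{u}+\nabla p=0,\qquad \nabla\cdot\mathbf{u}=0,\qquad \mathbf{u}(\mathbf{x},0)=\mathbf{u}_0(\mathbf{x}),$$ must develop a singularity within the interval $[0,T]$; that is, if $[0,T_{\max})$ denotes its maximal interval of existence as a strong solution, then $T_{\max}\leq T$.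
   Context: The spatial domain is the periodic box $\Omega=\mathbb{R}^3/\mathbb{Z}^3\equiv[0,1]^3$; $L^p$ and $H^s$ denote the usual Lebesgue and Sobolev spaces of (periodic) functions on $\Omega$. The unknowns are the velocity field $\mathbf{u}=\mathbf{u}(\mathbf{x},t)\in\mathbb{R}^3$ and the scalar pressure $p=p(\mathbf{x},t)$. Initial data are assumed to have zero spatial average, a property preserved in time by the equations. Euler-Voigt: for every fixed $\alpha>0$, the Euler-Voigt system is known to be globally well-posed for divergence-free, mean-zero initial data in $H^1$, i.e. it has a unique solution $\mathbf{u}^\alpha$ with values in $H^1$, defined for all times. Formally setting $\alpha=0$ in the system gives the Euler equations. Euler: for divergence-free initial data $\mathbf{u}_0\in H^3$, it is classical that the 3D Euler equations have a unique strong ($H^3$-valued) solution $\mathbf{u}$ on a maximal time interval $[0,T_{\max})$, with $0<T_{\max}\leq\infty$. The solution ''remains smooth on $[0,T]$'' if $T<T_{\max}$ (so that in particular $\sup_{0\leq t\leq T}\|\mathbf{u}(t)\|_{H^3}<\infty$), and it ''develops a singularity within $[0,T]$'' if it does not remain smooth on $[0,T]$, i.e. if $T_{\max}\leq T$. *)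

(* Defs.v *)
From HB Require Import structures.
From mathcomp Require Import all_boot all_order all_algebra.
From mathcomp Require Import all_classical all_reals all_analysis.

Set Implicit Arguments.
Unset Strict Implicit.
Unset Printing Implicit Defensive.

Import Order.TTheory GRing.Theory Num.Theory.
Import numFieldNormedType.Exports.

Local Open Scope classical_set_scope.
Local Open Scope ring_scope.

(* A function on the torus R^3/Z^3 is a 1-periodic function on R^3, integrated
   over the unit cell [0,1]^3. Elements of L^2 and H^s are represented by
   functions, so identities between them are stated almost everywhere. *)

Section Torus.
Context {R : realType}.

Local Notation point := (R * R * R)%type.
Local Notation mR := (measurableTypeR R).

Definition leb : {sigma_finite_measure set mR -> \bar R} := @lebesgue_measure R.

Definition area : {measure set (mR * mR)%type -> \bar R} :=
  (leb \x leb)%E.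
Definition vol : {measure set (mR * mR * mR)%type -> \bar R} :=
  (area \x leb)%E.

Definition cell : set (mR * mR * mR)%type := `[0, 1] `*` `[0, 1] `*` `[0, 1].

Definition torus_int (f : point -> R) : R := \int[vol]_(x in cell) f x.

Definition e_ (j : 'I_3) : point :=
  ((j == 0 :> nat)%:R, (j == 1 :> nat)%:R, (j == 2 :> nat)%:R).

Definition periodic (f : point -> R) : Prop :=
  forall (j : 'I_3) (x : point), f (x + e_ j) = f x.

Definition L2 (f : point -> R) : Prop :=
  [/\ measurable_fun (setT : set (mR * mR * mR)%type) f, periodic f &
      vol.-integrable cell (fun x => (f x ^+ 2)%:E)].

Definition ae_eq_fun (f g : point -> R) : Prop := {ae vol, forall x, f x = g x}.

Definition partial (j : 'I_3) (f : point -> R) : point -> R :=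
  fun x => 'D_(e_ j) f x.

Definition laplacian (f : point -> R) : point -> R :=
  fun x => \sum_(j < 3) partial j (partial j f) x.

Fixpoint Ck (n : nat) (f : point -> R) : Prop :=
  continuous f /\
  if n is m.+1 then
    forall j : 'I_3, (forall x, derivable f x (e_ j)) /\ Ck m (partial j f)
  else True.

Definition test_fun (phi : point -> R) : Prop :=
  periodic phi /\ forall n, Ck n phi.

Definition weak_partial (j : 'I_3) (f g : point -> R) : Prop :=
  L2 g /\ forall phi, test_fun phi ->
    torus_int (fun x => f x * partial j phi x) =
    - torus_int (fun x => g x * phi x).

(* A representative of the weak derivative, unique almost everywhere when it
   exists; the zero function otherwise. *)
Definition wD (j : 'I_3) (f : point -> R) : point -> R :=
  xget (fun=> 0) [set g | weak_partial j f g].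

Definition freq := (int * int * int)%type.

Definition phase (k : freq) (x : point) : R :=
  2 * pi * (k.1.1%:~R * x.1.1 + k.1.2%:~R * x.1.2 + k.2%:~R * x.2).

(* |\hat f(k)|^2, where \hat f(k) = \int f(x) e^{-2 i pi k.x} dx *)
Definition fourier_sqr (f : point -> R) (k : freq) : R :=
  torus_int (fun x => f x * cos (phase k x)) ^+ 2 +
  torus_int (fun x => f x * sin (phase k x)) ^+ 2.

(* 1 + |2 pi k|^2: with this weight the squared H^1 norm is the sum of the
   squared L^2 norms of f and of its gradient. *)
Definition bracket_sqr (k : freq) : R :=
  1 + (2 * pi) ^+ 2 *
    (k.1.1%:~R ^+ 2 + k.1.2%:~R ^+ 2 + k.2%:~R ^+ 2).

Definition Hs_norm_sqr (s : R) (f : point -> R) : \bar R :=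
  (\esum_(k in [set: freq]) (bracket_sqr k `^ s * fourier_sqr f k)%:E)%E.

Definition Hs (s : R) (f : point -> R) : Prop :=
  L2 f /\ (Hs_norm_sqr s f < +oo)%E.

Definition vfield := 'I_3 -> point -> R.

Definition vHs (s : R) (u : vfield) : Prop := forall i, Hs s (u i).

Definition vHs_norm_sqr (s : R) (u : vfield) : \bar R :=
  (\sum_(i < 3) Hs_norm_sqr s (u i))%E.

Definition div_free (u : vfield) : Prop :=
  {ae vol, forall x, \sum_(j < 3) wD j (u j) x = 0}.

Definition mean_zero (u : vfield) : Prop := forall i, torus_int (u i) = 0.

Definition advect (u : vfield) : vfield :=
  fun i x => \sum_(j < 3) u j x * wD j (u i) x.

Definition grad_L2norm (u : vfield) : R :=
  Num.sqrt (\sum_(i < 3) \sum_(j < 3) torus_int (fun x => wD j (u i) x ^+ 2)).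

(* Limits are taken within I: they are one-sided at an endpoint of I. *)
Definition cont_Hs (I : set R) (s : R) (u : R -> vfield) : Prop :=
  forall t, I t -> vHs s (u t) /\
    vHs_norm_sqr s (fun i x => u r i x - u t i x)
      @[r --> within I (nbhs t)] --> 0%E.

Definition deriv_Hs (I : set R) (s : R) (u du : R -> vfield) : Prop :=
  forall t, I t ->
    vHs_norm_sqr s (fun i x => (u r i x - u t i x) / (r - t) - du t i x)
      @[r --> within I t^'] --> 0%E.

Definition C1_Hs (I : set R) (s : R) (u du : R -> vfield) : Prop :=
  [/\ cont_Hs I s u, cont_Hs I s du & deriv_Hs I s u du].

(* Global solution in C^1([0,+oo[; H^1). As u(t) is only in H^1, the momentum
   equation holds in the sense of distributions on the torus. *)
Definition euler_voigt_solution (alpha : R) (u0 : vfield) (u : R -> vfield)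
    : Prop :=
  exists (du : R -> vfield) (p : R -> point -> R),
  [/\ C1_Hs `[0, +oo[ 1 u du,
      forall t, 0 <= t -> L2 (p t) /\ div_free (u t),
      forall t, 0 <= t -> forall (i : 'I_3) phi, test_fun phi ->
        - alpha ^+ 2 * torus_int (fun x => du t i x * laplacian phi x)
        + torus_int (fun x => du t i x * phi x)
        + torus_int (fun x => advect (u t) i x * phi x)
        - torus_int (fun x => p t x * partial i phi x) = 0 &
      forall i, ae_eq_fun (u 0 i) (u0 i)].

(* Strong solution on [0, T[, in C([0,T[; H^3) and C^1([0,T[; H^2). *)
Definition euler_solution (u0 : vfield) (T : R) (u : R -> vfield) : Prop :=
  exists (du : R -> vfield) (p : R -> point -> R),
  [/\ cont_Hs `[0, T[ 3 u,
      C1_Hs `[0, T[ 2 u du,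
      forall t, 0 <= t < T -> Hs 1 (p t) /\ div_free (u t),
      forall t, 0 <= t < T -> forall i : 'I_3,
        {ae vol, forall x, du t i x + advect (u t) i x + wD i (p t) x = 0} &
      forall i, ae_eq_fun (u 0 i) (u0 i)].

(* Right end of the maximal interval of existence. Strong solutions are unique,
   so those on the intervals [0, T[ glue to one on [0, euler_Tmax u0[. *)
Definition euler_Tmax (u0 : vfield) : \bar R :=
  ereal_sup [set T%:E | T in [set T : R |
    0 < T /\ exists u, euler_solution u0 T u]].

End Torus.

(* Main.v *)
Require Import Defs.
From HB Require Import structures.
From mathcomp Require Import all_boot all_order all_algebra.
From mathcomp Require Import all_classical all_reals all_analysis.
From mathcomp Require Import measurable_realfun zify ring lra.

Import Order.TTheory GRing.Theory Num.Theory.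
Import numFieldNormedType.Exports.

(** Suppose that the Euler solution v from u0 exists on [0, T'[ with T < T'. It
    is then bounded in H^3, and its time derivative in H^2, uniformly on [0, T].
    For a fixed alpha let u be the Euler-Voigt solution, w = u - v, and compare
    the two flows in the energy conserved by Euler-Voigt,
<<
      E = |w|^2 + alpha^2 |grad w|^2        (norms of L^2).
>>
    Subtract the equations and test with w. The pressures disappear since w is
    divergence free, (u . grad) u - (v . grad) v = (w . grad) v + (u . grad) w, and
    (u . grad) w is orthogonal to w. What remains is
<<
      E' / 2 = - ((w . grad) v, w) - alpha^2 (grad dv/dt, grad w),
>>
    hence E' <= C E + O(alpha^2) with a constant C depending on sup |grad v| only.
    As E(0) = 0, Gronwall's inequality gives E = O(alpha^2), that is, grad w is
    bounded in L^2 uniformly in alpha and in t in [0, T]. So is then grad u, whence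
    alpha |grad u| = O(alpha) and the upper limit in the hypothesis is 0.

    The testing needs care: u is only in H^1, the Euler-Voigt equation holds in the
    sense of distributions, and its test functions are smooth. So the test is
    made with the truncations P_N w of the Fourier series of w, which are smooth
    and still divergence free, and N tends to infinity (energy_rate). This rests
    on the following facts.
    - The weak derivative of an H^1 function exists, and differentiation is
      multiplication by the frequency on Fourier coefficients (cf_wD, sf_wD).
      Existence comes from the Riesz-Fischer theorem (L2_complete, riesz_fischer),
      and proj_cvg, the convergence of P_N f to f, from the completeness of the
      trigonometric system (annih_ae0). For the latter, a function orthogonal to
      all modes is shown to be orthogonal to the indicators of all measurable
      sets, by approximating step functions of trigonometric polynomials with
      polynomials of them.
    - The product (u . grad) w is only integrable, and its pairing with P_N w
      tends to 0 (convection_limit). This uses the estimate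
      |int f g h| <= c |f|_{H^1} |g|_{H^1} |h|_{L^2} (trilinear), valid in dimension
      three because the sum of (1 + |2 pi k|^2)^-2 over the frequencies is finite.
    - The same sum gives the bound on sup |grad v| by the H^3 norm (fproj_sup,
      ip_mul_sup).

    Continuity in time with values in H^1 makes E continuous on [0, T] and
    differentiable inside (voigt_energy_cvg, voigt_energy_derive), as needed for
    Gronwall's inequality (gronwall). *)

Set Implicit Arguments.
Unset Strict Implicit.
Unset Printing Implicit Defensive.

Local Open Scope classical_set_scope.
Local Open Scope ring_scope.

(** * Square integrable functions on the torus *)

Section SquareIntegrable.
Context {R : realType}.
Local Notation mR := (measurableTypeR R).
Local Notation mP := (mR * mR * mR)%type.
Local Notation point := (R * R * R)%type.
Local Notation periodic := Defs.periodic.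

Implicit Types f g h : point -> R.

Definition integ f := vol.-integrable (cell : set mP) (EFin \o f).

Lemma measurable_cell : measurable (cell : set mP).
Proof. by apply: measurableX; [apply: measurableX|]; exact: measurable_itv. Qed.

Lemma vol_cell : vol (cell : set mP) = 1%E.
Proof.
have m01 : measurable (`[0, 1]%classic : set mR) by exact: measurable_itv.
have leb01 : leb (`[0, 1]%classic : set mR) = 1%E.
  by rewrite /leb/= lebesgue_measure_itv /= lte_fin ltr01 -EFinD subr0.
rewrite /vol /cell /= product_measure1E//=; last exact: measurableX.
by rewrite /area/= product_measure1E//= leb01 !mul1e.
Qed.

Hint Resolve measurable_cell : core.

Lemma vol_aeS (P Q : point -> Prop) : (forall x, P x -> Q x) ->
  {ae vol, forall x, P x} -> {ae vol, forall x, Q x}.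
Proof.
by move=> PQ; apply: (@filterS _ _ (ae_filter_ringOfSetsType (R:=R) vol)).
Qed.

Lemma cell_lty : (vol (cell : set mP) < +oo)%E.
Proof. by rewrite vol_cell ltry. Qed.

Lemma integ_meas f : integ f -> measurable_fun (cell : set mP) f.
Proof. by move=> /measurable_int /measurable_EFinP. Qed.

Lemma integD f g : integ f -> integ g -> integ (fun x => f x + g x).
Proof. by move=> h1 h2; exact: (@integrableD _ _ _ vol cell measurable_cell _ _ h1 h2). Qed.

Lemma integZ (c : R) f : integ f -> integ (fun x => c * f x).
Proof. by move=> h1; exact: (@integrableZl _ _ _ vol cell measurable_cell c _ h1). Qed.

Lemma torus_intD f g : integ f -> integ g ->
  torus_int (fun x => f x + g x) = torus_int f + torus_int g.
Proof. by move=> ? ?; rewrite /torus_int RintegralD. Qed.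

Lemma torus_intZ (c : R) f : integ f ->
  torus_int (fun x => c * f x) = c * torus_int f.
Proof. by move=> ?; rewrite /torus_int RintegralZl. Qed.

Lemma le_torus_int f g : integ f -> integ g ->
  (forall x, cell x -> f x <= g x) -> torus_int f <= torus_int g.
Proof. by move=> *; apply: le_Rintegral. Qed.

Lemma eq_torus_int f g : f =1 g -> torus_int f = torus_int g.
Proof. by move=> /funext ->. Qed.

Lemma torus_int_cst (c : R) : torus_int (fun=> c) = c.
Proof. by rewrite /torus_int Rintegral_cst// [vol _]vol_cell /= mulr1. Qed.

Lemma ae_torus_int f g : integ f -> integ g -> ae_eq_fun f g ->
  torus_int f = torus_int g.
Proof.
move=> /integ_meas mf /integ_meas mg fg; congr fine.
apply: ae_eq_integral => //; try exact/measurable_EFinP.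
by apply: vol_aeS fg => x + _ => ->.
Qed.

Lemma integ_le f g : measurable_fun (cell : set mP) f -> integ g ->
  (forall x, cell x -> `|f x| <= `|g x|) -> integ f.
Proof.
by move=> mf ig fg; apply: le_integrable ig => //; exact/measurable_EFinP.
Qed.

Lemma integ_bounded f (M : R) : measurable_fun (cell : set mP) f ->
  (forall x, cell x -> `|f x| <= M) -> integ f.
Proof.
move=> mf fM; apply: measurable_bounded_integrable => //; first exact: cell_lty.
by exists M; split; rewrite ?num_real// => r Mr x /fM /le_trans; apply; exact: ltW.
Qed.

Lemma L2_meas f : L2 f -> measurable_fun (cell : set mP) f.
Proof. by case=> mf _ _; exact: measurable_funTS. Qed.

Lemma L2_integM f g : L2 f -> L2 g -> integ (fun x => f x * g x).
Proof.
move=> lf lg; case: (lf) => _ _ i1; case: (lg) => _ _ i2;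
apply: (integ_le _ (integD i1 i2)); first by apply: measurable_funM; exact: L2_meas.
move=> x _; rewrite [leRHS]ger0_norm ?addr_ge0 ?sqr_ge0// normrM.
rewrite -(real_normK (num_real (f x))) -(real_normK (num_real (g x))).
have := sqr_ge0 (`|f x| - `|g x|).
have := mulr_ge0 (normr_ge0 (f x)) (normr_ge0 (g x)).
by nra.
Qed.

Lemma L2Z (c : R) f : L2 f -> L2 (fun x => c * f x).
Proof.
move=> [mf pf i]; split.
- by apply: measurable_funM => //; exact: measurable_cst.
- by move=> j x; rewrite pf.
- have := integZ (c ^+ 2) i; congr (_.-integrable _ _).
  by apply/funext => x /=; rewrite exprMn.
Qed.

Lemma L2D f g : L2 f -> L2 g -> L2 (fun x => f x + g x).
Proof.
move=> lf lg; case: (lf) => mf pf i1; case: (lg) => mg pg i2; split.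
- exact: measurable_funD.
- by move=> j x; rewrite pf pg.
- have := integD (integD i1 i2) (integZ 2 (L2_integM lf lg)).
  by congr (_.-integrable _ _); apply/funext => x /=; congr (_%:E); ring.
Qed.

Lemma L2_bdM f g (M : R) : L2 f -> measurable_fun (setT : set mP) g -> periodic g ->
  (forall x, cell x -> `|g x| <= M) -> L2 (fun x => g x * f x).
Proof.
move=> lf mg pg gM; case: (lf) => mf pf i1; split.
- exact: measurable_funM.
- by move=> j x; rewrite pf pg.
- apply: (integ_le _ (integZ (M ^+ 2) i1)).
    apply: measurable_funTS; apply: measurable_funX.
    exact: measurable_funM.
  move=> x cx; rewrite (ger0_norm (sqr_ge0 _)) ger0_norm; last first.
    by apply: mulr_ge0; exact: sqr_ge0.
  rewrite exprMn.
  apply: ler_wpM2r; first exact: sqr_ge0.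
  rewrite -(real_normK (num_real (g x))) !expr2.
  by apply: ler_pM => //; exact: gM.
Qed.

Lemma L2_1 : L2 (fun=> 1 : R).
Proof.
split => //; apply: (@integ_bounded _ 1) => // x _ /=.
by rewrite expr1n normr1.
Qed.

Lemma L2_bounded g (M : R) : measurable_fun (setT : set mP) g -> periodic g ->
  (forall x, cell x -> `|g x| <= M) -> L2 g.
Proof.
move=> mg pg gM; have := L2_bdM L2_1 mg pg gM; congr L2.
by apply/funext => x; rewrite mulr1.
Qed.

Lemma L2_0 : L2 (fun=> 0 : R).
Proof.
by apply: (@L2_bounded _ 0) => // x _; rewrite normr0.
Qed.

Lemma L2N f : L2 f -> L2 (fun x => - f x).
Proof. by move=> /(L2Z (-1)); congr L2; apply/funext => x; rewrite mulN1r. Qed.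

Lemma L2B f g : L2 f -> L2 g -> L2 (fun x => f x - g x).
Proof. by move=> lf /L2N; exact: L2D. Qed.

Lemma sum_funE (I : Type) (i : I) (s : seq I) (F : I -> point -> R) :
  (fun x => \sum_(j <- i :: s) F j x) =
  (fun x => F i x + \sum_(j <- s) F j x).
Proof. by apply/funext => x; rewrite big_cons. Qed.

Lemma sum_fun0 (I : Type) (F : I -> point -> R) :
  (fun x => \sum_(j <- [::]) F j x) = (fun=> 0).
Proof. by apply/funext => x; rewrite big_nil. Qed.

Lemma L2_sum (I : Type) (s : seq I) (F : I -> point -> R) :
  (forall i, L2 (F i)) -> L2 (fun x => \sum_(i <- s) F i x).
Proof.
move=> lF; elim: s => [|i s IH]; first by rewrite sum_fun0; exact: L2_0.
by rewrite sum_funE; exact: L2D.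
Qed.

Definition ip f g : R := torus_int (fun x => f x * g x).
Definition nrm f : R := Num.sqrt (ip f f).

Lemma ipC f g : ip f g = ip g f.
Proof. by apply: eq_torus_int => x; rewrite mulrC. Qed.

Lemma ip_ge0 f : 0 <= ip f f.
Proof. by apply: Rintegral_ge0 => x _; rewrite -expr2 sqr_ge0. Qed.

Lemma nrm_ge0 f : 0 <= nrm f. Proof. exact: sqrtr_ge0. Qed.

Lemma nrm_sqr f : nrm f ^+ 2 = ip f f.
Proof. by rewrite /nrm sqr_sqrtr// ip_ge0. Qed.

Lemma ipDl f g h : L2 f -> L2 g -> L2 h ->
  ip (fun x => f x + g x) h = ip f h + ip g h.
Proof.
move=> lf lg lh; rewrite /ip -torus_intD; try exact: L2_integM.
by apply: eq_torus_int => x; rewrite mulrDl.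
Qed.

Lemma ipZl (c : R) f g : L2 f -> L2 g -> ip (fun x => c * f x) g = c * ip f g.
Proof.
move=> lf lg; rewrite /ip -torus_intZ; last exact: L2_integM.
by apply: eq_torus_int => x; rewrite mulrA.
Qed.

Lemma ipNl f g : L2 f -> L2 g -> ip (fun x => - f x) g = - ip f g.
Proof.
move=> lf lg; rewrite -[RHS]mulN1r -ipZl//.
by congr ip; apply/funext => x; rewrite mulN1r.
Qed.

Lemma ipBl f g h : L2 f -> L2 g -> L2 h ->
  ip (fun x => f x - g x) h = ip f h - ip g h.
Proof. by move=> lf lg lh; rewrite ipDl ?ipNl//; exact: L2N. Qed.

Lemma ipDr f g h : L2 f -> L2 g -> L2 h ->
  ip h (fun x => f x + g x) = ip h f + ip h g.
Proof. by move=> lf lg lh; rewrite ipC ipDl// !(ipC h). Qed.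

Lemma ipZr (c : R) f g : L2 f -> L2 g -> ip g (fun x => c * f x) = c * ip g f.
Proof. by move=> lf lg; rewrite ipC ipZl// ipC. Qed.

Lemma ipNr f g : L2 f -> L2 g -> ip g (fun x => - f x) = - ip g f.
Proof. by move=> lf lg; rewrite ipC ipNl// ipC. Qed.

Lemma ipBr f g h : L2 f -> L2 g -> L2 h ->
  ip h (fun x => f x - g x) = ip h f - ip h g.
Proof. by move=> lf lg lh; rewrite ipC ipBl// !(ipC h). Qed.

Lemma ip0l f : ip (fun=> 0) f = 0.
Proof.
rewrite /ip -[RHS](torus_int_cst 0); apply: eq_torus_int => x; exact: mul0r.
Qed.

Lemma ip_suml (I : Type) (s : seq I) (F : I -> point -> R) g :
  (forall i, L2 (F i)) -> L2 g ->
  ip (fun x => \sum_(i <- s) F i x) g = \sum_(i <- s) ip (F i) g.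
Proof.
move=> lF lg; elim: s => [|i s IH]; first by rewrite sum_fun0 big_nil ip0l.
by rewrite sum_funE big_cons ipDl ?IH//; exact: L2_sum.
Qed.

Lemma ip_sumr (I : Type) (s : seq I) (F : I -> point -> R) g :
  (forall i, L2 (F i)) -> L2 g ->
  ip g (fun x => \sum_(i <- s) F i x) = \sum_(i <- s) ip g (F i).
Proof.
by move=> lF lg; rewrite ipC ip_suml//; apply: eq_bigr => i _; exact: ipC.
Qed.

Lemma ip_CS f g : L2 f -> L2 g -> `|ip f g| <= nrm f * nrm g.
Proof.
move=> lf lg.
have key t : 0 <= ip f f + t * (2 * ip f g) + t ^+ 2 * ip g g.
  have := ip_ge0 (fun x => f x + t * g x).
  have lt := L2Z t lg; have ls := L2D lf lt.
  rewrite ipDl// !ipDr// !ipZl// !ipZr// (ipC g f) => /le_trans; apply.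
  by rewrite le_eqVlt; apply/orP; left; apply/eqP; ring.
rewrite -ler_sqr ?nnegrE ?mulr_ge0 ?nrm_ge0// exprMn !nrm_sqr.
rewrite real_normK ?num_real//.
have [g0|g0] := eqVneq (ip g g) 0.
  (* The quadratic polynomial in t is affine, and takes the value -1 here. *)
  have := key (- (ip f f + 1) / (2 * ip f g)); rewrite g0 mulr0 addr0 mulr0.
  have [->|fg0] := eqVneq (ip f g) 0; first by rewrite expr0n.
  rewrite mulfVK ?mulf_neq0 ?pnatr_eq0//; have := ip_ge0 f; nra.
have gp : 0 < ip g g by rewrite lt_def g0 ip_ge0.
have := key (- ip f g / ip g g).
have -> : ip f f + - ip f g / ip g g * (2 * ip f g) + (- ip f g / ip g g) ^+ 2 * ip g g
  = (ip f f * ip g g - ip f g ^+ 2) / ip g g by field.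
by rewrite pmulr_lge0 ?invr_gt0// subr_ge0.
Qed.

Lemma ip_le_nrm f g : L2 f -> L2 g -> ip f g <= nrm f * nrm g.
Proof. by move=> lf lg; apply: le_trans (ler_norm _) _; exact: ip_CS. Qed.

Lemma nrmZ (c : R) f : L2 f -> nrm (fun x => c * f x) = `|c| * nrm f.
Proof.
move=> lf; rewrite /nrm ipZl ?ipZr//; last exact: L2Z.
by rewrite mulrA -expr2 sqrtrM ?sqr_ge0// sqrtr_sqr.
Qed.

Lemma nrmD f g : L2 f -> L2 g -> nrm (fun x => f x + g x) <= nrm f + nrm g.
Proof.
move=> lf lg; rewrite -ler_sqr ?nnegrE ?addr_ge0 ?nrm_ge0//.
have ls := L2D lf lg.
rewrite nrm_sqr ipDl// !ipDr// (ipC g f) sqrrD !nrm_sqr.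
have := ip_le_nrm lf lg; lra.
Qed.

Lemma nrm_subC f g : nrm (fun x => f x - g x) = nrm (fun x => g x - f x).
Proof. by congr Num.sqrt; apply: eq_torus_int => x; rewrite -mulrNN !opprB. Qed.

Lemma nrm_le_bd f g (M : R) : L2 f -> measurable_fun (setT : set mP) g -> periodic g ->
  0 <= M -> (forall x, cell x -> `|g x| <= M) -> nrm (fun x => g x * f x) <= M * nrm f.
Proof.
move=> lf mg pg M0 gM; rewrite -{1}(ger0_norm M0) -nrmZ//; apply: ler_wsqrtr.
have l1 := L2_bdM lf mg pg gM; have l2 := L2Z M lf.
apply: (le_torus_int (L2_integM l1 l1) (L2_integM l2 l2)) => x cx.
rewrite -!expr2 !exprMn ler_wpM2r ?sqr_ge0//.
rewrite -(real_normK (num_real (g x))) [leLHS]expr2 expr2.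
by apply: ler_pM => //; exact: gM.
Qed.

Lemma nrm0_ip f g : L2 f -> L2 g -> nrm f = 0 -> ip f g = 0.
Proof.
by move=> lf lg f0; have := ip_CS lf lg; rewrite f0 mul0r normr_le0 => /eqP.
Qed.

Lemma nrm0_ip_eq f g h : L2 f -> L2 g -> L2 h ->
  nrm (fun x => f x - g x) = 0 -> ip f h = ip g h.
Proof.
move=> lf lg lh /nrm0_ip - /(_ h (L2B lf lg) lh).
by rewrite ipBl// => /eqP; rewrite subr_eq0 => /eqP.
Qed.

Lemma L2_integ f : L2 f -> integ f.
Proof.
move=> lf; have := L2_integM lf L2_1; congr (_.-integrable _ _).
by apply/funext => x /=; rewrite mulr1.
Qed.

Lemma ae_nrm0 f g : L2 f -> L2 g -> ae_eq_fun f g -> nrm (fun x => f x - g x) = 0.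
Proof.
move=> lf lg fg; have ld := L2B lf lg; rewrite /nrm.
suff -> : ip (fun x => f x - g x) (fun x => f x - g x) = 0 by rewrite sqrtr0.
rewrite -[RHS](torus_int_cst 0); apply: ae_torus_int.
- exact: L2_integM.
- exact: L2_integ L2_0.
- by apply: vol_aeS fg => x ->; rewrite subrr mul0r.
Qed.

End SquareIntegrable.
#[global] Hint Resolve measurable_cell : core.

(** * Smooth functions and integration by parts *)

Section SmoothFunctions.
Context {R : realType}.
Local Notation mR := (measurableTypeR R).
Local Notation mP := (mR * mR * mR)%type.
Local Notation point := (R * R * R)%type.
Local Notation periodic := Defs.periodic.

Implicit Types f g h : point -> R.

(** The product sigma-algebra is the Borel one: an open set is the countable
    union of the boxes with rational corners that it contains. *)
Lemma open_measurable3 (U : set point) : open U -> measurable (U : set mP).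
Proof.
move=> oU.
pose I := (rat * rat * rat * (rat * rat * rat))%type.
pose lo (q : rat) (r : rat) : set R := `]ratr q, ratr r[%classic.
pose B (i : I) : set point :=
  lo i.1.1.1 i.2.1.1 `*` lo i.1.1.2 i.2.1.2 `*` lo i.1.2 i.2.2.
suff -> : U = \bigcup_(i in [set: I]) (if `[< B i `<=` U >] then B i else set0).
  apply: countable_bigcupT_measurable; first exact: countableP.
  move=> i; case: ifP => // _.
  by apply: measurableX; [apply: measurableX|]; exact: measurable_itv.
apply/seteqP; split=> [x Ux|x [i _]]; last by case: ifPn => // /asboolP; exact.
have /nbhs_ballP[e /= e0 eU] := open_nbhs_nbhs (conj oU Ux).
have pick (t : R) : exists qr : rat * rat, [/\ t - e < ratr qr.1, ratr qr.1 < t,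
    t < ratr qr.2 & ratr qr.2 < t + e].
  have [|q] := @rat_in_itvoo R (t - e) t; first lra.
  have [|r] := @rat_in_itvoo R t (t + e); first lra.
  by rewrite !in_itv /= => /andP[? ?] /andP[? ?]; exists (q, r).
case: x Ux eU => -[x y] z Uxyz eU.
have [[q1 r1] [/= a1 b1 c1 d1]] := pick x.
have [[q2 r2] [/= a2 b2 c2 d2]] := pick y.
have [[q3 r3] [/= a3 b3 c3 d3]] := pick z.
exists ((q1, q2, q3), (r1, r2, r3)) => //.
rewrite asboolT.
  by rewrite /B /lo /=; split; [split|]; rewrite /= in_itv /=; apply/andP.
move=> [[x' y'] z'] [[/=]]; rewrite /lo /= !in_itv /=.
move=> /andP[? ?] /andP[? ?] /andP[? ?]; apply: eU.
by split; [split|]; rewrite /ball /= ltr_norml; apply/andP; split; lra.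
Qed.

Lemma continuous_measurable3 f : continuous f -> measurable_fun (setT : set mP) f.
Proof.
move=> /continuousP cf; apply: (measurability _ (RGenOpens.measurableE R)).
move=> _ [_ [a [b ->] <-]]; rewrite setTI; apply: open_measurable3.
exact/cf/interval_open.
Qed.

Lemma continuous_cell_bounded f : continuous f ->
  exists2 M : R, 0 <= M & forall x, cell x -> `|f x| <= M.
Proof.
move=> cf; have cc : compact (cell : set point).
  by apply: compact_setX; [apply: compact_setX|]; exact: segment_compact.
have := @continuous_compact _ _ f cell (continuous_subspaceT cf) cc.
move=> /compact_bounded [M [_ HM]]; exists (`|M| + 1); first by rewrite addr_ge0.
move=> x cx; apply: HM; last by exists x.
by rewrite (le_lt_trans (ler_norm M))// ltrDl.
Qed.

Lemma L2_continuous f : continuous f -> periodic f -> L2 f.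
Proof.
move=> cf pf; have [M _ fM] := continuous_cell_bounded cf.
exact: L2_bounded (continuous_measurable3 cf) pf fM.
Qed.

Lemma L2_contM f g : L2 f -> continuous g -> periodic g ->
  L2 (fun x => g x * f x).
Proof.
move=> lf cg pg; have [M _ gM] := continuous_cell_bounded cg.
exact: L2_bdM lf (continuous_measurable3 cg) pg gM.
Qed.

Lemma line_derive f (v a : point) (t : R) : derivable f (t *: v + a) v ->
  derivable (fun s : R => f (s *: v + a)) t 1 /\
  derive1 (fun s : R => f (s *: v + a)) t = 'D_v f (t *: v + a).
Proof.
rewrite derive1E /derivable /derive.
set F := (X in cvg (X @ _)); set G := (X in _ -> cvg (X @ _) /\ _).
have FG : F = G.
  rewrite /F /G; apply/funext => h /=.
  by rewrite [h *: 1]mulr1 scalerDl addrA.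
move=> dF; split; first by rewrite -FG.
by change (lim (G @ 0^') = lim (F @ 0^')); rewrite FG.
Qed.

Lemma int01_derive_line f (v a : point) :
  (forall x, derivable f x v) -> continuous (fun x => 'D_v f x) ->
  f (1 *: v + a) = f (0 *: v + a) ->
  (\int[leb]_(t in `[0%R, 1%R]) ('D_v f (t *: v + a))%:E = 0)%E.
Proof.
move=> df cdf per.
have cline : continuous (fun s : R => s *: v + a).
  by move=> s; apply: cvgD; [apply: cvgZr_tmp; exact: cvg_id|exact: cvg_cst].
have dg t := line_derive (df (t *: v + a)).
have cg : continuous (fun s : R => f (s *: v + a)).
  move=> t; apply/differentiable_continuous/derivable1_diffP.
  exact: (dg t).1.
rewrite [LHS](@continuous_FTC2 _ _ (fun s : R => f (s *: v + a)) 0 1)//.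
- by rewrite per subee.
- apply: continuous_subspaceT => t.
  by apply: (@continuous_comp _ _ _ (fun s : R => s *: v + a) (fun x => 'D_v f x));
    [exact: cline|exact: cdf].
- split.
  + by move=> t _; exact: (dg t).1.
  + exact: cvg_at_right_filter (cg 0).
  + exact: cvg_at_left_filter (cg 1).
- by move=> t _; exact: (dg t).2.
Qed.

(** The plane measure again, to carry the sigma-finiteness that Fubini's theorem
    asks of a first factor. *)
Definition area2 : set (mR * mR)%type -> \bar R := @area R.

HB.instance Definition _ := Measure.on area2.

Lemma area2_sigma_finite : sigma_finite setT area2.
Proof.
pose I n : set mR := `[- n%:R, n%:R]%classic.
exists (fun n => I n `*` I n).
  apply/esym/seteqP; split => // -[x y] _.
  pose b := Num.bound (`|x| + `|y|).
  have : `|x| + `|y| < b%:R.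
    by apply: archi_boundP; exact: addr_ge0.
  exists b => //; rewrite /I /=; have := normr_ge0 x; have := normr_ge0 y.
  by split; rewrite /= in_itv /= -ler_norml; lra.
move=> n; have mI : measurable (I n) by exact: measurable_itv.
split; first exact: measurableX.
rewrite /area2 /area /= product_measure1E//= /leb /= lebesgue_measure_itv /=.
by case: ifP => _; rewrite ?mul0e// -EFinB -EFinM ltry.
Qed.

HB.instance Definition _ := Measure_isSigmaFinite.Build _ _ _ area2
  area2_sigma_finite.

(** By Fubini the variable x_j can be integrated first; along a line in that
    direction the fundamental theorem of calculus leaves the difference of the
    values at the two ends of a period. *)
Lemma torus_int_partial f (j : 'I_3) : periodic f ->
  (forall x, derivable f x (e_ j)) -> continuous (partial j f) ->
  torus_int (partial j f) = 0.
Proof.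
move=> pf df cg.
have line a : (\int[leb]_(t in `[0%R, 1%R]) (partial j f (t *: e_ j + a))%:E = 0)%E.
  by apply: int01_derive_line => //; rewrite scale0r scale1r add0r addrC pf.
set G := (fun x => (partial j f x)%:E) \_ cell.
have [M M0 gM] := continuous_cell_bounded cg.
have iG : vol.-integrable setT G.
  apply/(integrable_mkcond _ measurable_cell).
  exact: integ_bounded (measurable_funTS (continuous_measurable3 cg)) gM.
have mG := measurable_int _ iG.
have GE x y z : G (x, y, z) = (if (x \in `[0%R, 1%R]) && ((y \in `[0%R, 1%R]) &&
    (z \in `[0%R, 1%R])) then (partial j f (x, y, z))%:E else 0%E).
  rewrite /G patchE; congr (if _ then _ else _).
  apply/idP/idP; first by rewrite inE => -[[/= -> ->] ->].
  by move=> /and3P[? ? ?]; rewrite inE; split; [split|].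
have line' a : (\int[leb]_t (if t \in `[0%R, 1%R] then
    (partial j f (t *: e_ j + a))%:E else 0%E) = 0)%E.
  rewrite -[RHS](line a) [RHS]integral_mkcond; apply: eq_integral => t _.
  by rewrite patchE mem_setE.
have -> : torus_int (partial j f) = fine (\int[area2 \x leb]_x G x)%E.
  by rewrite /torus_int /Rintegral integral_mkcond.
suff -> : (\int[area2 \x leb]_x G x = 0)%E by [].
have I01 : measurable (`[0, 1]%classic : set mR) by exact: measurable_itv.
have iz z : (leb \x leb)%E.-integrable setT (fun xy => G (xy, z)).
  have -> : (fun xy => G (xy, z)) =
      (EFin \o (fun xy => fine (G (xy, z)))) \_ (`[0, 1] `*` `[0, 1]).
    apply/funext => -[x y]; rewrite patchE /= GE; case: ifPn => [/and3P[xI yI zI]|nI].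
      by rewrite ifT// inE; split.
    by case: ifP.
  apply/(integrable_mkcond _ (measurableX I01 I01)).
  apply: measurable_bounded_integrable; first exact: measurableX.
  - rewrite /= product_measure1E//= /leb /= lebesgue_measure_itv /= lte_fin ltr01.
    by rewrite -EFinB -EFinM ltry.
  - apply: measurable_funTS; apply: measurableT_comp => //.
    exact: measurable_fun_pair1.
  - exists M; split; rewrite ?num_real// => r Mr -[x y] _ /=.
    rewrite GE; case: ifPn => [/and3P[xI yI zI]|_]; last first.
      by rewrite normr0 (le_trans M0) ?ltW.
    by apply: le_trans (ltW Mr); apply: gM; split; [split|].
case: j pf df cg line line' @G gM iG mG GE iz => -[|[|[|//]]] lt3 pf df cg line line' G gM iG mG GE iz.
- rewrite -integral21_prod_meas1//; apply: integral0_eq => z _.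
  rewrite /fubini_G -[LHS](integral21_prod_meas1 (iz z)).
  apply: integral0_eq => y _; rewrite /fubini_G.
  under eq_integral do rewrite GE.
  case: (boolP ((y \in `[0, 1]) && (z \in `[0, 1]))) => yzI; last first.
    by apply: integral0_eq => x _; rewrite andbF.
  rewrite -[RHS](line' (0, y, z)); apply: eq_integral => x _.
  rewrite andbT; case: ifP => // _; congr ((partial _ f _)%:E).
  by rewrite /e_ /=; congr (_, _, _); rewrite /= /GRing.scale/=; ring.
- rewrite -integral21_prod_meas1//; apply: integral0_eq => z _.
  rewrite /fubini_G -[LHS](integral12_prod_meas1 (iz z)).
  apply: integral0_eq => x _; rewrite /fubini_F.
  under eq_integral do rewrite GE.
  case: (boolP ((x \in `[0, 1]) && (z \in `[0, 1]))) => xzI; last first.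
    by apply: integral0_eq => y _; rewrite andbCA (negbTE xzI) andbF.
  rewrite -[RHS](line' (x, 0, z)); apply: eq_integral => y _.
  rewrite andbCA xzI andbT; case: ifP => // _; congr ((partial _ f _)%:E).
  by rewrite /e_ /=; congr (_, _, _); rewrite /= /GRing.scale/=; ring.
- rewrite -integral12_prod_meas1//; apply: integral0_eq => -[x y] _.
  rewrite /fubini_F; under eq_integral do rewrite GE.
  case: (boolP ((x \in `[0, 1]) && (y \in `[0, 1]))) => xyI; last first.
    by apply: integral0_eq => z _; rewrite andbA (negbTE xyI).
  rewrite -[RHS](line' (x, y, 0)); apply: eq_integral => z _.
  rewrite andbA xyI andTb; case: ifP => // _; congr ((partial _ f _)%:E).
  by rewrite /e_ /=; congr (_, _, _); rewrite /= /GRing.scale/=; ring.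
Qed.

End SmoothFunctions.

(** * Trigonometric modes *)

Section TrigModes.
Context {R : realType}.
Local Notation point := (R * R * R)%type.
Local Notation periodic := Defs.periodic.

Implicit Types (f g h : point -> R) (k l : freq).

Definition kco k (j : 'I_3) : int :=
  if val j is 0 then k.1.1 else if val j is 1 then k.1.2 else k.2.

Definition wave k (j : 'I_3) : R := 2 * pi * (kco k j)%:~R.

(** The real trigonometric polynomials of a single frequency. Differentiation
    acts on the pair (c, d), and products are sums of two such functions, so
    that the Fourier analysis stays real. *)
Definition tr k (c d : R) (x : point) : R :=
  c * cos (phase k x) + d * sin (phase k x).

Lemma cosD2piz (a : R) (n : int) : cos (a + 2 * pi * n%:~R) = cos a.
Proof.
have H (b : R) (m : nat) : cos (b + 2 * pi * m%:R) = cos b.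
  rewrite -[RHS](periodicn (@cosD2pi R) m b); congr (cos (_ + _)).
  by rewrite -mulrnA -[RHS]mulr_natr natrM; ring.
case: n => n; first exact: H.
rewrite -(H (a + _) n.+1); congr cos; rewrite NegzE mulrNz; ring.
Qed.

Lemma sinD2piz (a : R) (n : int) : sin (a + 2 * pi * n%:~R) = sin a.
Proof. by rewrite -!cosBpihalf addrAC cosD2piz. Qed.

Lemma phase_lin k (s : R) (v x : point) :
  phase k (s *: v + x) = s * phase k v + phase k x.
Proof. by rewrite /phase /= /GRing.scale /=; ring. Qed.

Lemma phase_e k j : phase k (e_ j) = wave k j.
Proof.
rewrite /phase /wave /kco /e_.
by case: j => -[|[|[|//]]] i /=; rewrite ?mulr0 ?mulr1 ?addr0 ?add0r.
Qed.

Lemma phaseD k l (x : point) : phase (k + l) x = phase k x + phase l x.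
Proof. by rewrite /phase /= !intrD; ring. Qed.

Lemma phaseN k (x : point) : phase (- k) x = - phase k x.
Proof. by rewrite /phase /= !mulrNz; ring. Qed.

Lemma phase0 (x : point) : phase (0 : freq) x = 0.
Proof. by rewrite /phase /=; ring. Qed.

Lemma tr_periodic k c d : periodic (tr k c d).
Proof.
move=> j x; have -> : x + e_ j = 1 *: e_ j + x by rewrite scale1r addrC.
by rewrite /tr phase_lin mul1r phase_e [_ + phase k x]addrC cosD2piz sinD2piz.
Qed.

Lemma continuous_phase k : continuous (phase k : point -> R).
Proof.
move=> x; apply: cvgM; first exact: cvg_cst.
apply: cvgD; [apply: cvgD|]; apply: cvgM; try exact: cvg_cst.
- by apply: (@cvg_comp _ _ _ fst fst); [exact: cvg_fst|exact: cvg_fst].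
- by apply: (@cvg_comp _ _ _ fst snd); [exact: cvg_fst|exact: cvg_snd].
- exact: cvg_snd.
Qed.

Lemma tr_continuous k c d : continuous (tr k c d).
Proof.
move=> x; apply: cvgD; (apply: cvgM; first exact: cvg_cst).
  by apply: (@continuous_comp _ _ _ (phase k) (@cos R));
    [exact: continuous_phase | exact: continuous_cos].
by apply: (@continuous_comp _ _ _ (phase k) (@sin R));
    [exact: continuous_phase | exact: continuous_sin].
Qed.

Lemma tr_is_derive k c d j x :
  is_derive x (e_ j) (tr k c d) (tr k (wave k j * d) (- (wave k j * c)) x).
Proof.
pose th := phase k x; pose w := wave k j.
have trE (t : R) y : tr k c d (t *: e_ j + y) =
    c * cos (t * w + phase k y) + d * sin (t * w + phase k y).
  by rewrite /tr phase_lin phase_e.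
have lin (t : R) : is_derive t 1 (fun s : R => s * w + th) w.
  have -> : (fun s : R => s * w + th) = (w *: id + cst th).
    by apply/funext => s /=; rewrite mulrC.
  by apply: is_derive_eq; rewrite addr0 [LHS]mulr1.
have D : is_derive (0 : R) 1 (fun s : R => c * cos (s * w + th) + d * sin (s * w + th))
   (w * d * cos th + - (w * c) * sin th).
  have Dc := @is_derive1_comp R cos (fun s => s * w + th) 0 _ _ (is_derive_cos (0 * w + th)) (lin 0).
  have Ds := @is_derive1_comp R sin (fun s => s * w + th) 0 _ _ (is_derive_sin (0 * w + th)) (lin 0).
  have := is_deriveD (is_deriveZ c Dc) (is_deriveZ d Ds).
  move/is_derive_eq; apply; rewrite mul0r add0r /GRing.scale /=; ring.
have E : (fun h : R => h^-1 *: ((tr k c d \o shift x) (h *: e_ j) - tr k c d x)) =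
  (fun h : R => h^-1 *: (((fun s : R => c * cos (s * w + th) + d * sin (s * w + th)) \o shift 0) (h *: 1) -
     (c * cos (0 * w + th) + d * sin (0 * w + th)))).
  by apply/funext => h /=; rewrite trE mul0r add0r addr0 [h *: 1]mulr1.
have [D1 D2] := D; split; first by rewrite /derivable E.
by rewrite /derive E; exact: D2.
Qed.

Lemma partial_tr k c d j :
  partial j (tr k c d) = tr k (wave k j * d) (- (wave k j * c)).
Proof. by apply/funext => x; rewrite /partial; have [_ ->] := tr_is_derive k c d j x. Qed.

Lemma tr_derivable k c d j x : derivable (tr k c d) x (e_ j).
Proof. by have [] := tr_is_derive k c d j x. Qed.

Lemma L2_tr k c d : L2 (tr k c d).
Proof. exact: L2_continuous (@tr_continuous k c d) (@tr_periodic k c d). Qed.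

Lemma test_tr k c d : test_fun (tr k c d).
Proof.
split=> [|n]; first exact: tr_periodic.
elim: n c d => [|n IH] c d; first by split=> //; exact: tr_continuous.
split; first exact: tr_continuous.
by move=> j; split=> [x|]; [exact: tr_derivable|rewrite partial_tr].
Qed.

Lemma wave_eq0 k : (forall j, wave k j = 0) -> k = 0.
Proof.
move=> H; have kc0 j : kco k j = 0.
  have /eqP := H j; rewrite /wave !mulf_eq0 pnatr_eq0 /= (gt_eqF (pi_gt0 R)) /=.
  by rewrite intr_eq0 => /eqP.
case: k H kc0 => -[a b] c _ kc0.
have := kc0 (@Ordinal 3 0 isT); have := kc0 (@Ordinal 3 1 isT).
by have := kc0 (@Ordinal 3 2 isT); rewrite /kco /= => -> -> ->.
Qed.

(** A mode with k <> 0 is a partial derivative of a mode. *)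
Lemma torus_int_tr k c d : torus_int (tr k c d) = if k == 0 then c else 0.
Proof.
case: eqVneq => [->|k0].
  rewrite -[RHS](torus_int_cst c); apply: eq_torus_int => x.
  by rewrite /tr phase0 cos0 sin0 mulr1 mulr0 addr0.
have [j wj] : exists j, wave k j != 0.
  apply: contrapT => H; move/eqP: k0; apply; apply: wave_eq0 => j.
  by apply: contrapT => /eqP wj; apply: H; exists j.
have -> : tr k c d = partial j (tr k (- d / wave k j) (c / wave k j)).
  by rewrite partial_tr; congr tr; field.
apply: torus_int_partial; first exact: tr_periodic.
- by move=> x; exact: tr_derivable.
- by rewrite partial_tr; exact: tr_continuous.
Qed.

Lemma trM k a b l c d x : tr k a b x * tr l c d x =
  tr (k + l) ((a * c - b * d) / 2) ((a * d + b * c) / 2) x +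
  tr (k - l) ((a * c + b * d) / 2) ((b * c - a * d) / 2) x.
Proof.
by rewrite /tr !phaseD phaseN !cosD !sinD !cosN !sinN; field.
Qed.

Lemma ip_tr k a b l c d : ip (tr k a b) (tr l c d) =
  (if k == - l then (a * c - b * d) / 2 else 0) +
  (if k == l then (a * c + b * d) / 2 else 0).
Proof.
rewrite /ip (eq_torus_int (trM k a b l c d)) torus_intD; try exact: L2_integ (L2_tr _ _ _).
by rewrite !torus_int_tr addr_eq0 subr_eq0.
Qed.

End TrigModes.

(** * Fourier projections and Bessel's inequality *)

Definition range_int (n : nat) : seq int :=
  [seq i%:Z - n%:Z | i <- iota 0 (n.*2.+1)].

Lemma mem_range_int n (z : int) : (z \in range_int n) = (`|z| <= n)%N.
Proof.
apply/mapP/idP => [[i]|zn].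
  by rewrite mem_iota => /andP[_ ?] ->; lia.
by exists (absz (z + n%:Z)); [rewrite mem_iota; lia|lia].
Qed.

Lemma range_int_uniq n : uniq (range_int n).
Proof. by rewrite map_inj_uniq ?iota_uniq// => i j; lia. Qed.

Lemma size_range_int n : size (range_int n) = n.*2.+1.
Proof. by rewrite size_map size_iota. Qed.

(** Locked, so that simplification does not enumerate the frequencies. *)
HB.lock Definition box (n : nat) : seq freq :=
  [seq (p, c) | p <- [seq (a, b) | a <- range_int n, b <- range_int n],
                c <- range_int n].

Section FrequencyBoxes.

Lemma mem_box n (k : freq) :
  (k \in box n) = [&& (`|k.1.1| <= n)%N, (`|k.1.2| <= n)%N & (`|k.2| <= n)%N].
Proof.
rewrite unlock -!mem_range_int andbA; case: k => -[a b] c.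
apply/idP/andP.
  move=> /allpairsP[[p c']] [/allpairsP[[a' b']] [/= ha hb ->] /= hc] [-> -> ->].
  by split => //; apply/andP.
move=> [/andP[ha hb] hc]; apply/allpairsP; exists ((a, b), c); split => //.
by apply/allpairsP; exists (a, b).
Qed.

Lemma box_uniq n : uniq (box n).
Proof.
rewrite unlock; have u := range_int_uniq n.
apply: allpairs_uniq => //; last by move=> [p c] [q d] _ _ [-> ->].
by apply: allpairs_uniq => // -[a b] [c d] _ _ [-> ->].
Qed.

Lemma size_box n : size (box n) = (n.*2.+1 ^ 3)%N.
Proof. by rewrite unlock !size_allpairs size_range_int !expnS expn0; lia. Qed.

Lemma sub_box m n : (m <= n)%N -> {subset box m <= box n}.
Proof. by move=> mn k; rewrite !mem_box; lia. Qed.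

Lemma seq_sub_box (S : seq freq) : exists n, {subset S <= box n}.
Proof.
elim: S => [|k S [n Sn]]; first by exists 0%N.
exists (n + `|k.1.1| + `|k.1.2| + `|k.2|)%N => l.
rewrite in_cons => /predU1P[->|/Sn]; first by rewrite mem_box; lia.
by apply: sub_box; lia.
Qed.

(** A real Fourier sum takes each mode twice, at k and at -k. Over a set stable
    under k |-> -k the coefficients then come out without a factor. *)
Definition symset (S : seq freq) : Prop :=
  uniq S /\ forall k, (- k \in S) = (k \in S).

Lemma symset_box n : symset (box n).
Proof. by split; [exact: box_uniq | move=> k; rewrite !mem_box /=; lia]. Qed.

Definition shell m n := [seq k <- box n | k \notin box m].

Lemma symset_shell m n : symset (shell m n).
Proof.
have [_ hm] := symset_box m; have [_ hn] := symset_box n.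
split; first by rewrite filter_uniq// box_uniq.
by move=> k; rewrite !mem_filter hm hn.
Qed.

Lemma box_shell m n : (m <= n)%N -> perm_eq (box n) (box m ++ shell m n).
Proof.
move=> mn; apply: uniq_perm; first exact: box_uniq.
  rewrite cat_uniq box_uniq (symset_shell m n).1 andbT /=.
  by apply/hasPn => k; rewrite /shell mem_filter => /andP[].
move=> k; rewrite mem_cat /shell mem_filter; have /implyP := @sub_box _ _ mn k.
by case: (k \in box m) => //= ->.
Qed.

End FrequencyBoxes.

Section FourierSums.
Context {R : realType}.
Local Notation point := (R * R * R)%type.
Local Notation periodic := Defs.periodic.

Implicit Types (f g h : point -> R) (k l : freq) (a b : freq -> R)
  (S : seq freq).

Definition cf f k : R := ip f (tr k 1 0).
Definition sf f k : R := ip f (tr k 0 1).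

Lemma fourier_sqrE f k : fourier_sqr f k = cf f k ^+ 2 + sf f k ^+ 2.
Proof.
rewrite /fourier_sqr /cf /sf /ip; congr (_ ^+ 2 + _ ^+ 2);
  by apply: eq_torus_int => x; rewrite /tr; ring.
Qed.

Lemma ip_trE f k c d : L2 f -> ip f (tr k c d) = c * cf f k + d * sf f k.
Proof.
move=> lf; rewrite /cf /sf -!ipZr//; try exact: L2_tr.
rewrite -ipDr//; try exact/L2Z/L2_tr.
by congr ip; apply/funext => x; rewrite /tr; ring.
Qed.

Lemma tr_oppk k c d x : tr (- k) c d x = tr k c (- d) x :> R.
Proof. by rewrite /tr phaseN cosN sinN; ring. Qed.

Lemma cfN f k : cf f (- k) = cf f k.
Proof. by rewrite /cf; congr ip; apply/funext => x; rewrite tr_oppk oppr0. Qed.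

Lemma sfN f k : L2 f -> sf f (- k) = - sf f k.
Proof.
move=> lf; rewrite /sf -ipNr//; last exact: L2_tr.
by congr ip; apply/funext => x; rewrite /tr phaseN cosN sinN; ring.
Qed.

Lemma cfD f g k : L2 f -> L2 g -> cf (fun x => f x + g x) k = cf f k + cf g k.
Proof. by move=> lf lg; rewrite /cf ipDl//; exact: L2_tr. Qed.

Lemma sfD f g k : L2 f -> L2 g -> sf (fun x => f x + g x) k = sf f k + sf g k.
Proof. by move=> lf lg; rewrite /sf ipDl//; exact: L2_tr. Qed.

Lemma cfZ (c : R) f k : L2 f -> cf (fun x => c * f x) k = c * cf f k.
Proof. by move=> lf; rewrite /cf ipZl//; exact: L2_tr. Qed.

Lemma sfZ (c : R) f k : L2 f -> sf (fun x => c * f x) k = c * sf f k.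
Proof. by move=> lf; rewrite /sf ipZl//; exact: L2_tr. Qed.

(** The parities of the cosine and sine coefficients of a real function. *)
Definition real_coefs a b := forall k, a (- k) = a k /\ b (- k) = - b k.

Lemma real_coefs_L2 f : L2 f -> real_coefs (cf f) (sf f).
Proof. by move=> lf k; rewrite cfN sfN. Qed.

Definition psum S a b (x : point) : R := \sum_(k <- S) tr k (a k) (b k) x.

Lemma L2_psum S a b : L2 (psum S a b).
Proof. by apply: L2_sum => k; exact: L2_tr. Qed.

Lemma psum_periodic S a b : periodic (psum S a b).
Proof. by case: (L2_psum S a b). Qed.

Lemma psum_continuous S a b : continuous (psum S a b).
Proof.
rewrite /psum; elim: S => [|k S IH].
  by rewrite sum_fun0; exact: cst_continuous.
by rewrite sum_funE => x; apply: cvgD; [exact: tr_continuous|exact: IH].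
Qed.

Lemma psum_is_derive S a b j x : is_derive x (e_ j) (psum S a b)
  (psum S (fun k => wave k j * b k) (fun k => - (wave k j * a k)) x).
Proof.
rewrite /psum; elim: S => [|k S IH].
  by rewrite big_nil sum_fun0; exact: is_derive_cst.
rewrite sum_funE big_cons.
exact: is_deriveD (tr_is_derive k (a k) (b k) j x) IH.
Qed.

Lemma partial_psum S a b j : partial j (psum S a b) =
  psum S (fun k => wave k j * b k) (fun k => - (wave k j * a k)).
Proof.
by apply/funext => x; rewrite /partial; have [_ ->] := psum_is_derive S a b j x.
Qed.

Lemma test_psum S a b : test_fun (psum S a b).
Proof.
split=> [|n]; first exact: psum_periodic.
elim: n a b => [|n IH] a b; first by split=> //; exact: psum_continuous.
split; first exact: psum_continuous.
move=> j; split=> [x|]; last by rewrite partial_psum.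
by have [] := psum_is_derive S a b j x.
Qed.

Lemma ip_psum S a b f : L2 f ->
  ip f (psum S a b) = \sum_(k <- S) (a k * cf f k + b k * sf f k).
Proof.
move=> lf; rewrite ip_sumr// => [|k]; last exact: L2_tr.
by apply: eq_bigr => k _; rewrite ip_trE.
Qed.

Lemma sum_delta S k (F : freq -> R) : uniq S ->
  \sum_(l <- S) (if l == k then F l else 0) = if k \in S then F k else 0.
Proof.
move=> uS; case: ifPn => kS; last first.
  rewrite big_seq big1// => l lS; case: eqP => // lk.
  by move: kS; rewrite -lk lS.
rewrite (bigD1_seq k)//= eqxx big1 ?addr0// => l /negbTE ->.
by [].
Qed.

Lemma cf_psum S a b k : symset S -> real_coefs a b ->
  cf (psum S a b) k = if k \in S then a k else 0.
Proof.
move=> [uS sS] ab; rewrite /cf ip_suml => [|l|]; try exact: L2_tr.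
under eq_bigr do rewrite ip_tr.
rewrite big_split /= !(sum_delta _ (fun l => _)) // sS (ab k).1.
by case: ifP => _; field.
Qed.

Lemma sf_psum S a b k : symset S -> real_coefs a b ->
  sf (psum S a b) k = if k \in S then b k else 0.
Proof.
move=> [uS sS] ab; rewrite /sf ip_suml => [|l|]; try exact: L2_tr.
under eq_bigr do rewrite ip_tr.
rewrite big_split /= !(sum_delta _ (fun l => _)) // sS (ab k).2.
by case: ifP => _; field.
Qed.

(** The modes k and -k of a sum are not orthogonal to each other; the parity of
    the coefficients is what makes the Pythagorean identity hold. *)
Lemma nrm_psum S a b : symset S -> real_coefs a b ->
  nrm (psum S a b) ^+ 2 = \sum_(k <- S) (a k ^+ 2 + b k ^+ 2).
Proof.
move=> sS ab; rewrite nrm_sqr ip_psum; last exact: L2_psum.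
rewrite big_seq [RHS]big_seq; apply: eq_bigr => k kS.
by rewrite cf_psum// sf_psum// kS -!expr2.
Qed.

Definition fproj S f := psum S (cf f) (sf f).

Lemma nrm_proj S f : symset S -> L2 f ->
  nrm (fproj S f) ^+ 2 = \sum_(k <- S) fourier_sqr f k.
Proof.
move=> sS lf; rewrite nrm_psum//; last exact: real_coefs_L2.
by apply: eq_bigr => k _; rewrite fourier_sqrE.
Qed.

Lemma ip_proj S f g : L2 g ->
  ip g (fproj S f) = \sum_(k <- S) (cf f k * cf g k + sf f k * sf g k).
Proof. exact: ip_psum. Qed.

Lemma nrm_sub_proj S f : symset S -> L2 f ->
  nrm (fun x => f x - fproj S f x) ^+ 2 =
  nrm f ^+ 2 - \sum_(k <- S) fourier_sqr f k.
Proof.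
move=> sS lf; have lp : L2 (fproj S f) by exact: L2_psum.
have lB := L2B lf lp.
rewrite nrm_sqr ipBl// !ipBr// (ipC (fproj S f) f) -!nrm_sqr nrm_proj//.
have -> : ip f (fproj S f) = \sum_(k <- S) fourier_sqr f k.
  by rewrite ip_proj//; apply: eq_bigr => k _; rewrite fourier_sqrE -!expr2.
ring.
Qed.

Lemma bessel_sym S f : symset S -> L2 f ->
  \sum_(k <- S) fourier_sqr f k <= nrm f ^+ 2.
Proof. by move=> sS lf; rewrite -subr_ge0 -nrm_sub_proj// sqr_ge0. Qed.

Lemma fourier_sqr_ge0 f k : 0 <= fourier_sqr f k.
Proof. by rewrite addr_ge0 ?sqr_ge0. Qed.

Lemma le_sum_subset S S' (F : freq -> R) : (forall k, 0 <= F k) ->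
  uniq S -> {subset S <= S'} -> \sum_(k <- S) F k <= \sum_(k <- S') F k.
Proof.
move=> F0 uS SS'; elim: S uS S' SS' => [|k S IH] /= => [_ S' _|/andP[kS uS] S' SS'].
  by rewrite big_nil sumr_ge0.
have kS' : k \in S' by apply: SS'; rewrite mem_head.
rewrite (perm_big _ (perm_to_rem kS')) !big_cons lerD2l; apply: IH => // l lS.
have : l \in S' by apply: SS'; rewrite in_cons lS orbT.
rewrite (perm_mem (perm_to_rem kS')) in_cons => /predU1P[lk|//].
by move: kS; rewrite -lk lS.
Qed.

Lemma bessel S f : uniq S -> L2 f -> \sum_(k <- S) fourier_sqr f k <= nrm f ^+ 2.
Proof.
move=> uS lf; have [n Sn] := seq_sub_box S.
apply: le_trans (bessel_sym (symset_box n) lf).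
by apply: le_sum_subset => // k; exact: fourier_sqr_ge0.
Qed.

Lemma psum_shell m n a b x : (m <= n)%N ->
  psum (box n) a b x - psum (box m) a b x = psum (shell m n) a b x.
Proof.
by move=> mn; rewrite /psum (perm_big _ (box_shell mn)) big_cat /= addrAC subrr add0r.
Qed.

End FourierSums.

(** * Polynomial approximation of step functions *)

Section Threshold.
Context {R : realType}.
Implicit Types (t r a : R).

Lemma onem_exp_ge a n : 0 <= a <= 1 -> 1 - n%:R * a <= (1 - a) ^+ n.
Proof.
move=> /andP[a0 a1]; elim: n => [|n IH]; first by rewrite expr0 mul0r subr0.
rewrite exprS -natr1.
have h1 : (1 - a) * (1 - n%:R * a) <= (1 - a) * (1 - a) ^+ n.
  by rewrite ler_wpM2l// subr_ge0.
apply: le_trans h1; have : 0 <= n%:R * a ^+ 2 by rewrite mulr_ge0 ?sqr_ge0.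
nra.
Qed.

Lemma exp1D_ge a n : 0 <= a -> 1 + n%:R * a <= (1 + a) ^+ n.
Proof.
move=> a0; elim: n => [|n IH]; first by rewrite expr0 mul0r addr0.
rewrite exprS -natr1.
have h1 : (1 + a) * (1 + n%:R * a) <= (1 + a) * (1 + a) ^+ n.
  by rewrite ler_wpM2l// addr_ge0.
apply: le_trans h1; have : 0 <= n%:R * a ^+ 2 by rewrite mulr_ge0 ?sqr_ge0.
nra.
Qed.

Lemma onem_exp_le a n : 0 <= a <= 1 -> (1 - a) ^+ n <= (1 + n%:R * a)^-1.
Proof.
move=> /andP[a0 a1]; have p1 : 0 < 1 + n%:R * a.
  by rewrite ltr_pwDl// mulr_ge0.
rewrite -[leRHS]mul1r ler_pdivlMr//.
apply: (@le_trans _ _ ((1 - a) ^+ n * (1 + a) ^+ n)).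
  by rewrite ler_wpM2l ?exprn_ge0 ?subr_ge0// exp1D_ge.
rewrite -exprMn exprn_ile1//; have := sqr_ge0 a; nra.
Qed.

Lemma cvg_n_exp r : 0 <= r < 1 -> (fun n => n%:R * r ^+ n) @ \oo --> (0 : R).
Proof.
(* With r = s^2, the sequence n s^n is bounded and s^n tends to 0. *)
move=> /andP[r0 r1]; pose s := Num.sqrt r.
have s0 : 0 <= s by exact: sqrtr_ge0.
have s1 : s < 1 by rewrite -sqrtr1 ltr_sqrt.
have ss : s ^+ 2 = r by rewrite sqr_sqrtr.
have ns n : n%:R * s ^+ n <= (1 - s)^-1.
  rewrite -[leRHS]mul1r ler_pdivlMr ?subr_gt0//.
  have : n%:R * s ^+ n <= \sum_(i < n) s ^+ i.
    have -> : n%:R * s ^+ n = \sum_(i < n) s ^+ n.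
      by rewrite sumr_const card_ord mulr_natl.
    apply: ler_sum => i _; rewrite ler_wiXn2l//; first exact: ltW.
    exact: ltnW.
  move=> /(ler_wpM2r (x := 1 - s)) => /(_ _)/le_trans; apply; first by rewrite subr_ge0 ltW.
  by have := subrX1 s n; have := exprn_ge0 n s0; nra.
apply: (@squeeze_cvgr _ _ _ _ (fun=> 0) (fun n => (1 - s)^-1 * s ^+ n)).
- near=> n; rewrite mulr_ge0 ?exprn_ge0//= -ss exprAC expr2 mulrA.
  by rewrite ler_wpM2r ?exprn_ge0.
- exact: cvg_cst.
- rewrite -[X in _ --> X](mulr0 (1 - s)^-1); apply: cvgM; first exact: cvg_cst.
  by apply: cvg_expr; rewrite ger0_norm.
Unshelve. all: by end_near.
Qed.

(** The product n 2^n t^n decides: it tends to 0 when t < 1/2 and to infinity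
    when t >= 1/2, so that by Bernoulli's inequality the power tends to 1 in the
    first case and to 0 in the second. *)
Lemma cvg_threshold t : 0 <= t <= 1 ->
  (fun n => (1 - t ^+ n) ^+ (n * 2 ^ n)) @ \oo --> ((t < 2^-1)%R%:R : R).
Proof.
move=> /andP[t0 t1].
have tn n : 0 <= t ^+ n <= 1 by rewrite exprn_ge0// exprn_ile1.
have mE n : (n * 2 ^ n)%:R * t ^+ n = n%:R * (2 * t) ^+ n.
  by rewrite natrM natrX exprMn mulrA.
case: ltP => ht /=.
- apply: (@squeeze_cvgr _ _ _ _ (fun n => 1 - n%:R * (2 * t) ^+ n) (fun=> 1)).
  + near=> n; rewrite -mE onem_exp_ge//= exprn_ile1//.
    * by rewrite subr_ge0; case/andP: (tn n).
    * by rewrite lerBlDr lerDl; case/andP: (tn n).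
  + rewrite -[X in _ --> X]subr0; apply: cvgB; first exact: cvg_cst.
    by apply: cvg_n_exp; apply/andP; split; lra.
  + exact: cvg_cst.
- apply: (@squeeze_cvgr _ _ _ _ (fun=> 0) (fun n => n.+1%:R^-1)).
  + near=> n; rewrite exprn_ge0/=; last by rewrite subr_ge0; case/andP: (tn n).
    apply: le_trans (onem_exp_le _ (tn n)) _.
    have g0 : 0 < 1 + n%:R :> R by rewrite ltr_pwDl.
    rewrite mE -[n.+1%:R]natr1 [n%:R + 1]addrC lef_pV2 ?posrE//; last first.
      by rewrite ltr_pwDl// mulr_ge0// exprn_ge0// mulr_ge0.
    rewrite lerD2l ler_peMr// exprn_ege1//; lra.
  + exact: cvg_cst.
  + exact: cvg_harmonic.
Unshelve. all: by end_near.
Qed.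

End Threshold.

Section Annihilator.
Context {R : realType}.
Local Notation mR := (measurableTypeR R).
Local Notation mP := (mR * mR * mR)%type.
Local Notation point := (R * R * R)%type.

Implicit Types (f g h : point -> R) (k l : freq).

Definition annih f := integ f /\
  forall k c d, torus_int (fun x => f x * tr k c d x) = 0.

(** The multipliers that preserve orthogonality to all modes. They form an
    algebra containing the trigonometric polynomials and closed under bounded
    pointwise limits, hence reach the indicators of all measurable sets; and a
    function orthogonal to its own sign vanishes. *)
Definition mult h :=
  [/\ measurable_fun (cell : set mP) h,
      exists2 M : R, 0 <= M & forall x, cell x -> `|h x| <= M &
      forall f, annih f -> annih (fun x => f x * h x)].

Lemma integMb f h (M : R) : integ f -> measurable_fun (cell : set mP) h ->
  0 <= M -> (forall x, cell x -> `|h x| <= M) -> integ (fun x => f x * h x).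
Proof.
move=> If mh M0 hM; apply: (integ_le _ (integZ M If)).
  by apply: measurable_funM => //; exact: integ_meas.
move=> x cx; rewrite !normrM mulrC ler_wpM2r//.
by rewrite (ger0_norm M0) hM.
Qed.

Lemma cell_bd_tr k c d : exists2 M : R, 0 <= M &
  forall x : point, cell x -> `|tr k c d x| <= M.
Proof. exact: continuous_cell_bounded (@tr_continuous _ k c d). Qed.

Lemma meas_tr k c d : measurable_fun (cell : set mP) (tr k c d : point -> R).
Proof. exact: L2_meas (L2_tr k c d). Qed.

Lemma integ_tr f k c d : integ f -> integ (fun x => f x * tr k c d x).
Proof.
by move=> If; have [M M0 trM] := cell_bd_tr k c d; exact: integMb (meas_tr _ _ _) M0 trM.
Qed.

Lemma annihD f g : annih f -> annih g -> annih (fun x => f x + g x).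
Proof.
move=> [If af] [Ig ag]; split; first exact: integD.
move=> k c d; under eq_torus_int do rewrite mulrDl.
by rewrite torus_intD ?af ?ag ?addr0//; exact: integ_tr.
Qed.

Lemma annihZ (a : R) f : annih f -> annih (fun x => a * f x).
Proof.
move=> [If af]; split; first exact: integZ.
move=> k c d; under eq_torus_int do rewrite -mulrA.
by rewrite torus_intZ ?af ?mulr0//; exact: integ_tr.
Qed.

Lemma eq_annih f g : f =1 g -> annih f -> annih g.
Proof. by move=> /funext ->. Qed.

Lemma mult_cst (a : R) : mult (fun=> a).
Proof.
split; first exact: measurable_cst.
  by exists `|a|.
by move=> f /(annihZ a); apply: eq_annih => x; rewrite mulrC.
Qed.

Lemma mult_tr k c d : mult (tr k c d).
Proof.
split; [exact: meas_tr | exact: cell_bd_tr | move=> f [If af]].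
split; first exact: integ_tr.
move=> l c' d'; under eq_torus_int do rewrite -mulrA trM mulrDr.
by rewrite torus_intD ?af ?addr0//; exact: integ_tr.
Qed.

Lemma multD g h : mult g -> mult h -> mult (fun x => g x + h x).
Proof.
move=> [mg [M M0 gM] ag] [mh [N N0 hN] ah]; split.
- exact: measurable_funD.
- exists (M + N) => [|x cx]; first exact: addr_ge0.
  by rewrite (le_trans (ler_normD _ _))// lerD ?gM ?hN.
- move=> f af; apply: eq_annih (annihD (ag _ af) (ah _ af)) => x.
  by rewrite mulrDr.
Qed.

Lemma multM g h : mult g -> mult h -> mult (fun x => g x * h x).
Proof.
move=> [mg [M M0 gM] ag] [mh [N N0 hN] ah]; split.
- exact: measurable_funM.
- exists (M * N) => [|x cx]; first exact: mulr_ge0.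
  by rewrite normrM ler_pM// ?gM ?hN.
- move=> f af; apply: eq_annih (ah _ (ag _ af)) => x.
  by rewrite mulrA.
Qed.

Lemma multX h n : mult h -> mult (fun x => h x ^+ n).
Proof.
move=> mh; elim: n => [|n IH].
  by under [X in mult X]funext do rewrite expr0; exact: mult_cst.
by under [X in mult X]funext do rewrite exprS; exact: multM.
Qed.

Lemma multB g h : mult g -> mult h -> mult (fun x => g x - h x).
Proof.
move=> mg mh; have := multD mg (multM (mult_cst (-1)) mh).
by congr mult; apply/funext => x; rewrite mulN1r.
Qed.

Lemma eq_mult g h : (forall x, cell x -> g x = h x) -> mult g -> mult h.
Proof.
move=> gh [mg [M M0 gM] ag]; split.
- by apply: eq_measurable_fun mg => x /set_mem /gh.
- by exists M => // x cx; rewrite -gh// gM.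
move=> f /ag [Ig Ag]; split.
  by apply: eq_integrable Ig => // x /set_mem /gh /= ->.
move=> k c d; rewrite -[RHS](Ag k c d); apply: eq_Rintegral => x /set_mem /gh.
by move=> ->.
Qed.

(** Dominated convergence, a multiple of f being the dominating function. *)
Lemma mult_lim (h_ : nat -> point -> R) h (M : R) : 0 <= M ->
  (forall n, mult (h_ n)) -> (forall n x, cell x -> `|h_ n x| <= M) ->
  (forall x, cell x -> h_ n x @[n --> \oo] --> h x) -> mult h.
Proof.
move=> M0 mh hM hh.
have mhlim : measurable_fun (cell : set mP) h.
  by apply: (measurable_fun_cvg (h := h_)) => // n; case: (mh n).
have hMlim x : cell x -> `|h x| <= M.
  move=> cx; apply: (cvgr_to_le (cvg_norm (hh x cx))).
  by apply: nearW => n; exact: hM.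
split => //; first by exists M.
move=> f af; have [If _] := af; split; first exact: integMb mhlim M0 hMlim.
move=> k c d; pose F n x := f x * h_ n x * tr k c d x.
have IF n : integ (F n) by case: (mh n) => _ _ /(_ _ af) [? _]; exact: integ_tr.
have F0 n : torus_int (F n) = 0 by case: (mh n) => _ _ /(_ _ af) [_ ->].
have [N N0 trN] := cell_bd_tr k c d.
have Ifh : integ (fun x => f x * h x * tr k c d x).
  by apply: integ_tr; exact: integMb mhlim M0 hMlim.
have ig := integZ (M * N) If.
have := @dominated_convergence _ _ R vol cell measurable_cell
  (fun n x => (F n x)%:E) (fun x => (f x * h x * tr k c d x)%:E)
  (fun x => `|(M * N * f x)%:E|%E).
move=> [].
- by move=> n; exact: measurable_int (IF n).
- exact: measurable_int Ifh.
- apply: aeW => x cx; apply: cvg_EFin; first by apply: nearW.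
  apply: cvgM; last exact: cvg_cst.
  by apply: cvgM; [exact: cvg_cst|exact: hh].
- exact: integrable_abse ig.
- apply: aeW => x n cx /=; rewrite lee_fin /F !normrM (ger0_norm M0).
  rewrite (ger0_norm N0) [leRHS]mulrC -mulrA; apply: ler_wpM2l => //.
  by apply: ler_pM => //; [exact: hM|exact: trN].
move=> _ _; rewrite /torus_int /Rintegral => H.
have E n : (\int[vol]_(x in cell) (F n x)%:E = 0)%E.
  rewrite -[LHS](fineK (integrable_fin_num measurable_cell (IF n))).
  by have := F0 n; rewrite /torus_int /Rintegral => ->.
have {}H : (0%E : \bar R) @[_ --> \oo] -->
    (\int[vol]_(x in cell) (f x * h x * tr k c d x)%:E)%E.
  by move: H; apply: cvg_trans; apply: near_eq_cvg; apply: nearW => n; rewrite /= E.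
by rewrite -(cvg_lim (@ereal_hausdorff R) H) lim_cst.
Qed.

(** An affine map sends the values of p into [0, 1] and c to 1/2, where the
    polynomials of cvg_threshold apply. *)
Lemma mult_lt (p : point -> R) (c : R) : mult p -> mult (fun x => (p x < c)%R%:R).
Proof.
move=> mp; have [_ [M M0 pM] _] := mp.
pose K := 2 * (M + `|c| + 1); have K0 : 0 < K.
  by rewrite /K mulr_gt0// ltr_wpDl// addr_ge0.
pose t x := (p x - c) / K + 2^-1.
have mt : mult t.
  have := multD (multM (multB mp (mult_cst c)) (mult_cst K^-1)) (mult_cst 2^-1).
  exact.
have t01 x : cell x -> 0 <= t x <= 1.
  move=> cx; have := pM x cx; rewrite ler_norml => /andP[p1 p2].
  have := ler_norm c; have := ler_norm (- c); rewrite normrN => c1 c2.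
  have e1 : - 2^-1 <= (p x - c) / K by rewrite ler_pdivlMr// /K; lra.
  have e2 : (p x - c) / K <= 2^-1 by rewrite ler_pdivrMr// /K; lra.
  by rewrite /t; apply/andP; split; lra.
have tE x : (t x < 2^-1) = (p x < c).
  by rewrite /t -subr_lt0 addrK pmulr_llt0 ?invr_gt0// subr_lt0.
apply: (@mult_lim (fun n x => (1 - t x ^+ n) ^+ (n * 2 ^ n)) _ 1) => //.
- by move=> n; apply: multX; apply: multB; [exact: mult_cst|exact: multX].
- move=> n x /t01/andP[t0 t1]; have tn1 : t x ^+ n <= 1 by exact: exprn_ile1.
  have tn0 : 0 <= t x ^+ n by exact: exprn_ge0.
  by rewrite ger0_norm ?exprn_ge0 ?subr_ge0// exprn_ile1// ?subr_ge0// lerBlDr lerDl.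
- by move=> x /t01 tx; rewrite -tE; exact: cvg_threshold.
Qed.

End Annihilator.

(** * Completeness of the trigonometric system *)

Section Completeness.
Context {R : realType}.
Local Notation mR := (measurableTypeR R).
Local Notation mP := (mR * mR * mR)%type.
Local Notation point := (R * R * R)%type.

Implicit Types (f g h : point -> R) (k l : freq).

Definition ax0 : 'I_3 := @Ordinal 3 0 isT.
Definition ax1 : 'I_3 := @Ordinal 3 1 isT.
Definition ax2 : 'I_3 := @Ordinal 3 2 isT.

Definition pr (j : 'I_3) (x : point) : R :=
  if val j is 0 then x.1.1 else if val j is 1 then x.1.2 else x.2.

Definition efreq (j : 'I_3) : freq :=
  ((j == 0 :> nat)%:Z, (j == 1 :> nat)%:Z, (j == 2 :> nat)%:Z).

Lemma phase_efreq j (x : point) : phase (efreq j) x = 2 * pi * pr j x.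
Proof.
rewrite /phase /pr /efreq.
by case: j => -[|[|[|//]]] i /=; rewrite ?mul0r ?mul1r ?addr0 ?add0r.
Qed.

Lemma measurable_pr j : measurable_fun (setT : set mP) (pr j).
Proof.
case: j => -[|[|[|//]]] i; rewrite /pr /=.
- by apply: (measurableT_comp (f := fst) (g := fst)).
- by apply: (measurableT_comp (f := snd) (g := fst)).
- exact: measurable_snd.
Qed.

Lemma pr_cell j (x : point) : cell x -> 0 <= pr j x <= 1.
Proof.
case: x => -[x y] z [[/=]]; rewrite !in_itv /= => hx hy hz.
by case: j => -[|[|[|//]]] i; rewrite /pr /=.
Qed.

Lemma ae_pr_neq j (c : R) : {ae vol, forall x : point, pr j x != c}.
Proof.
have mc : measurable ([set c] : set mR) by exact: measurable_set1.
have lc : @leb R [set c] = 0%E by rewrite /leb/= lebesgue_measure_set1.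
pose A i : set mR := if i == j then [set c] else setT.
have mA i : measurable (A i) by rewrite /A; case: ifP.
exists (A ax0 `*` A ax1 `*` A ax2); split.
- by apply: measurableX => //; exact: measurableX.
- have vE : vol (A ax0 `*` A ax1 `*` A ax2) = (@leb R (A ax0) * @leb R (A ax1) * @leb R (A ax2))%E.
    rewrite /vol /= product_measure1E//; last exact: measurableX.
    by rewrite /area /= product_measure1E.
  rewrite vE /A; case: j {A mA vE} => -[|[|[|//]]] i.
  + by rewrite [ax0 == _]/= lc !mul0e.
  + by rewrite [ax1 == _]/= lc mule0 mul0e.
  + by rewrite [ax2 == _]/= lc mule0.
- move=> [[x y] z] /= /negP; rewrite negbK => /eqP.
  by rewrite /A; case: j {A mA} => -[|[|[|//]]] i; rewrite /pr /= => <-.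
Qed.

Lemma vol_aeI (P Q : point -> Prop) : {ae vol, forall x, P x} ->
  {ae vol, forall x, Q x} -> {ae vol, forall x, P x /\ Q x}.
Proof. exact: (@filterI _ _ (ae_filter_ringOfSetsType (R := R) vol)). Qed.

Lemma ae_mult g h (M : R) : measurable_fun (cell : set mP) h -> 0 <= M ->
  (forall x, cell x -> `|h x| <= M) ->
  {ae vol, forall x : point, cell x -> g x = h x} -> mult g -> mult h.
Proof.
move=> mh M0 hM gh [mg _ ag]; split => //; first by exists M.
move=> f af; have [If _] := af; have [Ig Ag] := ag _ af.
have Ih : integ (fun x => f x * h x) by exact: integMb mh M0 hM.
split=> // k c d; rewrite -(Ag k c d); congr fine.
apply: ae_eq_integral; first exact: measurable_cell.
- exact/measurable_int/integ_tr.
- exact/measurable_int/integ_tr.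
- by apply: vol_aeS gh => x gx cx /=; rewrite gx.
Qed.

Lemma sin_gt0_2pi (y : R) : 0 < y < 2^-1 -> 0 < sin (2 * pi * y).
Proof.
move=> /andP[y0 y1]; have p := pi_gt0 R; apply: sin_gt0_pi.
by apply/andP; split; [rewrite !mulr_gt0|nra].
Qed.

Lemma sin_lt0_2pi (y : R) : 2^-1 < y < 1 -> sin (2 * pi * y) < 0.
Proof.
move=> /andP[y0 y1]; rewrite -(subrK pi (2 * pi * y)) sinDpi oppr_lt0.
by have p := pi_gt0 R; apply: sin_gt0_pi; apply/andP; split; nra.
Qed.

Lemma ltr_cos_2pi (y z : R) : 0 <= y <= 2^-1 -> 0 <= z <= 2^-1 ->
  (cos (2 * pi * y) < cos (2 * pi * z)) = (z < y).
Proof.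
move=> /andP[y0 y1] /andP[z0 z1]; have p := pi_gt0 R.
rewrite ltr_cos ?in_itv /=; try by apply/andP; split; nra.
by rewrite ltr_pM2l// mulr_gt0.
Qed.

Lemma cos_2piB (y : R) : cos (2 * pi * (1 - y)) = cos (2 * pi * y).
Proof.
rewrite -cosN; have -> : - (2 * pi * (1 - y)) = 2 * pi * y + 2 * pi * (-1)%:~R.
  by rewrite mulrNz; ring.
exact: cosD2piz.
Qed.

Lemma indic_lt (p : point -> R) (a : R) (x : point) :
  \1_(p @^-1` `]-oo, a[) x = (p x < a)%R%:R :> R.
Proof.
rewrite indicE; congr (nat_of_bool _)%:R.
by apply/idP/idP; rewrite inE /= in_itv.
Qed.

Lemma meas_pr_lt j (a : R) :
  measurable_fun (cell : set mP) (fun x : mP => (pr j x < a)%R%:R : R).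
Proof.
have -> : (fun x : mP => (pr j x < a)%R%:R : R) = \1_(pr j @^-1` `]-oo, a[).
  by apply/funext => x; rewrite indic_lt.
apply: measurable_funTS; apply: measurable_indic.
rewrite -[X in measurable X]setTI; apply: measurable_pr => //.
Qed.

(** The sine of 2 pi x_j tells the two halves of the period apart, and the cosine
    is monotone on each: up to null sets, x_j < a is a Boolean combination of
    trigonometric inequalities. *)
Lemma mult_pr_lt j (a : R) : mult (fun x => (pr j x < a)%R%:R).
Proof.
pose k := efreq j.
have trs x : tr k 0 1 x = sin (2 * pi * pr j x) by rewrite /tr phase_efreq; ring.
have trc x : tr k 1 0 x = cos (2 * pi * pr j x) by rewrite /tr phase_efreq; ring.
have bd x : cell x -> `|(pr j x < a)%R%:R : R| <= 1.
  by move=> _; case: (_ < _); rewrite ?normr1 ?normr0.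
have aeP : {ae vol, forall x : point, [/\ pr j x != 0, pr j x != 1 & pr j x != 2^-1]}.
  have := vol_aeI (vol_aeI (ae_pr_neq j 0) (ae_pr_neq j 1)) (ae_pr_neq j 2^-1).
  by apply: vol_aeS => x [[]].
have m1 := mult_cst (1 : R).
have [a0|a0] := leP a 0.
  apply: eq_mult (mult_cst 0) => x /(pr_cell j)/andP[p0 p1].
  by rewrite ltNge (le_trans a0 p0).
have [a1|a1] := ltP 1 a.
  apply: eq_mult m1 => x /(pr_cell j)/andP[p0 p1].
  by rewrite (le_lt_trans p1 a1).
(* For a <= 1/2 the set is the part of the first half where the cosine exceeds
   its value at a; for a > 1/2 it is the complement of a part of the second. *)
have [ah|ah] := leP a 2^-1.
  have mm := multM (multB m1 (mult_lt 0 (mult_tr k 0 1)))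
               (mult_lt (- cos (2 * pi * a)) (mult_tr k (-1) 0)).
  apply: ae_mult (meas_pr_lt j a) ler01 bd _ mm.
  apply: vol_aeS aeP => x [n0 n1 nh] /(pr_cell j)/andP[p0 p1].
  have {n0}p0 : 0 < pr j x by rewrite lt_def n0.
  have {n1}p1 : pr j x < 1 by rewrite lt_neqAle n1.
  have -> : tr k (-1) 0 x = - cos (2 * pi * pr j x) by rewrite -trc /tr; ring.
  rewrite trs ltrN2; have [ph|ph] := ltP (pr j x) 2^-1.
    rewrite ltr_cos_2pi ?(ltW p0) ?(ltW ph) ?(ltW a0)//.
    by rewrite ltNge ltW ?sin_gt0_2pi ?p0//= subr0 mul1r.
  have {nh}ph : 2^-1 < pr j x by rewrite lt_def nh.
  rewrite sin_lt0_2pi ?ph//= subrr mul0r ltNge.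
  by rewrite (le_trans ah)// ltW.
have mm := multB m1 (multM (multB m1 (mult_lt 0 (mult_tr k 0 (-1))))
             (multB m1 (mult_lt (cos (2 * pi * a)) (mult_tr k 1 0)))).
apply: ae_mult (meas_pr_lt j a) ler01 bd _ mm.
apply: vol_aeS aeP => x [n0 n1 nh] /(pr_cell j)/andP[p0 p1].
have {n0}p0 : 0 < pr j x by rewrite lt_def n0.
have {n1}p1 : pr j x < 1 by rewrite lt_neqAle n1.
have -> : tr k 0 (-1) x = - sin (2 * pi * pr j x) by rewrite -trs /tr; ring.
rewrite trc oppr_lt0; have [ph|ph] := ltP (pr j x) 2^-1.
  rewrite sin_gt0_2pi ?p0//= subrr mul0r subr0.
  by rewrite (lt_trans ph ah).
have {nh}ph : 2^-1 < pr j x by rewrite lt_def nh.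
rewrite ltNge ltW ?sin_lt0_2pi ?ph//= subr0 mul1r opprB addrC subrK.
rewrite -cos_2piB -(cos_2piB a) ltr_cos_2pi; last 2 first.
- by apply/andP; split; lra.
- by apply/andP; split; lra.
by rewrite ltrD2l ltrN2.
Qed.

Definition mult_sets : set (set point) := [set S | mult (\1_S)].

(** Complements are differences with 1, and the indicator of a countable union is
    the limit of one minus a finite product. *)
Lemma sigma_algebra_mult_sets : sigma_algebra setT mult_sets.
Proof.
split.
- by rewrite /mult_sets /= indic0; exact: mult_cst.
- move=> A /= mA; apply: eq_mult (multB (mult_cst 1) mA) => x _.
  by rewrite setTD !indicE in_setC; case: (x \in A); rewrite ?subrr ?subr0.
move=> A mA.
pose P n (x : point) : R := \prod_(i < n) (1 - \1_(A i) x).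
have P01 n x : 0 <= P n x <= 1.
  apply/andP; split; first by apply: prodr_ge0 => i _; rewrite indicE; case: (_ \in _); rewrite ?subrr ?subr0.
  by apply: prodr_ile1 => i _; rewrite indicE; case: (_ \in _); rewrite ?subrr ?subr0 ?lexx ler01.
have mP n : mult (P n).
  rewrite /P; elim: n => [|n IH].
    by apply: eq_mult (mult_cst 1) => x _; rewrite big_ord0.
  apply: eq_mult (multM IH (multB (mult_cst 1) (mA n))) => x _.
  by rewrite big_ord_recr.
apply: (@mult_lim _ (fun n x => 1 - P n x) _ 1) => //.
- by move=> n; exact: multB (mult_cst 1) (mP n).
- move=> n x _; have /andP[? ?] := P01 n x.
  by rewrite ler_norml; apply/andP; split; lra.
move=> x _; rewrite indicE; have [/set_mem [i _ Aix]|nx] := boolP (x \in _).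
  apply: cvg_near_cst.
  exists i.+1 => // n /= ni; rewrite /P (bigD1 (Ordinal ni))//=.
  by rewrite indicE mem_set//= subrr mul0r subr0.
apply: cvg_near_cst.
apply: nearW => n; rewrite /P big1 ?subrr// => i _.
rewrite indicE memNset ?subr0// => Aix; move/negP: nx; apply.
by rewrite inE; exists i.
Qed.

(** The half-spaces x_j < a generate the measurable sets. *)
Lemma mult_measurable (S : set mP) : measurable S -> mult (\1_S).
Proof.
pose T := g_sigma_algebraType mult_sets.
have mT (A : set T) : measurable A -> mult (\1_A : point -> R).
  by rewrite /measurable /= sigma_algebra_id //; exact: sigma_algebra_mult_sets.
have mpr j : measurable_fun (setT : set T) (pr j : T -> mR).
  apply: (measurability _ (RGenCInfty.measurableE R)).
  move=> _ [_ [a ->] <-]; rewrite setTI.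
  have -> : pr j @^-1` `[a, +oo[ = ~` (pr j @^-1` `]-oo, a[) by rewrite preimage_setC setCitvl.
  apply: measurableC; apply: sub_sigma_algebra; rewrite /mult_sets /=.
  by apply: eq_mult (mult_pr_lt j a) => x _; rewrite indic_lt.
move=> mS; have -> : S = (fun x : T => ((pr ax0 x, pr ax1 x), pr ax2 x) : mP) @^-1` S.
  by apply/funext => -[[x y] z]; rewrite /preimage /= /pr /=.
apply: mT; rewrite -[X in measurable X]setTI.
have mid : measurable_fun (setT : set T)
    (fun x : T => ((pr ax0 x, pr ax1 x), pr ax2 x) : mP).
  by apply: measurable_fun_pair => //; apply: measurable_fun_pair.
exact: mid.
Qed.

(** The product of f with the indicator of f < 0 is still orthogonal to the
    constant mode; so |f| has integral 0. *)
Lemma annih_ae0 f : measurable_fun (setT : set mP) f -> annih f ->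
  {ae vol, forall x : point, cell x -> f x = 0}.
Proof.
move=> mf af; have [If _] := af.
have mlt : measurable ((f @^-1` `]-oo, 0[) : set mP).
  by rewrite -[X in measurable X]setTI; exact: mf.
have [_ _ /(_ _ af) [I1 A1]] := mult_measurable mlt.
have tr1 x : tr 0 1 0 x = 1 :> R by rewrite /tr phase0 cos0 mulr1 mul0r addr0.
have T1 : torus_int (fun x => f x * \1_(f @^-1` `]-oo, 0[) x) = 0.
  by rewrite -[RHS](A1 0 1 0); apply: eq_torus_int => x; rewrite tr1 mulr1.
have T0 : torus_int f = 0.
  by rewrite -[RHS](af.2 0 1 0); apply: eq_torus_int => x; rewrite tr1 mulr1.
have absE x : `|f x| = f x + (-2) * (f x * \1_(f @^-1` `]-oo, 0[) x).
  rewrite indic_lt; case: ltP => f0.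
    by rewrite ltr0_norm// mulr1; ring.
  by rewrite ger0_norm// mulr0 mulr0 addr0.
have Iabs : torus_int (fun x => `|f x|) = 0.
  rewrite (eq_torus_int absE) torus_intD//; last exact: integZ.
  by rewrite torus_intZ// T1 T0 mulr0 addr0.
have mfc := integ_meas If.
have := (ae_eq_integral_abs vol measurable_cell (f := EFin \o f) _).1.
move=> []; first exact/measurable_EFinP.
  have ii : integ (fun x => `|f x|) by exact: (@integrable_norm _ _ _ vol cell f If).
  rewrite -[LHS]fineK; first by rewrite -[X in _ = X%:E]Iabs.
  exact: (integrable_fin_num measurable_cell ii).
move=> N HN; exists N; case: HN => mN N0 sN; split => // x /= nx; apply: sN => /= H.
by apply: nx => cx; case: (H cx).
Qed.

Lemma fourier_coefs0 f : L2 f -> (forall k, cf f k = 0 /\ sf f k = 0) -> nrm f = 0.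
Proof.
move=> lf f0.
have af : annih f.
  split; first exact: L2_integ.
  move=> k c d; have [c0 s0] := f0 k.
  by have := ip_trE k c d lf; rewrite c0 s0 !mulr0 addr0.
have mf : measurable_fun (setT : set mP) f by case: lf.
have ae0 := annih_ae0 mf af.
rewrite /nrm; suff -> : ip f f = 0 by rewrite sqrtr0.
have <- : torus_int (fun=> 0 : R) = 0 by exact: torus_int_cst.
congr fine; apply: ae_eq_integral; first exact: measurable_cell.
- exact/measurable_int/L2_integM.
- exact: measurable_cst.
- by apply: vol_aeS ae0 => x + cx => /(_ cx) ->; rewrite mulr0.
Qed.

End Completeness.

(** * The Riesz-Fischer theorem *)

Section L2Complete.
Context {R : realType}.
Local Notation mR := (measurableTypeR R).
Local Notation mP := (mR * mR * mR)%type.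
Local Notation point := (R * R * R)%type.
Local Notation periodic := Defs.periodic.

Implicit Types (f g h : point -> R) (T : nat -> point -> R).

Definition l2cauchy T := forall e : R, 0 < e -> exists N, forall m n,
  (N <= m)%N -> (N <= n)%N -> nrm (fun x => T m x - T n x) <= e.

Definition l2cvg T g := forall e : R, 0 < e -> exists N, forall n,
  (N <= n)%N -> nrm (fun x => T n x - g x) <= e.

Lemma le_torus_int_nrm f : L2 f -> torus_int (fun x => `|f x|) <= nrm f.
Proof.
move=> lf; have la : L2 (fun x => `|f x|).
  case: (lf) => mf pf i1; split.
  - by apply: measurableT_comp => //; exact: normr_measurable.
  - by move=> j x; rewrite pf.
  - by apply: eq_integrable i1 => // x _; rewrite real_normK ?num_real.
have := ip_le_nrm la (L2_1 (R := R)).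
have -> : nrm (fun x => `|f x|) = nrm f.
  by congr Num.sqrt; apply: eq_torus_int => x; rewrite -!expr2 real_normK ?num_real.
have -> : nrm (fun=> 1 : R) = 1.
  rewrite /nrm /ip; under eq_torus_int do rewrite mulr1.
  by rewrite torus_int_cst sqrtr1.
by rewrite mulr1; congr (_ <= _); apply: eq_torus_int => x; rewrite mulr1.
Qed.

(** Along a subsequence with summable increments the series of increments has a
    finite integral, hence converges almost everywhere. *)
Lemma ae_cvg_fast T : (forall n, L2 (T n)) ->
  (forall i, nrm (fun x => T i.+1 x - T i x) <= (2 ^ i.+1)%:R^-1) ->
  {ae vol, forall x : point, cell x -> cvgn (fun i => T i x)}.
Proof.
move=> lT dT; pose d i (x : mP) : \bar R := (`|T i.+1 x - T i x|)%:E.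
have ld i := L2B (lT i.+1) (lT i).
have md i : measurable_fun (cell : set mP) (d i).
  apply/measurable_EFinP; apply: measurableT_comp; first exact: normr_measurable.
  exact: L2_meas (ld i).
have d0 i x : cell x -> (0 <= d i x)%E by move=> _; rewrite lee_fin.
have ii i : integ (fun x => `|T i.+1 x - T i x|).
  exact: (@integrable_norm _ _ _ vol cell _ (L2_integ (ld i))).
have Id : (\int[vol]_(x in cell) (\sum_(i <oo) d i x) <= 1)%E.
  rewrite (integral_nneseries vol measurable_cell md d0).
  apply: (@le_trans _ _ (\sum_(i <oo) ((1 / (2 ^ i.+1)%:R)%:E : \bar R))%E).
    apply: lee_nneseries => [i _ _|i _].
      by apply: integral_ge0 => x; exact: d0.
    rewrite -[leLHS](fineK (integrable_fin_num measurable_cell (ii i))) lee_fin.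
    by rewrite div1r; apply: le_trans (dT i); exact: le_torus_int_nrm.
  by apply: (epsilon_trick0 xpredT).
have mS : measurable_fun (cell : set mP) (fun x => \sum_(i <oo) d i x)%E.
  by apply: ge0_emeasurable_sum => // i x cx _; exact: d0.
have IS : vol.-integrable cell (fun x => \sum_(i <oo) d i x)%E.
  apply/integrableP; split => //; apply: le_lt_trans (ltry 1).
  apply: le_trans Id; rewrite le_eqVlt; apply/orP; left; apply/eqP.
  by apply: eq_integral => x /set_mem cx; rewrite gee0_abs// nneseries_ge0// => i _ _; exact: d0.
have := integrable_ae measurable_cell IS.
apply: vol_aeS => x + cx => /(_ cx) fin.
have [L EL] : exists L : R, (\sum_(i <oo) d i x = L%:E)%E.
  by exists (fine (\sum_(i <oo) d i x)%E); rewrite fineK.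
have : cvgn [normed series (fun i => T i.+1 x - T i x)].
  apply: nondecreasing_is_cvgn.
    by move=> m n mn; exact: (nondecreasing_series (u_ := fun i => `|T i.+1 x - T i x|)).
  exists L => _ [n _ <-]; rewrite -lee_fin -EL.
  rewrite /series /= -sumEFin.
  by apply: (nneseries_lim_ge n (u_ := fun i => d i x)) => i _ _; exact: d0.
move=> /normed_cvg /cvg_ex[/= l hl]; apply/cvg_ex; exists (l + T 0%N x).
have -> : (fun i => T i x) = (fun i => series (fun i => T i.+1 x - T i x) i + T 0%N x).
  by apply/funext => n; rewrite /series /= telescope_sumr// subrK.
by apply: cvgD => //; exact: cvg_cst.
Qed.

(** Fatou's lemma for the squares: a bound in norm along a sequence passes to its
    limit almost everywhere. *)
Lemma L2_fatou T g h (e : R) : (forall n, L2 (T n)) ->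
  measurable_fun (setT : set mP) g -> periodic g -> L2 h ->
  {ae vol, forall x : point, cell x -> T n x @[n --> \oo] --> g x} ->
  (exists N, forall n, (N <= n)%N -> nrm (fun x => T n x - h x) <= e) ->
  L2 (fun x => g x - h x) /\ nrm (fun x => g x - h x) <= e.
Proof.
move=> lT mg pg lh Tg [N HN].
have e0 : 0 <= e by apply: le_trans (HN N (leqnn _)); exact: nrm_ge0.
pose F n (x : mP) : \bar R := ((T n x - h x) ^+ 2)%:E.
have ld n := L2B (lT n) lh.
have mF n : measurable_fun (cell : set mP) (F n).
  by apply/measurable_EFinP; apply: measurable_funX; exact: L2_meas (ld n).
have F0 n x : cell x -> (0 <= F n x)%E by move=> _; rewrite lee_fin sqr_ge0.
have mgh : measurable_fun (setT : set mP) (fun x => g x - h x).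
  by apply: measurable_funB => //; case: lh.
have mgh2 : measurable_fun (cell : set mP) (fun x => (g x - h x) ^+ 2).
  by apply: measurable_funTS; exact: measurable_funX.
have Ige : (\int[vol]_(x in cell) ((g x - h x) ^+ 2)%:E <= (e ^+ 2)%:E)%E.
  have -> : (\int[vol]_(x in cell) ((g x - h x) ^+ 2)%:E =
      \int[vol]_(x in cell) limn_einf (F ^~ x))%E.
    apply: ae_eq_integral; first exact: measurable_cell.
    - exact/measurable_EFinP.
    - have -> : (fun x => limn_einf (F ^~ x)) =
          (fun x => - limn_esup (fun n => - F n x))%E.
        by apply/funext => x; rewrite -limn_einfN; congr limn_einf; apply/funext => n; rewrite -[LHS]oppeK.
      apply: measurableT_comp => //; apply: measurable_fun_limn_esup => n.
      exact: measurableT_comp.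
    - apply: vol_aeS Tg => x + cx => /(_ cx) Tgx.
      suff /cvg_limn_einf_sup[-> _] : F n x @[n --> \oo] --> ((g x - h x) ^+ 2)%:E by [].
      apply: cvg_EFin; first exact: nearW.
      apply: (@cvgM _ _ _ _ (fun n => T n x - h x) (fun n => T n x - h x));
        by apply: cvgB => //; exact: cvg_cst.
  apply: le_trans (fatou _ measurable_cell mF F0) _.
  apply: le_trans (limn_einf_sup _) _.
  apply: (@le_trans _ _ (ereal_sup [set (\int[vol]_(x in cell) F n x)%E | n in [set n | (N <= n)%N]])).
    by apply: ereal_inf_lbound; exists [set n | (N <= n)%N] => //; exists N.
  apply: ge_ereal_sup => _ [n Nn <-].
  have iF : integ (fun x => (T n x - h x) ^+ 2) by case: (ld n).
  rewrite -[leLHS](fineK (integrable_fin_num measurable_cell iF)) lee_fin.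
  have : nrm (fun x => T n x - h x) ^+ 2 <= e ^+ 2.
    by rewrite ler_sqr ?nnegrE ?nrm_ge0//; exact: HN.
  rewrite nrm_sqr.
  by congr (_ <= _); apply: eq_torus_int => x; rewrite expr2.
have lgh : L2 (fun x => g x - h x).
  split => //; first by move=> j x; case: lh => _ ph _; rewrite pg ph.
  apply/integrableP; split; first exact/measurable_EFinP.
  apply: le_lt_trans (ltry (e ^+ 2)); apply: le_trans Ige.
  rewrite le_eqVlt; apply/orP; left; apply/eqP; apply: eq_integral => x _ /=.
  by rewrite ger0_norm// sqr_ge0.
split => //; rewrite -ler_sqr ?nnegrE ?nrm_ge0// nrm_sqr -lee_fin.
apply: le_trans Ige; rewrite /ip /torus_int /Rintegral fineK.
  by rewrite le_eqVlt; apply/orP; left; apply/eqP; apply: eq_integral => x _; rewrite expr2.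
by apply: integrable_fin_num => //; exact: L2_integM.
Qed.

(** The limit is taken along a subsequence that converges almost everywhere. It is
    defined as an upper limit, which is measurable and periodic everywhere. *)
Lemma L2_complete T : (forall n, L2 (T n)) -> l2cauchy T ->
  exists2 g, L2 g & l2cvg T g.
Proof.
move=> lT cT.
have c0 i : 0 < (2 ^ i.+1)%:R^-1 :> R by rewrite invr_gt0 ltr0n expn_gt0.
have [n_ Hn] : {n_ : nat -> nat | forall i m n, (n_ i <= m)%N -> (n_ i <= n)%N ->
    nrm (fun x => T m x - T n x) <= (2 ^ i.+1)%:R^-1}.
  exists (fun i => projT1 (cid (cT _ (c0 i)))) => i.
  exact: projT2 (cid (cT _ (c0 i))).
(* The sum makes N nondecreasing and at least n_ i; the term i makes it unbounded. *)
pose N i := (i + \sum_(j < i.+1) n_ j)%N.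
have nN i : (n_ i <= N i)%N by rewrite /N big_ord_recr /=; lia.
have NS i : (N i <= N i.+1)%N by rewrite /N [in leqRHS]big_ord_recr /=; lia.
have iN i : (i <= N i)%N by rewrite /N; lia.
have lTN i := lT (N i).
have fast i : nrm (fun x => T (N i.+1) x - T (N i) x) <= (2 ^ i.+1)%:R^-1.
  by apply: Hn => //; apply: leq_trans (nN i) (NS i).
have aec := ae_cvg_fast lTN fast.
pose g x : R := fine (limn_esup (fun i => (T (N i) x)%:E)).
have mg : measurable_fun (setT : set mP) g.
  apply: measurableT_comp => //; apply: measurable_fun_limn_esup => i.
  by apply/measurable_EFinP; case: (lTN i).
have pg : periodic g.
  move=> j x; rewrite /g; congr (fine (limn_esup _)); apply/funext => i.
  by case: (lTN i) => _ -> _.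
have aeg : {ae vol, forall x : point, cell x -> T (N i) x @[i --> \oo] --> g x}.
  apply: vol_aeS aec => x + cx => /(_ cx) /cvg_ex[/= l hl]; rewrite /g.
  have hlE : (T (N i) x)%:E @[i --> \oo] --> l%:E.
    by apply: cvg_EFin => //; exact: nearW.
  by have [_ ->] := cvg_limn_einf_sup hlE.
have step (e : R) : 0 < e -> exists M, forall m, (M <= m)%N ->
    L2 (fun x => g x - T m x) /\ nrm (fun x => g x - T m x) <= e.
  move=> /cT[M HM]; exists M => m Mm; apply: (L2_fatou lTN mg pg (lT m) aeg).
  by exists M => n Mn; apply: HM => //; apply: leq_trans Mn (iN n).
have [M /(_ M (leqnn _))[lgM _]] := step 1 ltr01.
exists g.
  have := L2D lgM (lT M); congr L2; apply/funext => x; exact: subrK.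
move=> e /step[M' HM']; exists M' => n /HM'[_].
by rewrite nrm_subC.
Qed.

End L2Complete.

(** * Weak derivatives and Fourier coefficients *)

Section SobolevOne.
Context {R : realType}.
Local Notation point := (R * R * R)%type.
Local Notation periodic := Defs.periodic.

Implicit Types (f g h : point -> R) (k l : freq) (a b F : freq -> R).

Lemma l2cvg_ip T g h : (forall n, L2 (T n)) -> L2 g -> L2 h -> l2cvg T g ->
  ip (T n) h @[n --> \oo] --> ip g h.
Proof.
move=> lT lg lh Tg; apply/cvgrPdist_le => /= e e0.
have h0 : 0 < nrm h + 1 by rewrite ltr_pwDr// nrm_ge0.
have [N HN] := Tg (e / (nrm h + 1)) (divr_gt0 e0 h0).
exists N => // n /= Nn; rewrite distrC -ipBl//.
apply: le_trans (ip_CS (L2B (lT n) lg) lh) _.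
apply: (@le_trans _ _ (e / (nrm h + 1) * (nrm h + 1))).
  by apply: ler_pM; rewrite ?nrm_ge0 ?HN// lerDl.
by rewrite divfK// gt_eqF.
Qed.

Lemma l2cvg_cf T g k : (forall n, L2 (T n)) -> L2 g -> l2cvg T g ->
  cf (T n) k @[n --> \oo] --> cf g k.
Proof. by move=> lT lg Tg; apply: l2cvg_ip => //; exact: L2_tr. Qed.

Lemma l2cvg_sf T g k : (forall n, L2 (T n)) -> L2 g -> l2cvg T g ->
  sf (T n) k @[n --> \oo] --> sf g k.
Proof. by move=> lT lg Tg; apply: l2cvg_ip => //; exact: L2_tr. Qed.

Lemma shell_small F (M : R) : (forall k, 0 <= F k) ->
  (forall n, \sum_(k <- box n) F k <= M) ->
  forall e, 0 < e -> exists N, forall m n, (N <= m)%N -> (m <= n)%N ->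
    \sum_(k <- shell m n) F k <= e.
Proof.
move=> F0 FM e e0; pose s n := \sum_(k <- box n) F k.
have sE m n : (m <= n)%N -> s n = s m + \sum_(k <- shell m n) F k.
  by move=> mn; rewrite /s (perm_big _ (box_shell mn)) big_cat.
have sh0 m n : 0 <= \sum_(k <- shell m n) F k by exact: sumr_ge0.
have nd : nondecreasing_seq s by move=> m n mn; rewrite (sE m n mn) lerDl.
have cs : cvgn s by apply: nondecreasing_is_cvgn => //; exists M => _ [n _ <-]; exact: FM.
have sl := nondecreasing_cvgn_le nd cs.
have /cvgrPdist_le /(_ e e0) [N _ HN] : s @ \oo --> limn s by exact: cs.
exists N => m n Nm mn; have := HN m Nm; have := sl n; rewrite (sE m n mn) /= ler_norml.
by move=> h1 /andP[_ h2]; lra.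
Qed.

Lemma cvg_unique_near (u : nat -> R) (l c : R) : u @ \oo --> l ->
  (exists N, forall n, (N <= n)%N -> u n = c) -> l = c.
Proof.
move=> ul [N HN]; apply: (cvg_unique (@Rhausdorff R) ul).
by apply: cvg_near_cst; exists N => // n /= /HN.
Qed.

(** The partial sums are Cauchy because the squared norm of the difference of two of
    them is a sum of squared coefficients over a shell. *)
Lemma riesz_fischer a b (M : R) : real_coefs a b ->
  (forall n, \sum_(k <- box n) (a k ^+ 2 + b k ^+ 2) <= M) ->
  exists g, [/\ L2 g, l2cvg (fun n => psum (box n) a b) g &
    forall k, cf g k = a k /\ sf g k = b k].
Proof.
move=> ab sM; pose T n := psum (box n) a b.
have lT n : L2 (T n) by exact: L2_psum.
have F0 k : 0 <= a k ^+ 2 + b k ^+ 2 by rewrite addr_ge0 ?sqr_ge0.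
have cT : l2cauchy T.
  move=> e e0; have [N HN] := shell_small F0 sM (exprn_gt0 2 e0).
  have H m n : (N <= m)%N -> (m <= n)%N -> nrm (fun x => T n x - T m x) <= e.
    move=> Nm mn; rewrite -ler_sqr ?nnegrE ?nrm_ge0 ?(ltW e0)//.
    have -> : (fun x => T n x - T m x) = psum (shell m n) a b.
      by apply/funext => x; exact: psum_shell.
    by rewrite nrm_psum//; [exact: HN|exact: symset_shell].
  exists N => m n Nm Nn; case: (leqP m n) => mn; last exact: H (ltnW mn).
  by rewrite nrm_subC; exact: H.
have [g lg Tg] := L2_complete lT cT; exists g; split => // k.
have [N HN] := seq_sub_box [:: k].
have kin n : (N <= n)%N -> k \in box n.
  by move=> Nn; apply: (sub_box Nn); apply: HN; rewrite mem_head.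
split.
  apply: (cvg_unique_near (l2cvg_cf lT lg Tg)); exists N => n /kin kn.
  by rewrite cf_psum ?kn//; exact: symset_box.
apply: (cvg_unique_near (l2cvg_sf lT lg Tg)); exists N => n /kin kn.
by rewrite sf_psum ?kn//; exact: symset_box.
Qed.

Lemma coefs_inj f g : L2 f -> L2 g ->
  (forall k, cf f k = cf g k /\ sf f k = sf g k) -> nrm (fun x => f x - g x) = 0.
Proof.
move=> lf lg fg; apply: fourier_coefs0; first exact: L2B.
move=> k; have [c s] := fg k; rewrite /cf /sf !ipBl//; try exact: L2_tr.
by rewrite -/(cf f k) -/(cf g k) -/(sf f k) -/(sf g k) c s !subrr.
Qed.

(** By Bessel's inequality the projections converge to some function; it has the
    Fourier coefficients of f, and completeness identifies the two. *)
Lemma proj_cvg f : L2 f -> l2cvg (fun n => fproj (box n) f) f.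
Proof.
move=> lf; have [|g [lg Tg cg]] := riesz_fischer (M := nrm f ^+ 2) (real_coefs_L2 lf).
  move=> n; apply: le_trans (bessel_sym (symset_box n) lf).
  by rewrite le_eqVlt; apply/orP; left; apply/eqP/eq_bigr => k _; rewrite fourier_sqrE.
have gf : nrm (fun x => g x - f x) = 0 by exact: coefs_inj.
move=> e /Tg[N HN]; exists N => n /HN; apply: le_trans.
have lp : L2 (fproj (box n) f) by exact: L2_psum.
have := nrmD (L2B lp lg) (L2B lg lf); rewrite gf addr0; apply: le_trans.
rewrite le_eqVlt; apply/orP; left; apply/eqP; congr nrm; apply/funext => x.
by rewrite addrA subrK.
Qed.

(** This half of Parseval's identity, unlike Bessel's inequality, depends on
    completeness. *)
Lemma parseval_le f (B : R) : L2 f -> 0 <= B ->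
  (forall n, \sum_(k <- box n) fourier_sqr f k <= B) -> nrm f ^+ 2 <= B.
Proof.
move=> lf B0 fB; rewrite -[B]sqr_sqrtr// ler_sqr ?nnegrE ?nrm_ge0 ?sqrtr_ge0//.
apply/ler_addgt0Pr => e e0; have [N /(_ N (leqnn _)) HN] := proj_cvg lf e0.
have lp : L2 (fproj (box N) f) by exact: L2_psum.
have := nrmD lp (L2B lf lp).
have -> : (fun x => fproj (box N) f x + (f x - fproj (box N) f x)) = f.
  by apply/funext => x; rewrite addrC subrK.
move=> /le_trans; apply; rewrite nrm_subC in HN; apply: lerD => //.
rewrite -ler_sqr ?nnegrE ?nrm_ge0 ?sqrtr_ge0// (sqr_sqrtr B0) nrm_proj//.
exact: symset_box.
Qed.

Lemma test_fun_C1 (phi : point -> R) j : test_fun phi ->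
  [/\ periodic phi, continuous phi, forall x, derivable phi x (e_ j),
      continuous (partial j phi) & L2 phi].
Proof.
move=> [pp /(_ 1%N) [cp /(_ j) [dp [cdp _]]]]; split => //.
exact: L2_continuous.
Qed.

Lemma periodic_partial (phi : point -> R) j : periodic phi -> periodic (partial j phi).
Proof.
move=> pp i x; rewrite /partial /derive.
have -> : (fun h : R => h^-1 *: ((phi \o shift (x + e_ i)) (h *: e_ j) - phi (x + e_ i))) =
    (fun h : R => h^-1 *: ((phi \o shift x) (h *: e_ j) - phi x)).
  by apply/funext => h /=; rewrite addrA !pp.
by [].
Qed.

Lemma L2_partial (phi : point -> R) j : test_fun phi -> L2 (partial j phi).
Proof.
by move=> /(test_fun_C1 j)[pp _ _ cp _]; apply: L2_continuous => //; exact: periodic_partial.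
Qed.

Lemma ibp_test (phi psi : point -> R) j : test_fun phi -> test_fun psi ->
  ip phi (partial j psi) = - ip (partial j phi) psi.
Proof.
move=> tphi tpsi.
have [p1 c1 d1 cd1 l1] := test_fun_C1 j tphi.
have [p2 c2 d2 cd2 l2] := test_fun_C1 j tpsi.
have lp1 := L2_partial j tphi; have lp2 := L2_partial j tpsi.
have E : partial j (phi * psi) = (fun x => phi x * partial j psi x + partial j phi x * psi x).
  apply/funext => x; rewrite /partial deriveM//= /GRing.scale /=.
  by rewrite [psi x * _]mulrC.
have : torus_int (partial j (phi * psi)) = 0.
  apply: torus_int_partial.
  - by move=> i x /=; rewrite !fctE p1 p2.
  - by move=> x; apply: derivableM.
  - rewrite E => x; apply: cvgD; apply: cvgM;
      [exact: c1|exact: cd2|exact: cd1|exact: c2].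
rewrite E torus_intD; try exact: L2_integM.
by move/eqP; rewrite addr_eq0 => /eqP.
Qed.

Lemma waveN k j : wave (- k) j = - wave k j :> R.
Proof.
by rewrite /wave /kco; case: j => -[|[|[|//]]] i /=; rewrite mulrNz mulrN.
Qed.

Lemma wave_sqr k j : wave k j ^+ 2 <= bracket_sqr k :> R.
Proof.
rewrite /wave /bracket_sqr exprMn.
have p : 0 <= (2 * pi) ^+ 2 :> R by exact: sqr_ge0.
have h1 := sqr_ge0 (k.1.1%:~R : R); have h2 := sqr_ge0 (k.1.2%:~R : R).
have h3 := sqr_ge0 (k.2%:~R : R).
rewrite -[leLHS]add0r lerD// ler_wpM2l//.
by case: j => -[|[|[|//]]] i; rewrite /kco /=; lra.
Qed.

Lemma bracket_ge1 k : 1 <= bracket_sqr k :> R.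
Proof.
rewrite /bracket_sqr lerDl mulr_ge0 ?sqr_ge0// !addr_ge0 ?sqr_ge0//.
Qed.

Lemma bracket_gt0 k : 0 < bracket_sqr k :> R.
Proof. exact: lt_le_trans ltr01 (bracket_ge1 k). Qed.

(** Membership in the ball of radius B^(1/2) of H^p. Finite sums suffice to
    express it, which keeps Sobolev estimates among real numbers. *)
Definition hbound (p : nat) f (B : R) :=
  L2 f /\ forall n, \sum_(k <- box n) bracket_sqr k ^+ p * fourier_sqr f k <= B.

Lemma hbound_ge0 p f B : hbound p f B -> 0 <= B.
Proof.
move=> [_ /(_ 0%N)]; apply: le_trans; apply: sumr_ge0 => k _.
by rewrite mulr_ge0 ?fourier_sqr_ge0// exprn_ge0// ltW// bracket_gt0.
Qed.

Lemma hbound_le (p q : nat) f B : (p <= q)%N -> hbound q f B -> hbound p f B.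
Proof.
move=> pq [lf fB]; split=> // n; apply: le_trans (fB n); apply: ler_sum => k _.
by rewrite ler_wpM2r ?fourier_sqr_ge0// ler_weXn2l// bracket_ge1.
Qed.

Lemma hbound_nrm p f B : hbound p f B -> nrm f ^+ 2 <= B.
Proof.
move=> fB; have B0 := hbound_ge0 fB; have [lf f0] := hbound_le (leq0n p) fB.
apply: parseval_le => // n; apply: le_trans (f0 n).
by apply: ler_sum => k _; rewrite expr0 mul1r.
Qed.

Lemma fourier_sqrD f g k : L2 f -> L2 g ->
  fourier_sqr (fun x => f x + g x) k <= 2 * fourier_sqr f k + 2 * fourier_sqr g k.
Proof.
move=> lf lg; rewrite !fourier_sqrE cfD// sfD//.
have := sqr_ge0 (cf f k - cf g k); have := sqr_ge0 (sf f k - sf g k); nra.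
Qed.

Lemma hboundD p f g B C : hbound p f B -> hbound p g C ->
  hbound p (fun x => f x + g x) (2 * B + 2 * C).
Proof.
move=> [lf fB] [lg gC]; split; first exact: L2D.
move=> n; apply: (@le_trans _ _ (\sum_(k <- box n)
   (2 * (bracket_sqr k ^+ p * fourier_sqr f k) + 2 * (bracket_sqr k ^+ p * fourier_sqr g k)))).
  apply: ler_sum => k _; rewrite !(mulrCA 2) -mulrDr ler_wpM2l//.
    by rewrite exprn_ge0// ltW// bracket_gt0.
  exact: fourier_sqrD.
by rewrite big_split /= -!mulr_sumr lerD// ler_wpM2l.
Qed.

Lemma hboundZ p (c : R) f B : hbound p f B ->
  hbound p (fun x => c * f x) (c ^+ 2 * B).
Proof.
move=> [lf fB]; split; first exact: L2Z.
move=> n; apply: (@le_trans _ _ (c ^+ 2 * \sum_(k <- box n) bracket_sqr k ^+ p * fourier_sqr f k)).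
  rewrite le_eqVlt; apply/orP; left; apply/eqP; rewrite mulr_sumr.
  by apply: eq_bigr => k _; rewrite !fourier_sqrE cfZ// sfZ//; ring.
by rewrite ler_wpM2l// sqr_ge0.
Qed.

Lemma hboundB p f g B C : hbound p f B -> hbound p g C ->
  hbound p (fun x => f x - g x) (2 * B + 2 * C).
Proof.
move=> fB /(hboundZ (-1)); rewrite sqrrN expr1n mul1r => gC.
by have := hboundD fB gC; congr hbound; apply/funext => x; rewrite mulN1r.
Qed.

Definition H1 f := exists B, hbound 1 f B.

Lemma H1_L2 f : H1 f -> L2 f. Proof. by move=> [B []]. Qed.

Lemma H1Z (c : R) f : H1 f -> H1 (fun x => c * f x).
Proof. by move=> [B fB]; exists (c ^+ 2 * B); exact: hboundZ. Qed.

Lemma H1B f g : H1 f -> H1 g -> H1 (fun x => f x - g x).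
Proof. by move=> [B fB] [C gC]; exists (2 * B + 2 * C); exact: hboundB. Qed.

Lemma partial_proj S f j : partial j (fproj S f) =
  psum S (fun k => wave k j * sf f k) (fun k => - (wave k j * cf f k)).
Proof. exact: partial_psum. Qed.

(** The coefficients of the derivative are square summable, so they belong to some
    g; integration by parts against phi holds for the truncations of f and passes
    to the limit. *)
Lemma weak_partial_exists f j : H1 f -> exists g, weak_partial j f g.
Proof.
move=> [B [lf fB]].
pose a k : R := wave k j * sf f k; pose b k : R := - (wave k j * cf f k).
have ab : real_coefs a b.
  by move=> k; rewrite /a /b waveN sfN// cfN; split; ring.
have [|g [lg Tg cg]] := riesz_fischer (M := B) ab.
  move=> n; apply: le_trans (fB n); apply: ler_sum => k _.
  rewrite expr1 fourier_sqrE /a /b.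
  have -> : (wave k j * sf f k) ^+ 2 + (- (wave k j * cf f k)) ^+ 2 =
     wave k j ^+ 2 * (cf f k ^+ 2 + sf f k ^+ 2) by ring.
  by rewrite ler_wpM2r ?wave_sqr// addr_ge0 ?sqr_ge0.
exists g; split => // phi tphi.
have [_ _ _ _ lphi] := test_fun_C1 j tphi; have ldphi := L2_partial j tphi.
have lp n : L2 (fproj (box n) f) by exact: L2_psum.
have l1 := l2cvg_ip lp lf ldphi (proj_cvg lf).
have l2 := l2cvg_ip (fun n => L2_psum (box n) a b) lg lphi Tg.
apply: (cvg_unique (@Rhausdorff R) l1).
have -> : (fun n => ip (fproj (box n) f) (partial j phi)) =
          (fun n => - ip (psum (box n) a b) phi).
  apply/funext => n; rewrite ibp_test//; last exact: test_psum.
  by rewrite partial_proj.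
exact: cvgN.
Qed.

Lemma wD_weak f j : H1 f -> weak_partial j f (wD j f).
Proof. by move=> /(weak_partial_exists j) ex; exact: (xgetPex (fun=> 0) ex). Qed.

Lemma L2_wD f j : H1 f -> L2 (wD j f).
Proof. by move=> /(wD_weak j)[]. Qed.

Lemma wD_ibp f j (phi : point -> R) : H1 f -> test_fun phi ->
  ip f (partial j phi) = - ip (wD j f) phi.
Proof. by move=> /(wD_weak j)[_]; apply. Qed.

Lemma cf_wD f j k : H1 f -> cf (wD j f) k = wave k j * sf f k.
Proof.
move=> hf; have := wD_ibp j hf (test_tr k 1 0); rewrite partial_tr ip_trE; last exact: H1_L2.
by rewrite -/(cf _ k) => E; apply: oppr_inj; rewrite -E; ring.
Qed.

Lemma sf_wD f j k : H1 f -> sf (wD j f) k = - (wave k j * cf f k).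
Proof.
move=> hf; have := wD_ibp j hf (test_tr k 0 1); rewrite partial_tr ip_trE; last exact: H1_L2.
by rewrite -/(sf _ k) => E; apply: oppr_inj; rewrite -E; ring.
Qed.

Lemma proj_wD S f j : H1 f -> fproj S (wD j f) = partial j (fproj S f).
Proof.
move=> hf; rewrite partial_proj; apply/funext => x; apply: eq_bigr => k _.
by rewrite cf_wD// sf_wD.
Qed.

Lemma fourier_sqr_wD f j k : H1 f ->
  fourier_sqr (wD j f) k = wave k j ^+ 2 * fourier_sqr f k.
Proof. by move=> hf; rewrite !fourier_sqrE cf_wD// sf_wD//; ring. Qed.

Lemma hbound_wD p f j B : hbound p.+1 f B -> hbound p (wD j f) B.
Proof.
move=> fB; have hf : H1 f by exists B; exact: hbound_le fB.
case: (fB) => lf sB; split; first exact: L2_wD.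
move=> n; apply: le_trans (sB n); apply: ler_sum => k _.
rewrite fourier_sqr_wD// [in leRHS]exprSr -[in leRHS]mulrA ler_wpM2l//.
  by rewrite exprn_ge0// ltW// bracket_gt0.
by rewrite ler_wpM2r ?fourier_sqr_ge0// wave_sqr.
Qed.

Lemma nrm_wD_le f j B : hbound 1 f B -> nrm (wD j f) ^+ 2 <= B.
Proof. by move=> /(hbound_wD j)/hbound_nrm. Qed.

(** The weak derivative picks a representative, so that linearity holds in norm
    only. *)
Lemma wDB f g j : H1 f -> H1 g ->
  nrm (fun x => wD j (fun y => f y - g y) x - (wD j f x - wD j g x)) = 0.
Proof.
move=> hf hg; have hs := H1B hf hg; have lf := H1_L2 hf; have lg := H1_L2 hg.
have l1 := L2_wD j hf; have l2 := L2_wD j hg.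
apply: coefs_inj; [exact: L2_wD|exact: L2B|move=> k].
have sB (p q : point -> R) (lp : L2 p) (lq : L2 q) :
    cf (fun x => p x - q x) k = cf p k - cf q k /\ sf (fun x => p x - q x) k = sf p k - sf q k.
  by rewrite /cf /sf !ipBl//; exact: L2_tr.
have [e1 e2] := sB _ _ lf lg; have [e3 e4] := sB _ _ l1 l2.
by rewrite cf_wD// sf_wD// e1 e2 e3 e4 !cf_wD// !sf_wD//; split; ring.
Qed.

End SobolevOne.

(** * Trilinear estimates for trigonometric sums *)

Section Trilinear.
Context {R : realType}.
Local Notation point := (R * R * R)%type.

Implicit Types (f g h : point -> R) (k l : freq) (a b c d : freq -> R)
  (S : seq freq).

Lemma shell_bracket n k : k \in shell n n.+1 ->
  (n.+1%:R ^+ 2 : R) <= bracket_sqr k.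
Proof.
rewrite mem_filter !mem_box => /andP[].
rewrite !negb_and -!ltnNge => H _.
have sq (z : int) : (n < `|z|)%N -> n.+1%:R ^+ 2 <= (z%:~R : R) ^+ 2.
  move=> nz; have h : n.+1%:R <= `|z%:~R : R|.
    by rewrite -intr_norm -[n.+1%:R]/((n.+1%:Z)%:~R) ler_int; lia.
  by rewrite -[leRHS]real_normK ?num_real// !expr2; apply: ler_pM.
have p : 1 <= (2 * pi) ^+ 2 :> R.
  by rewrite exprn_ege1//; have := pi_ge2 R; lra.
have h1 := sqr_ge0 (k.1.1%:~R : R); have h2 := sqr_ge0 (k.1.2%:~R : R).
have h3 := sqr_ge0 (k.2%:~R : R).
rewrite /bracket_sqr; set s := _ + _ + _.
have ns : n.+1%:R ^+ 2 <= s.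
  rewrite /s; case/or3P : H => /sq; lra.
have s0 : 0 <= s by rewrite /s !addr_ge0.
nra.
Qed.

Lemma size_shell n : size (shell n n.+1) = (24 * n ^ 2 + 48 * n + 26)%N.
Proof.
have := perm_size (box_shell (leqnSn n)); rewrite size_cat !size_box.
rewrite -!muln2 => /eqP; rewrite eq_sym => /eqP E.
apply/eqP; rewrite -(eqn_add2l ((n * 2).+1 ^ 3)) E; apply/eqP; ring.
Qed.

(** The induction needs the stronger bound 53 - 52 / (n + 1): the shell at distance
    n + 1 has at most 26 (n + 1)^2 frequencies, of weight at most (n + 1)^-4. *)
Lemma sum_bracket_le n : \sum_(k <- box n) (bracket_sqr k : R) ^- 2 <= 53.
Proof.
suff : \sum_(k <- box n) (bracket_sqr k : R) ^- 2 <= 53 - 52 / n.+1%:R.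
  by move=> /le_trans; apply; rewrite lerBlDr lerDl divr_ge0.
have b1 k : (bracket_sqr k : R) ^- 2 <= 1.
  by rewrite invf_le1 ?exprn_gt0 ?bracket_gt0// exprn_ege1// bracket_ge1.
elim: n => [|n IH].
  have -> : 53 - 52 / 1%:R = 1 :> R by field.
  apply: (@le_trans _ _ (\sum_(k <- box 0) 1)); first exact: ler_sum.
  by rewrite big_const_seq count_predT size_box iter_addr addr0.
rewrite (perm_big _ (box_shell (leqnSn n))) big_cat /=.
have m0 : 0 < n.+1%:R :> R by rewrite ltr0n.
have sh : \sum_(k <- shell n n.+1) (bracket_sqr k : R) ^- 2 <= 26 / n.+1%:R ^+ 2.
  apply: (@le_trans _ _ (\sum_(k <- shell n n.+1) (n.+1%:R ^- 4 : R))).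
    rewrite big_seq [leRHS]big_seq; apply: ler_sum => k /shell_bracket kn.
    rewrite lef_pV2 ?posrE ?exprn_gt0 ?bracket_gt0//.
    rewrite (_ : 4 = 2 * 2)%N// exprM lerXn2r ?nnegrE ?exprn_ge0//.
    exact: ltW (bracket_gt0 k).
  rewrite big_const_seq count_predT size_shell iter_addr addr0 -[leLHS]mulr_natl.
  rewrite ler_pdivrMr ?exprn_gt0//.
  have -> : 26 / n.+1%:R ^+ 2 * n.+1%:R ^+ 4 = 26 * n.+1%:R ^+ 2 :> R by field; rewrite lt0r_neq0.
  rewrite -natrX -natrM ler_nat; lia.
apply: (le_trans (lerD IH sh)).
have m1 : 0 < n.+2%:R :> R by rewrite ltr0n.
have e2 : n.+2%:R = n.+1%:R + 1 :> R by rewrite natr1.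
have m2 : 1 <= n.+1%:R :> R by rewrite ler1n.
rewrite e2 in m1 *; move: (n.+1%:R : R) m0 m1 m2 => m m0 m1 m2.
rewrite -subr_ge0.
have -> : 53 - 52 / (m + 1) - (53 - 52 / m + 26 / m ^+ 2) =
   26 * (m - 1) / (m ^+ 2 * (m + 1)) by field; rewrite !lt0r_neq0.
by rewrite divr_ge0 ?mulr_ge0 ?subr_ge0 ?exprn_ge0// ltW.
Qed.

Lemma sum_bracket_uniq_le S : uniq S -> \sum_(k <- S) (bracket_sqr k : R) ^- 2 <= 53.
Proof.
move=> uS; have [n Sn] := seq_sub_box S; apply: le_trans (sum_bracket_le n).
apply: le_sum_subset => // k.
by rewrite invr_ge0 exprn_ge0// ltW// bracket_gt0.
Qed.

Lemma cs_step (e P x y X Y : R) : 0 <= x -> 0 <= y -> 0 <= X -> 0 <= Y ->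
  e ^+ 2 <= x * y -> P ^+ 2 <= X * Y -> (e + P) ^+ 2 <= (x + X) * (y + Y).
Proof.
move=> x0 y0 X0 Y0 h1 h2.
have h3 : (2 * e * P) ^+ 2 <= (x * Y + X * y) ^+ 2.
  have -> : (2 * e * P) ^+ 2 = 4 * (e ^+ 2 * P ^+ 2) by ring.
  have : e ^+ 2 * P ^+ 2 <= (x * y) * (X * Y) by apply: ler_pM; rewrite ?sqr_ge0.
  have := sqr_ge0 (x * Y - X * y); nra.
have h4 : 0 <= x * Y + X * y by rewrite addr_ge0// mulr_ge0.
have h5 : 2 * e * P <= x * Y + X * y.
  apply: le_trans (ler_norm _) _.
  by rewrite -ler_sqr ?nnegrE// real_normK ?num_real.
nra.
Qed.

Lemma sum_CS (I : Type) (s : seq I) (e x y : I -> R) :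
  (forall i, 0 <= x i) -> (forall i, 0 <= y i) ->
  (forall i, e i ^+ 2 <= x i * y i) ->
  (\sum_(i <- s) e i) ^+ 2 <= (\sum_(i <- s) x i) * (\sum_(i <- s) y i).
Proof.
move=> x0 y0 exy; elim: s => [|i s IH]; first by rewrite !big_nil expr0n mulr0.
by rewrite !big_cons; apply: cs_step => //; exact: sumr_ge0.
Qed.

Lemma ip_tr_sqr h m (p q : R) : L2 h ->
  ip h (tr m p q) ^+ 2 <= (p ^+ 2 + q ^+ 2) * fourier_sqr h m.
Proof.
move=> lh; rewrite ip_trE// fourier_sqrE.
have := sqr_ge0 (p * sf h m - q * cf h m); nra.
Qed.

Lemma bessel_shift h S (s : freq -> freq) : injective s -> uniq S -> L2 h ->
  \sum_(k <- S) fourier_sqr h (s k) <= nrm h ^+ 2.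
Proof.
move=> si uS lh; have := @bessel _ [seq s k | k <- S] h.
by rewrite big_map; apply => //; rewrite map_inj_uniq.
Qed.

(** The product is a sum over pairs (k, l) of modes at k + l and k - l. By
    Cauchy-Schwarz over the pairs, with weights of H^1, it remains to bound the sum
    of (|h(k + l)|^2 + |h(k - l)|^2) / (<k>^2 <l>^2), where <k>^2 = 1 + |2 pi k|^2 and
    h(k) is a Fourier coefficient. Replacing 1 / (<k>^2 <l>^2) by the mean of <k>^-4
    and <l>^-4 decouples the two sums; the sum of <k>^-4 converges in dimension
    three, and Bessel's inequality controls the other. *)
Lemma trilinear S S' a b c d h (B C : R) : uniq S -> uniq S' -> L2 h ->
  \sum_(k <- S) bracket_sqr k * (a k ^+ 2 + b k ^+ 2) <= B ->
  \sum_(k <- S') bracket_sqr k * (c k ^+ 2 + d k ^+ 2) <= C ->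
  ip (fun x => psum S a b x * psum S' c d x) h ^+ 2 <= 53 * B * C * nrm h ^+ 2.
Proof.
move=> uS uS' lh SB SC.
pose A k := a k ^+ 2 + b k ^+ 2; pose Cc k := c k ^+ 2 + d k ^+ 2.
pose H k : R := fourier_sqr h k; pose L k : R := bracket_sqr k.
pose E (kl : freq * freq) := ip h (fun x => tr kl.1 (a kl.1) (b kl.1) x * tr kl.2 (c kl.2) (d kl.2) x).
have L0 k : 0 < L k by exact: bracket_gt0.
have A0 k : 0 <= A k by rewrite addr_ge0 ?sqr_ge0.
have C0 k : 0 <= Cc k by rewrite addr_ge0 ?sqr_ge0.
have H0 k : 0 <= H k by exact: fourier_sqr_ge0.
pose x (kl : freq * freq) := L kl.1 * A kl.1 * (L kl.2 * Cc kl.2).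
pose y (kl : freq * freq) := (H (kl.1 + kl.2) + H (kl.1 - kl.2)) / (2 * (L kl.1 * L kl.2)).
have Exy kl : E kl ^+ 2 <= x kl * y kl.
  case: kl => k l; rewrite /E /x /y /=.
  under [X in ip h X]funext do rewrite trM.
  rewrite ipDr//; try exact: L2_tr.
  set p1 := (a k * c l - b k * d l) / 2; set q1 := (a k * d l + b k * c l) / 2.
  set p2 := (a k * c l + b k * d l) / 2; set q2 := (b k * c l - a k * d l) / 2.
  have h1 := ip_tr_sqr (k + l) p1 q1 lh; have h2 := ip_tr_sqr (k - l) p2 q2 lh.
  have e1 : p1 ^+ 2 + q1 ^+ 2 = A k * Cc l / 4 by rewrite /p1 /q1 /A /Cc; field.
  have e2 : p2 ^+ 2 + q2 ^+ 2 = A k * Cc l / 4 by rewrite /p2 /q2 /A /Cc; field.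
  rewrite e1 -/(H _) in h1; rewrite e2 -/(H _) in h2.
  have -> : L k * A k * (L l * Cc l) * ((H (k + l) + H (k - l)) / (2 * (L k * L l)))
     = 2 * (A k * Cc l / 4 * H (k + l) + A k * Cc l / 4 * H (k - l)).
    by field; rewrite !lt0r_neq0.
  have := sqr_ge0 (ip h (tr (k + l) p1 q1) - ip h (tr (k - l) p2 q2)); nra.
have EE : ip (fun x => psum S a b x * psum S' c d x) h =
    \sum_(kl <- [seq (k, l) | k <- S, l <- S']) E kl.
  rewrite big_allpairs ipC /E /=.
  have -> : (fun x => psum S a b x * psum S' c d x) = (fun x => \sum_(k <- S) \sum_(l <- S')
      tr k (a k) (b k) x * tr l (c l) (d l) x).
    apply/funext => z; rewrite /psum mulr_suml; apply: eq_bigr => k _.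
    by rewrite mulr_sumr.
  have ltt k l : L2 (fun x => tr k (a k) (b k) x * tr l (c l) (d l) x).
    by apply: L2_contM; [exact: L2_tr|exact: tr_continuous|exact: tr_periodic].
  rewrite ip_sumr//; last by move=> k; exact: L2_sum.
  by apply: eq_bigr => k _; rewrite ip_sumr.
have x0 kl : 0 <= x kl by rewrite /x !mulr_ge0// ltW.
have y0 kl : 0 <= y kl.
  apply: divr_ge0; first exact: (addr_ge0 (H0 _) (H0 _)).
  by apply: mulr_ge0 => //; apply: mulr_ge0; exact: ltW.
rewrite EE; apply: le_trans (sum_CS _ x0 y0 Exy) _.
have -> : 53 * B * C * nrm h ^+ 2 = (B * C) * (53 * nrm h ^+ 2) by ring.
apply: ler_pM; [exact: sumr_ge0|exact: sumr_ge0| |].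
  rewrite big_allpairs /x /=.
  under eq_bigr do rewrite -mulr_sumr.
  rewrite -mulr_suml; apply: ler_pM => //; apply: sumr_ge0 => k _;
    by apply: mulr_ge0 => //; exact: ltW.
pose W k : R := L k ^- 2.
have W0 k : 0 <= W k by rewrite invr_ge0 exprn_ge0// ltW.
have yW k l : y (k, l) <= (W k + W l) * (H (k + l) + H (k - l)) / 4.
  rewrite /y /=.
  have -> : (H (k + l) + H (k - l)) / (2 * (L k * L l)) =
     (2 * ((L k)^-1 * (L l)^-1)) * (H (k + l) + H (k - l)) / 4.
    by field; rewrite !lt0r_neq0.
  rewrite ler_wpM2r//; apply: ler_wpM2r; first exact: (addr_ge0 (H0 _) (H0 _)).
  rewrite /W -!exprVn.
  have := sqr_ge0 ((L k)^-1 - (L l)^-1); nra.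
have Sbd k : \sum_(l <- S') (H (k + l) + H (k - l)) <= 2 * nrm h ^+ 2.
  rewrite big_split /= mulr2n mulrDl !mul1r; apply: lerD.
    by apply: bessel_shift => //; exact: addrI.
  by apply: bessel_shift => // l l' /addrI /oppr_inj.
have Sbd' l : \sum_(k <- S) (H (k + l) + H (k - l)) <= 2 * nrm h ^+ 2.
  rewrite big_split /= mulr2n mulrDl !mul1r; apply: lerD.
    by apply: bessel_shift => //; exact: addIr.
  by apply: bessel_shift => //; exact: addIr.
have n0 : 0 <= nrm h ^+ 2 by exact: sqr_ge0.
have part1 : \sum_(k <- S) \sum_(l <- S') W k * (H (k + l) + H (k - l)) <= 53 * (2 * nrm h ^+ 2).
  apply: (@le_trans _ _ (\sum_(k <- S) W k * (2 * nrm h ^+ 2))).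
    by apply: ler_sum => k _; rewrite -mulr_sumr; apply: ler_wpM2l.
  rewrite -mulr_suml; apply: ler_wpM2r; first exact: mulr_ge0.
  exact: sum_bracket_uniq_le.
have part2 : \sum_(k <- S) \sum_(l <- S') W l * (H (k + l) + H (k - l)) <= 53 * (2 * nrm h ^+ 2).
  rewrite exchange_big /=.
  apply: (@le_trans _ _ (\sum_(l <- S') W l * (2 * nrm h ^+ 2))).
    by apply: ler_sum => l _; rewrite -mulr_sumr; apply: ler_wpM2l.
  rewrite -mulr_suml; apply: ler_wpM2r; first exact: mulr_ge0.
  exact: sum_bracket_uniq_le.
rewrite big_allpairs.
apply: (@le_trans _ _ (\sum_(k <- S) \sum_(l <- S')
   (W k * (H (k + l) + H (k - l)) + W l * (H (k + l) + H (k - l))) * 4^-1)).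
  by apply: ler_sum => k _; apply: ler_sum => l _; rewrite -mulrDl.
under eq_bigr do rewrite -mulr_suml big_split /=.
rewrite -mulr_suml big_split /=; lra.
Qed.

End Trilinear.

(** * The convective term *)

Section Convection.
Context {R : realType}.
Local Notation point := (R * R * R)%type.
Local Notation periodic := Defs.periodic.

Implicit Types (f g h : point -> R) (k l : freq) (a b c d : freq -> R)
  (S : seq freq).

Lemma cvg_sum_seq (X I : Type) (Fl : set_system X) (FF : Filter Fl) (s : seq I)
    (u : X -> I -> R) (l : I -> R) :
  (forall i, u n i @[n --> Fl] --> l i) ->
  \sum_(i <- s) u n i @[n --> Fl] --> \sum_(i <- s) l i.
Proof.
move=> ul; elim: s => [|i s IH].
  by under eq_fun do rewrite big_nil; rewrite big_nil; exact: cvg_cst.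
have -> : (fun n => \sum_(j <- i :: s) u n j) = (fun n => u n i + \sum_(j <- s) u n j).
  by apply/funext => n; rewrite big_cons.
by rewrite big_cons; exact: cvgD.
Qed.

Lemma l2cvg_ip2 (T T' : nat -> point -> R) g g' : (forall n, L2 (T n)) ->
  (forall n, L2 (T' n)) -> L2 g -> L2 g' -> l2cvg T g -> l2cvg T' g' ->
  ip (T n) (T' n) @[n --> \oo] --> ip g g'.
Proof.
move=> lT lT' lg lg' Tg Tg'; apply/cvgrPdist_le => /= e e0.
have p0 : 0 < nrm g' + 1 by rewrite ltr_pwDr// nrm_ge0.
have q0 : 0 < nrm g + 1 by rewrite ltr_pwDr// nrm_ge0.
have [N1 H1] := Tg (e / (2 * (nrm g' + 1))) (divr_gt0 e0 (mulr_gt0 (ltr0Sn R 1) p0)).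
have [N2 H2] := Tg' (e / (2 * (nrm g + 1))) (divr_gt0 e0 (mulr_gt0 (ltr0Sn R 1) q0)).
have [N3 H3] := Tg' 1 ltr01.
exists (N1 + N2 + N3)%N => // n /= Nn; rewrite distrC.
have h1 := H1 n ltac:(lia); have h2 := H2 n ltac:(lia); have h3 := H3 n ltac:(lia).
have ld := L2B (lT n) lg; have ld' := L2B (lT' n) lg'.
have -> : ip (T n) (T' n) - ip g g' =
  ip (fun x => T n x - g x) (T' n) + ip g (fun x => T' n x - g' x).
  by rewrite ipBl// ipBr//; ring.
have nT : nrm (T' n) <= nrm g' + 1.
  have := nrmD lg' ld'; have -> : (fun x => g' x + (T' n x - g' x)) = T' n.
    by apply/funext => x; rewrite addrC subrK.
  by move=> /le_trans; apply; rewrite lerD2l.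
apply: le_trans (ler_normD _ _) _; rewrite [leRHS](splitr e); apply: lerD.
  apply: le_trans (ip_CS ld (lT' n)) _.
  apply: (@le_trans _ _ (e / (2 * (nrm g' + 1)) * (nrm g' + 1))).
    by apply: ler_pM => //; exact: nrm_ge0.
  by rewrite le_eqVlt; apply/orP; left; apply/eqP; field; rewrite lt0r_neq0.
apply: le_trans (ip_CS lg ld') _; rewrite mulrC.
apply: (@le_trans _ _ (e / (2 * (nrm g + 1)) * (nrm g + 1))).
  by apply: ler_pM => //; [exact: nrm_ge0|exact: nrm_ge0|rewrite lerDl].
by rewrite le_eqVlt; apply/orP; left; apply/eqP; field; rewrite lt0r_neq0.
Qed.

Lemma l2cvg_mul (phi : point -> R) (T : nat -> point -> R) g :
  continuous phi -> periodic phi -> (forall n, L2 (T n)) -> L2 g -> l2cvg T g ->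
  l2cvg (fun n x => phi x * T n x) (fun x => phi x * g x).
Proof.
move=> cp pp lT lg Tg e e0; have [M M0 pM] := continuous_cell_bounded cp.
have M1 : 0 < M + 1 by rewrite ltr_pwDr.
have [N HN] := Tg (e / (M + 1)) (divr_gt0 e0 M1); exists N => n /HN h.
have -> : (fun x => phi x * T n x - phi x * g x) = (fun x => phi x * (T n x - g x)).
  by apply/funext => x; rewrite mulrBr.
apply: le_trans (nrm_le_bd (L2B (lT n) lg) (continuous_measurable3 cp) pp M0 pM) _.
apply: (@le_trans _ _ ((M + 1) * (e / (M + 1)))).
  by apply: ler_pM => //; [exact: nrm_ge0|rewrite lerDl].
by rewrite mulrC divfK// gt_eqF.
Qed.

Lemma tr_sqr_le k (p q : R) (x : point) : tr k p q x ^+ 2 <= p ^+ 2 + q ^+ 2.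
Proof.
rewrite /tr; have := cos2Dsin2 (phase k x : R).
move: (cos _) (sin _) => s t st; have := sqr_ge0 (p * t - q * s); nra.
Qed.

(** Cauchy-Schwarz between <k>^-2 and <k>^2 |g(k)|: the Sobolev embedding of H^2
    into the bounded functions in dimension three. *)
Lemma fproj_sup S g (B : R) (x : point) : uniq S -> hbound 2 g B ->
  fproj S g x ^+ 2 <= 53 * B.
Proof.
move=> uS gB; have B0 := hbound_ge0 gB; case: gB => lg sB.
have L0 k : 0 < (bracket_sqr k : R) by exact: bracket_gt0.
have H0 k : 0 <= bracket_sqr k ^+ 2 * fourier_sqr g k.
  by apply: mulr_ge0; [exact: sqr_ge0|exact: fourier_sqr_ge0].
apply: (@le_trans _ _ ((\sum_(k <- S) (bracket_sqr k : R) ^- 2) *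
   (\sum_(k <- S) bracket_sqr k ^+ 2 * fourier_sqr g k))).
  apply: sum_CS => // k; first by rewrite invr_ge0 sqr_ge0.
  rewrite mulrA mulVf ?mul1r ?expf_neq0 ?lt0r_neq0// fourier_sqrE.
  exact: tr_sqr_le.
apply: ler_pM.
- by apply: sumr_ge0 => k _; rewrite invr_ge0 sqr_ge0.
- exact: sumr_ge0.
- exact: sum_bracket_uniq_le.
have [n Sn] := seq_sub_box S; apply: le_trans (sB n).
exact: le_sum_subset.
Qed.

(** The sup bound applies to the truncations of g, and the pairing with them tends
    to the pairing with g. *)
Lemma ip_mul_sup (phi w g : point -> R) (B : R) : continuous phi -> periodic phi ->
  L2 w -> hbound 2 g B ->
  `|ip (fun x => phi x * w x) g| <= Num.sqrt (53 * B) * nrm w * nrm phi.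
Proof.
move=> cp pp lw gB; have B0 := hbound_ge0 gB; have lg : L2 g by case: gB.
have lphi := L2_continuous cp pp; have lpw := L2_contM lw cp pp.
have lP n : L2 (fproj (box n) g) by exact: L2_psum.
have := l2cvg_ip lP lg lpw (proj_cvg lg); rewrite (ipC g) => /cvg_norm h.
apply: (cvgr_to_le h); apply: nearW => n.
have -> : ip (fproj (box n) g) (fun x => phi x * w x) =
    ip (fun x => fproj (box n) g x * w x) phi.
  by apply: eq_torus_int => x; ring.
have cP := psum_continuous (S := box n) (a := cf g) (b := sf g).
have pP := psum_periodic (box n) (cf g) (sf g).
apply: le_trans (ip_CS (L2_contM lw cP pP) lphi) _.
apply: ler_wpM2r; first exact: nrm_ge0.
apply: nrm_le_bd => //; [exact: continuous_measurable3 cP|].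
move=> x _; rewrite -sqrtr_sqr; apply: ler_wsqrtr.
by apply: fproj_sup => //; exact: box_uniq.
Qed.

(** The divergence condition mode by mode, a form which passes to truncations and
    differences without exceptional null sets. *)
Definition solenoidal (u : @vfield R) := forall k,
  \sum_(j < 3) cf (wD j (u j)) k = 0 /\ \sum_(j < 3) sf (wD j (u j)) k = 0.

Lemma div_free_solenoidal (u : @vfield R) :
  (forall j, H1 (u j)) -> div_free u -> solenoidal u.
Proof.
move=> hu du k; have lD j : L2 (wD j (u j)) by exact: L2_wD.
have ls : L2 (fun x => \sum_(j < 3) wD j (u j) x) by exact: L2_sum.
have z : nrm (fun x => \sum_(j < 3) wD j (u j) x) = 0.
  have := ae_nrm0 ls (L2_0 (R := R)) du.
  by congr (_ = _); congr nrm; apply/funext => x; rewrite subr0.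
by split; rewrite /cf /sf -ip_suml//; try exact: L2_tr;
   apply: nrm0_ip => //; exact: L2_tr.
Qed.

Lemma solenoidalB (u v : @vfield R) : (forall j, H1 (u j)) -> (forall j, H1 (v j)) ->
  solenoidal u -> solenoidal v -> solenoidal (fun i x => u i x - v i x).
Proof.
move=> hu hv su sv k; have [c1 s1] := su k; have [c2 s2] := sv k.
have lu j := H1_L2 (hu j); have lv j := H1_L2 (hv j).
have sub00 (x y : R) : x = 0 -> y = 0 -> x - y = 0 by move=> -> ->; rewrite subrr.
split.
  rewrite -[RHS](sub00 _ _ c1 c2) -sumrB; apply: eq_bigr => j _.
  by rewrite !cf_wD//; [rewrite /sf ipBl//; [ring|exact: L2_tr]|exact: H1B].
rewrite -[RHS](sub00 _ _ s1 s2) -sumrB; apply: eq_bigr => j _.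
by rewrite !sf_wD//; [rewrite /cf ipBl//; [ring|exact: L2_tr]|exact: H1B].
Qed.

Lemma div_free_fproj (u : @vfield R) S x : (forall j, H1 (u j)) -> solenoidal u ->
  \sum_(j < 3) partial j (fproj S (u j)) x = 0.
Proof.
move=> hu du; under eq_bigr do rewrite -proj_wD//.
rewrite /fproj /psum exchange_big /= big1_seq// => k _; rewrite /tr big_split /=.
have [c0 s0] := du k.
by rewrite -!mulr_suml c0 s0 !mul0r addr0.
Qed.

Lemma psum_derivable S a b j (x : point) : derivable (psum S a b) x (e_ j).
Proof. by have [] := psum_is_derive S a b j x. Qed.

Lemma partial_psum_continuous S a b j : continuous (partial j (psum S a b)).
Proof. by rewrite partial_psum; exact: psum_continuous. Qed.

(** For F a Fourier sum and U the truncated field, 2 F U_j d_j F equals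
    d_j (F^2 U_j) - F^2 d_j U_j. The first term has integral 0, and the second
    sums over j to a multiple of the divergence of U. *)
Lemma convection_skew (u : @vfield R) S S' a b :
  (forall j, H1 (u j)) -> solenoidal u ->
  \sum_(j < 3) ip (fun x => psum S' a b x * fproj S (u j) x)
                  (partial j (psum S' a b)) = 0.
Proof.
move=> hu du; set F := psum S' a b.
have cF : continuous F by exact: psum_continuous.
have pF : periodic F by exact: psum_periodic.
have lF : L2 F by exact: L2_psum.
have dF j x : derivable F x (e_ j) by exact: psum_derivable.
have cdF j : continuous (partial j F) by exact: partial_psum_continuous.
have lDF j : L2 (partial j F) by apply: L2_partial; exact: test_psum.
have key j : 2 * ip (fun x => F x * fproj S (u j) x) (partial j F) =
    - ip (fun x => F x * F x) (partial j (fproj S (u j))).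
  set U := fproj S (u j).
  have cU : continuous U by exact: psum_continuous.
  have pU : periodic U by exact: psum_periodic.
  have lU : L2 U by exact: L2_psum.
  have dU x : derivable U x (e_ j) by exact: psum_derivable.
  have cdU : continuous (partial j U) by exact: partial_psum_continuous.
  have lDU : L2 (partial j U) by apply: L2_partial; exact: test_psum.
  have E : partial j (F * F * U) = (fun x => 2 * (F x * U x * partial j F x)
       + F x * F x * partial j U x).
    apply/funext => x; rewrite /partial deriveM//=; last exact: derivableM.
    by rewrite deriveM//= /GRing.scale /= !fctE; ring.
  have lFU : L2 (fun x => F x * U x) by exact: L2_contM.
  have lFF : L2 (fun x => F x * F x) by exact: L2_contM.
  have : torus_int (partial j (F * F * U)) = 0.
    apply: torus_int_partial.
    - by move=> i x /=; rewrite !fctE pF pU.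
    - by move=> x; apply: derivableM => //; exact: derivableM.
    - rewrite E => x; apply: cvgD.
        apply: cvgM; first exact: cvg_cst.
        by apply: cvgM; [apply: cvgM; [exact: cF|exact: cU]|exact: cdF].
      by apply: cvgM; [apply: cvgM; exact: cF|exact: cdU].
  rewrite E torus_intD; last 2 first.
  - exact: integZ (L2_integM lFU (lDF j)).
  - exact: L2_integM lFF lDU.
  rewrite torus_intZ; last exact: L2_integM lFU (lDF j).
  by move=> /eqP; rewrite addr_eq0 => /eqP.
have : 2 * \sum_(j < 3) ip (fun x => F x * fproj S (u j) x) (partial j F) = 0.
  rewrite mulr_sumr; under eq_bigr do rewrite key.
  have lFF : L2 (fun x => F x * F x) by exact: L2_contM.
  rewrite sumrN -ip_sumr//; last first.
    by move=> j; apply: L2_partial; exact: test_psum.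
  have -> : (fun x => \sum_(j < 3) partial j (fproj S (u j)) x) = (fun=> 0).
    by apply/funext => x; exact: div_free_fproj.
  by rewrite ipC ip0l oppr0.
by move/eqP; rewrite mulf_eq0 pnatr_eq0 /= => /eqP.
Qed.

(** (u . grad) f is orthogonal to f when u is divergence free; as it need not be
    square integrable, the pairing is the limit along truncations of f. To see
    that it vanishes, truncate everything at some M > N. By skew-symmetry only the
    part of f between N and M contributes; it is small in H^1, and the trilinear
    estimate is uniform in M. *)
Lemma convection_limit (u : @vfield R) f :
  (forall j, H1 (u j)) -> solenoidal u -> H1 f ->
  \sum_(j < 3) ip (fun x => fproj (box N) f x * u j x) (wD j f)
    @[N --> \oo] --> 0.
Proof.
move=> hu du hf.
have [Bu HBu] : {Bu : 'I_3 -> R | forall j, hbound 1 (u j) (Bu j)}.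
  by exists (fun j => projT1 (cid (hu j))) => j; exact: projT2 (cid (hu j)).
have [B fB] := hf; have B0 := hbound_ge0 fB.
pose Bs := \sum_(j < 3) Bu j.
have Bu0 j : 0 <= Bu j by exact: hbound_ge0 (HBu j).
have BuB j : Bu j <= Bs by rewrite /Bs (bigD1 j)//= lerDl sumr_ge0.
have Bs0 : 0 <= Bs by exact: sumr_ge0.
have lf := H1_L2 hf; have lu j := H1_L2 (hu j); have lD j := L2_wD j hf.
have lP S g : L2 (fproj S g) by exact: L2_psum.
have cP S g : continuous (fproj S g) by exact: psum_continuous.
have pP S g : periodic (fproj S g) by exact: psum_periodic.
apply/cvgrPdist_le => /= e e0.
have e3 : 0 < e / 3 by rewrite divr_gt0.
pose K := 53 * Bs * B + 1; have K0 : 0 < K by rewrite ltr_wpDl// !mulr_ge0.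
have d0 : 0 < (e / 3) ^+ 2 / K by rewrite divr_gt0// exprn_gt0.
have W0 k : 0 <= bracket_sqr k ^+ 1 * fourier_sqr f k.
  by rewrite mulr_ge0 ?fourier_sqr_ge0// exprn_ge0// ltW// bracket_gt0.
have [N0 HN0] := shell_small W0 fB.2 d0.
exists N0 => // N /= N0N; rewrite sub0r normrN.
pose I M := \sum_(j < 3) ip (fun x => fproj (box N) f x * fproj (box M) (u j) x)
                            (fproj (box M) (wD j f)).
have Icvg : I M @[M --> \oo] -->
   \sum_(j < 3) ip (fun x => fproj (box N) f x * u j x) (wD j f).
  apply: cvg_sum_seq => j; apply: l2cvg_ip2 => //.
  - by move=> n; apply: L2_contM => //; exact: lP.
  - exact: L2_contM.
  - by apply: l2cvg_mul => //; exact: proj_cvg.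
  - exact: proj_cvg.
apply: (cvgr_to_le (cvg_norm Icvg)); exists N => // M /= NM.
have -> : I M = - \sum_(j < 3) ip (fun x => psum (shell N M) (cf f) (sf f) x * fproj (box M) (u j) x)
                            (fproj (box M) (wD j f)).
  have sk := convection_skew (box M) (box M) (cf f) (sf f) hu du.
  rewrite -sumrN -[LHS]subr0 -[X in _ - X]sk /I -sumrB; apply: eq_bigr => j _; rewrite proj_wD//.
  have lDp : L2 (partial j (fproj (box M) f)) by apply: L2_partial; exact: test_psum.
  have l1 S : L2 (fun x => fproj S f x * fproj (box M) (u j) x).
    exact: L2_contM (lP _ _) (cP S f) (pP S f).
  have l2 : L2 (fun x => psum (shell N M) (cf f) (sf f) x * fproj (box M) (u j) x).
    exact: (l1 (shell N M)).
  rewrite -(ipBl (l1 (box N)) (l1 (box M)) lDp) -(ipNl l2 lDp).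
  congr ip; apply/funext => x; rewrite -(psum_shell _ _ _ NM).
  by rewrite /fproj; ring.
rewrite normrN; apply: le_trans (ler_norm_sum _ _ _) _.
have -> : e = \sum_(j < 3) e / 3.
  by rewrite sumr_const card_ord -[RHS]mulr_natr; field.
apply: ler_sum => j _.
rewrite -ler_sqr ?nnegrE ?(ltW e3)// real_normK ?num_real//.
have [uM _] := symset_box M; have [uS _] := symset_shell N M.
have h1 : \sum_(k <- shell N M) bracket_sqr k * (cf f k ^+ 2 + sf f k ^+ 2) <= (e / 3) ^+ 2 / K.
  by apply: le_trans (HN0 N M N0N NM); apply: ler_sum => k _; rewrite expr1 fourier_sqrE.
have h2 : \sum_(k <- box M) bracket_sqr k * (cf (u j) k ^+ 2 + sf (u j) k ^+ 2) <= Bu j.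
  by case: (HBu j) => _ /(_ M); apply: le_trans; apply: ler_sum => k _; rewrite expr1 fourier_sqrE.
apply: le_trans (trilinear uS uM (lP (box M) (wD j f)) h1 h2) _.
have nB : nrm (fproj (box M) (wD j f)) ^+ 2 <= B.
  rewrite nrm_proj//; last exact: symset_box.
  have [_ /(_ M)] := hbound_wD j fB; apply: le_trans; apply: ler_sum => k _.
  by rewrite expr0 mul1r.
set X := (e / 3) ^+ 2; have X0 : 0 <= X by exact: sqr_ge0.
have c0 : 0 <= 53 * (X / K) by apply: mulr_ge0 => //; apply: divr_ge0 => //; exact: ltW.
apply: (@le_trans _ _ (53 * (X / K) * Bs * B)).
  by apply: ler_pM => //; [exact: mulr_ge0|exact: sqr_ge0|exact: ler_wpM2l].
have -> : 53 * (X / K) * Bs * B = X * ((53 * Bs * B) / K) by field; rewrite lt0r_neq0.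
apply: ler_piMr => //; rewrite ler_pdivrMr// mul1r /K; lra.
Qed.

End Convection.

(** * The relative energy identity *)

Section RelativeEnergy.
Context {R : realType}.
Local Notation point := (R * R * R)%type.
Local Notation periodic := Defs.periodic.

Implicit Types (f g h : point -> R) (u v w : @vfield R).

Definition H1v u := forall i, H1 (u i).

Definition subv u v : vfield := fun i x => u i x - v i x.

Lemma H1v_sub u v : H1v u -> H1v v -> H1v (subv u v).
Proof. by move=> hu hv i; exact: H1B. Qed.

Lemma wDB_ip u v i j h : H1v u -> H1v v -> L2 h ->
  ip (wD j (subv u v i)) h = ip (wD j (u i)) h - ip (wD j (v i)) h.
Proof.
move=> hu hv lh; have l1 := L2_wD j (hu i); have l2 := L2_wD j (hv i).
rewrite -ipBl//; apply: nrm0_ip_eq => //; [|exact: L2B|exact: wDB].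
by apply: L2_wD; exact: H1v_sub.
Qed.

Definition trunc N w : vfield := fun i => fproj (box N) (w i).

Lemma integ_sum (I : Type) (s : seq I) (F : I -> point -> R) :
  (forall i, integ (F i)) -> integ (fun x => \sum_(i <- s) F i x).
Proof.
move=> iF; elim: s => [|i s IH]; first by rewrite sum_fun0; exact: L2_integ L2_0.
by rewrite sum_funE; exact: integD.
Qed.

Lemma torus_int_sum (I : Type) (s : seq I) (F : I -> point -> R) :
  (forall i, integ (F i)) ->
  torus_int (fun x => \sum_(i <- s) F i x) = \sum_(i <- s) torus_int (F i).
Proof.
move=> iF; elim: s => [|i s IH]; first by rewrite sum_fun0 big_nil torus_int_cst.
by rewrite sum_funE big_cons torus_intD ?IH//; exact: integ_sum.
Qed.

Section Truncation.
Variables (w : @vfield R) (N : nat).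
Hypotheses (hw : H1v w) (sw : solenoidal w).

Let lw i : L2 (w i) := H1_L2 (hw i).

Lemma test_trunc i : test_fun (trunc N w i).
Proof. exact: test_psum. Qed.

Lemma L2_trunc i : L2 (trunc N w i).
Proof. exact: L2_psum. Qed.

Lemma trunc_continuous i : continuous (trunc N w i).
Proof. exact: psum_continuous. Qed.

Lemma trunc_periodic i : periodic (trunc N w i).
Proof. exact: psum_periodic. Qed.

Lemma L2_partial_trunc i j : L2 (partial j (trunc N w i)).
Proof. exact: L2_partial (test_trunc i). Qed.

Lemma nrm_trunc i : nrm (trunc N w i) <= nrm (w i).
Proof.
rewrite -ler_sqr ?nnegrE ?nrm_ge0// nrm_proj//; last exact: symset_box.
exact: bessel_sym (symset_box N) _.
Qed.

Lemma L2_mul_trunc i g : L2 g -> L2 (fun x => trunc N w i x * g x).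
Proof. by move=> lg; apply: L2_contM => //; [exact: trunc_continuous|exact: trunc_periodic]. Qed.

(** Divergence free test fields do not see the pressure. *)
Lemma pressure_trunc (p : point -> R) : L2 p ->
  \sum_(i < 3) ip p (partial i (trunc N w i)) = 0.
Proof.
move=> lp; rewrite -ip_sumr//; last by move=> i; exact: L2_partial_trunc.
have -> : (fun x => \sum_(i < 3) partial i (trunc N w i) x) = (fun=> 0).
  by apply/funext => x; exact: div_free_fproj.
by rewrite ipC ip0l.
Qed.

Lemma advect_truncE u i x : advect u i x * trunc N w i x =
  \sum_(j < 3) trunc N w i x * u j x * wD j (u i) x.
Proof. by rewrite /advect mulr_suml; apply: eq_bigr => j _; ring. Qed.

Lemma advect_trunc u i : H1v u ->
  torus_int (fun x => advect u i x * trunc N w i x) =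
  \sum_(j < 3) ip (fun x => trunc N w i x * u j x) (wD j (u i)).
Proof.
move=> hu; have lu j := H1_L2 (hu j); have lD j := L2_wD j (hu i).
have I j := L2_integM (L2_mul_trunc i (lu j)) (lD j).
rewrite (eq_torus_int (advect_truncE u i)).
by rewrite torus_int_sum.
Qed.

Lemma integ_advect_trunc u i : H1v u ->
  integ (fun x => advect u i x * trunc N w i x).
Proof.
move=> hu; have lu j := H1_L2 (hu j); have lD j := L2_wD j (hu i).
have I j := L2_integM (L2_mul_trunc i (lu j)) (lD j).
by have := integ_sum (index_enum 'I_3) I; congr integ; apply/funext => x; rewrite advect_truncE.
Qed.

(** The truncations of w are smooth, hence admissible in the weak equation, and one
    derivative of the Laplacian can be moved onto du. *)
Lemma voigt_trunc (alpha : R) u du (p : point -> R) :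
  H1v u -> H1v du -> L2 p ->
  (forall (i : 'I_3) phi, test_fun phi ->
        - alpha ^+ 2 * torus_int (fun x => du i x * laplacian phi x)
        + torus_int (fun x => du i x * phi x)
        + torus_int (fun x => advect u i x * phi x)
        - torus_int (fun x => p x * partial i phi x) = 0) ->
  \sum_(i < 3) ip (du i) (trunc N w i)
  + alpha ^+ 2 * \sum_(i < 3) \sum_(j < 3) ip (wD j (du i)) (partial j (trunc N w i))
  + \sum_(i < 3) \sum_(j < 3) ip (fun x => trunc N w i x * u j x) (wD j (u i)) = 0.
Proof.
move=> hu hdu lp eqn.
have lap i : torus_int (fun x => du i x * laplacian (trunc N w i) x) =
    - \sum_(j < 3) ip (wD j (du i)) (partial j (trunc N w i)).
  have tp j : test_fun (partial j (trunc N w i)).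
    by rewrite /trunc partial_proj; exact: test_psum.
  rewrite -[LHS]/(ip (du i) (fun x => \sum_(j < 3) partial j (partial j (trunc N w i)) x)).
  rewrite ip_sumr; last 2 first.
  - by move=> j; exact: L2_partial.
  - exact: H1_L2.
  by rewrite -sumrN; apply: eq_bigr => j _; exact: wD_ibp.
rewrite mulr_sumr -!big_split /= -[RHS](pressure_trunc lp).
have E i : ip p (partial i (trunc N w i)) =
   ip (du i) (trunc N w i) + alpha ^+ 2 * \sum_(j < 3) ip (wD j (du i)) (partial j (trunc N w i))
   + \sum_(j < 3) ip (fun x => trunc N w i x * u j x) (wD j (u i)).
  have := eqn i _ (test_trunc i); rewrite lap advect_trunc// => /eqP.
  rewrite subr_eq0 => /eqP E0; rewrite [LHS]/ip -E0 [ip (du i) _]/ip; ring.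
by apply: eq_bigr => i _; rewrite E.
Qed.

Lemma euler_trunc v dv (q : point -> R) :
  H1v v -> (forall i, L2 (dv i)) -> H1 q ->
  (forall i, {ae vol, forall x, dv i x + advect v i x + wD i q x = 0}) ->
  \sum_(i < 3) ip (dv i) (trunc N w i)
  + \sum_(i < 3) \sum_(j < 3) ip (fun x => trunc N w i x * v j x) (wD j (v i)) = 0.
Proof.
move=> hv ldv hq eqn; rewrite -big_split /=.
have lD i := L2_wD i hq.
have E i : ip (dv i) (trunc N w i) +
    \sum_(j < 3) ip (fun x => trunc N w i x * v j x) (wD j (v i)) =
    ip q (partial i (trunc N w i)).
  rewrite wD_ibp//; last exact: test_trunc.
  rewrite -advect_trunc//; apply/eqP; rewrite -subr_eq0 opprK; apply/eqP.
  have Iadv := integ_advect_trunc i hv.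
  have I1 := L2_integM (ldv i) (L2_trunc i); have I2 := L2_integM (lD i) (L2_trunc i).
  rewrite /ip -!torus_intD//; last exact: integD.
  rewrite -[RHS](torus_int_cst 0); apply: ae_torus_int.
  - by apply: integD => //; exact: integD.
  - exact: L2_integ (L2_0 (R := R)).
  - by apply: vol_aeS (eqn i) => x h; rewrite -!mulrDl h mul0r.
rewrite -[RHS](pressure_trunc (H1_L2 hq)).
by apply: eq_bigr => i _; rewrite E.
Qed.

End Truncation.

Lemma sum2_addsub (a b c d : 'I_3 -> 'I_3 -> R) :
  (forall i j, a i j + b i j = c i j - d i j) ->
  \sum_(i < 3) \sum_(j < 3) a i j + \sum_(i < 3) \sum_(j < 3) b i j =
  \sum_(i < 3) \sum_(j < 3) c i j - \sum_(i < 3) \sum_(j < 3) d i j.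
Proof.
move=> abcd; rewrite -big_split -sumrB; apply: eq_bigr => i _ /=.
by rewrite -big_split -sumrB; apply: eq_bigr => j _ /=.
Qed.

Lemma trunc_balance (s1 s2 s3 s4 s5 : R) : s1 + s2 + s3 = 0 -> s4 + s5 = 0 ->
  s1 - s4 + s2 = - (s3 - s5).
Proof. by move=> h1 h2; lra. Qed.

Lemma rate_arith (a M Y G Z V D : R) : 0 <= a -> 0 <= M -> 0 <= Y -> 0 <= G ->
  Z <= 3 * M * Y -> - (2 * V) <= 9 * D + G ->
  2 * (Z - a * V) <= (6 * M + 1) * (Y + a * G) + 9 * a * D.
Proof.
move=> a0 M0 Y0 G0 hZ hV; have k1 := ler_wpM2l a0 hV.
by have k2 := mulr_ge0 M0 (mulr_ge0 a0 G0); nra.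
Qed.

Lemma young_neg (x b c D : R) : `|x| <= b * c -> b ^+ 2 <= D -> - (2 * x) <= D + c ^+ 2.
Proof.
move=> h1 h2; have h3 := ler_norm (- x); rewrite normrN in h3.
by have := sqr_ge0 (b - c); nra.
Qed.

Lemma young_half (x y : R) : y * x <= (x ^+ 2 + y ^+ 2) / 2.
Proof. by have := sqr_ge0 (x - y); lra. Qed.

Lemma sum2_cst (D : R) (x : 'I_3 -> 'I_3 -> R) :
  9 * D + \sum_(i < 3) \sum_(j < 3) x i j = \sum_(i < 3) \sum_(j < 3) (D + x i j).
Proof.
under [RHS]eq_bigr do rewrite big_split sumr_const card_ord.
by rewrite big_split sumr_const card_ord; congr (_ + _); ring.
Qed.

Lemma sum2_half (M : R) (y : 'I_3 -> R) :
  \sum_(i < 3) \sum_(j < 3) M * ((y i + y j) / 2) = 3 * M * \sum_(i < 3) y i.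
Proof. by rewrite !big_ord_recl !big_ord0; field. Qed.

(** The bilinear form of the energy that the Euler-Voigt flow conserves. *)
Definition voigt_energy (alpha : R) u w : R :=
  \sum_(i < 3) ip (u i) (w i) +
  alpha ^+ 2 * \sum_(i < 3) \sum_(j < 3) ip (wD j (u i)) (wD j (w i)).

(** The growth of the relative energy at a fixed time. With w = u - v the
    convective terms differ by (w . grad) v + (u . grad) w; the first is
    controlled by sup |grad v|, the second vanishes against w. The regularising
    term of the Euler-Voigt equation has no counterpart for v, and leaves
    alpha^2 (grad dv, grad w): by Young's inequality, a part of the energy plus a
    multiple of alpha^2 D. *)
Lemma energy_rate (alpha B D : R) u du p v dv q :
  H1v u -> H1v du -> L2 p -> div_free u ->
  (forall (i : 'I_3) phi, test_fun phi ->
        - alpha ^+ 2 * torus_int (fun x => du i x * laplacian phi x)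
        + torus_int (fun x => du i x * phi x)
        + torus_int (fun x => advect u i x * phi x)
        - torus_int (fun x => p x * partial i phi x) = 0) ->
  H1v v -> H1 q -> div_free v ->
  (forall i, {ae vol, forall x, dv i x + advect v i x + wD i q x = 0}) ->
  (forall i j, hbound 2 (wD j (v i)) B) -> (forall i, hbound 1 (dv i) D) ->
  2 * voigt_energy alpha (subv du dv) (subv u v) <=
  (6 * Num.sqrt (53 * B) + 1) * voigt_energy alpha (subv u v) (subv u v) + 9 * alpha ^+ 2 * D.
Proof.
move=> hu hdu lp dfu eqV hv hq dfv eqE vB dvD.
have hdv : H1v dv by move=> i; exists D.
set w := subv u v.
have hw : H1v w by exact: H1v_sub.
have su := div_free_solenoidal hu dfu; have sv := div_free_solenoidal hv dfv.
have sw : solenoidal w by exact: solenoidalB.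
have lu i := H1_L2 (hu i); have lv i := H1_L2 (hv i); have lw i := H1_L2 (hw i).
have ldu i := H1_L2 (hdu i); have ldv i := H1_L2 (hdv i).
have lDu i j := L2_wD j (hu i); have lDv i j := L2_wD j (hv i).
have lDw i j := L2_wD j (hw i).
have lDdu i j := L2_wD j (hdu i); have lDdv i j := L2_wD j (hdv i).
pose M := Num.sqrt (53 * B); have M0 : 0 <= M by exact: sqrtr_ge0.
pose Y := \sum_(i < 3) nrm (w i) ^+ 2.
pose Gw := \sum_(i < 3) \sum_(j < 3) nrm (wD j (w i)) ^+ 2.
have enw : voigt_energy alpha w w = Y + alpha ^+ 2 * Gw.
  rewrite /voigt_energy /Y /Gw; congr (_ + _ * _); first by apply: eq_bigr => i _; rewrite nrm_sqr.
  by apply: eq_bigr => i _; apply: eq_bigr => j _; rewrite nrm_sqr.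
pose Z := \sum_(i < 3) ip (w i) (subv du dv i) +
  alpha ^+ 2 * \sum_(i < 3) \sum_(j < 3) ip (wD j (w i)) (wD j (du i)).
pose V := \sum_(i < 3) \sum_(j < 3) ip (wD j (dv i)) (wD j (w i)).
have enZ : voigt_energy alpha (subv du dv) w = Z - alpha ^+ 2 * V.
  rewrite /voigt_energy /Z /V -addrA -mulrBr -sumrB; congr (_ + _ * _).
    by apply: eq_bigr => i _; exact: ipC.
  apply: eq_bigr => i _; rewrite -sumrB; apply: eq_bigr => j _.
  by rewrite (wDB_ip i j hdu hdv (lDw i j)) (ipC (wD j (w i))).
pose A N := \sum_(i < 3) \sum_(j < 3) ip (fun x => trunc N w i x * w j x) (wD j (v i)).
pose C N := \sum_(i < 3) \sum_(j < 3) ip (fun x => trunc N w i x * u j x) (wD j (w i)).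
pose Q N := \sum_(i < 3) ip (trunc N w i) (subv du dv i) +
  alpha ^+ 2 * \sum_(i < 3) \sum_(j < 3) ip (fproj (box N) (wD j (w i))) (wD j (du i)).
have QE N : Q N = - A N - C N.
  have e1 := voigt_trunc N hw sw hu hdu lp eqV.
  have e2 := euler_trunc N hw sw hv ldv hq eqE.
  have AC : A N + C N = \sum_(i < 3) \sum_(j < 3) ip (fun x => trunc N w i x * u j x) (wD j (u i))
     - \sum_(i < 3) \sum_(j < 3) ip (fun x => trunc N w i x * v j x) (wD j (v i)).
    have sub3 (x y z : R) : x - y + (z - x) = z - y by ring.
    apply: sum2_addsub => i j.
    have l1 g : L2 g -> L2 (fun x => trunc N w i x * g x) by exact: L2_mul_trunc.
    rewrite (ipC _ (wD j (w i))) (wDB_ip i j hu hv (l1 _ (lu j))).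
    have -> : (fun x => trunc N w i x * w j x) =
        (fun x => trunc N w i x * u j x - trunc N w i x * v j x).
      by apply/funext => x; rewrite /w /subv mulrBr.
    rewrite (ipBl (l1 _ (lu j)) (l1 _ (lv j)) (lDv i j)).
    rewrite (ipC (wD j (u i)) (fun x => _)) (ipC (wD j (v i)) (fun x => _)).
    exact: sub3.
  rewrite -opprD AC.
  have -> : Q N = (\sum_(i < 3) ip (du i) (trunc N w i) - \sum_(i < 3) ip (dv i) (trunc N w i)) +
     alpha ^+ 2 * \sum_(i < 3) \sum_(j < 3) ip (wD j (du i)) (partial j (trunc N w i)).
    rewrite /Q; congr (_ + _ * _).
      rewrite -sumrB; apply: eq_bigr => i _; rewrite ipBr//; last exact: L2_trunc.
      by rewrite !(ipC (trunc N w i)).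
    by apply: eq_bigr => i _; apply: eq_bigr => j _; rewrite ipC proj_wD.
  exact: trunc_balance e1 e2.
have Qcvg : Q N @[N --> \oo] --> Z.
  apply: cvgD.
    apply: cvg_sum_seq => i; apply: l2cvg_ip => //; first by move=> n; exact: L2_trunc.
      exact: L2B.
    exact: proj_cvg.
  apply: cvgM; first exact: cvg_cst.
  apply: cvg_sum_seq => i; apply: cvg_sum_seq => j; apply: l2cvg_ip => //.
    by move=> n; exact: L2_psum.
  exact: proj_cvg.
have Ccvg : C N @[N --> \oo] --> 0.
  have -> : 0 = \sum_(i < 3) 0 :> R by rewrite big1.
  by apply: cvg_sum_seq => i; exact: convection_limit.
have ABd N : - A N <= 3 * M * Y.
  apply: (@le_trans _ _ (\sum_(i < 3) \sum_(j < 3) M * ((nrm (w i) ^+ 2 + nrm (w j) ^+ 2) / 2))).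
    rewrite /A -sumrN; apply: ler_sum => i _; rewrite -sumrN; apply: ler_sum => j _.
    have := ip_mul_sup (@trunc_continuous w N i) (@trunc_periodic w N i) (lw j) (vB i j).
    rewrite -/M => h; apply: le_trans (ler_norm _) _; rewrite normrN; apply: le_trans h _.
    rewrite -mulrA; apply: ler_wpM2l => //; apply: le_trans (young_half _ _).
    by apply: ler_wpM2l; [exact: nrm_ge0|exact: nrm_trunc].
  by rewrite (sum2_half M (fun i => nrm (w i) ^+ 2)).
have ZBd : Z <= 3 * M * Y.
  have h : Q N + C N @[N --> \oo] --> Z + 0 by exact: cvgD.
  rewrite -[Z]addr0; apply: (cvgr_to_le h); apply: nearW => n.
  by rewrite QE subrK.
have VBd : - (2 * V) <= 9 * D + Gw.
  have -> : 9 * D + Gw = \sum_(i < 3) \sum_(j < 3) (D + nrm (wD j (w i)) ^+ 2).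
    exact: sum2_cst.
  rewrite /V mulr_sumr -sumrN; apply: ler_sum => i _.
  rewrite mulr_sumr -sumrN; apply: ler_sum => j _.
  by apply: young_neg (ip_CS (lDdv i j) (lDw i j)) (nrm_wD_le j (dvD i)).
rewrite enZ enw -/M.
have a0 := sqr_ge0 alpha.
have Y0 : 0 <= Y by apply: sumr_ge0 => i _; exact: sqr_ge0.
have G0 : 0 <= Gw by apply: sumr_ge0 => i _; apply: sumr_ge0 => j _; exact: sqr_ge0.
exact: rate_arith.
Qed.

End RelativeEnergy.

(** * Curves of square integrable functions and Gronwall's inequality *)

Section EnergyInTime.
Context {R : realType}.
Local Notation point := (R * R * R)%type.

Implicit Types (f g : point -> R) (u v w : @vfield R).

Lemma Hs_hbound (p : nat) f (B : R) : L2 f -> (Hs_norm_sqr p%:R f <= B%:E)%E ->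
  hbound p f B.
Proof.
move=> lf fB; split => // n; rewrite -lee_fin; apply: le_trans fB.
rewrite -sumEFin; apply: esum_ge; exists [set` box n].
  by split => //; exact: finite_seq.
rewrite -fsbig_seq ?box_uniq//; apply: lee_sum => k _.
by rewrite powR_mulrn// ltW// bracket_gt0.
Qed.

Lemma Hs_hbound_ex (p : nat) f : Hs p%:R f -> exists B, hbound p f B.
Proof.
move=> [lf fin]; exists (fine (Hs_norm_sqr p%:R f)); apply: Hs_hbound => //.
rewrite fineK// ge0_fin_numE//; apply: esum_ge0 => k _.
by rewrite lee_fin mulr_ge0 ?powR_ge0// fourier_sqr_ge0.
Qed.

Lemma vHs_hbound (p : nat) u (B : R) : (forall i, L2 (u i)) ->
  (vHs_norm_sqr p%:R u <= B%:E)%E -> forall i, hbound p (u i) B.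
Proof.
move=> lu uB i; apply: Hs_hbound => //; apply: le_trans uB.
have H0 j : (0 <= Hs_norm_sqr p%:R (u j))%E.
  by apply: esum_ge0 => k _; rewrite lee_fin mulr_ge0 ?powR_ge0// fourier_sqr_ge0.
by rewrite /vHs_norm_sqr (bigD1 i)//= leeDl// sume_ge0.
Qed.

Lemma nrm_sub0_eq f g : L2 f -> L2 g -> nrm (fun x => f x - g x) = 0 -> nrm f = nrm g.
Proof.
move=> lf lg fg; rewrite /nrm (nrm0_ip_eq lf lg lf fg) ipC.
by rewrite (nrm0_ip_eq lf lg lg fg).
Qed.

Lemma nrm_wD_quotient (c : R) f g h j : H1 f -> H1 g -> H1 h ->
  nrm (fun x => c * (wD j f x - wD j g x) - wD j h x) =
  nrm (wD j (fun x => c * (f x - g x) - h x)).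
Proof.
move=> hf hg hh; have hfg := H1B hf hg; have hc := H1Z c hfg; have hl := H1B hc hh.
have lf := H1_L2 hf; have lg := H1_L2 hg; have lh := H1_L2 hh.
have df := L2_wD j hf; have dg := L2_wD j hg; have dh := L2_wD j hh.
have l1 := L2B lf lg; have l2 := L2Z c l1.
have d1 := L2B df dg; have d2 := L2Z c d1; have d3 := L2B d2 dh.
apply: nrm_sub0_eq => //; first exact: L2_wD.
apply: coefs_inj => //; first exact: L2_wD.
have cB (p q : point -> R) k (lp : L2 p) (lq : L2 q) : cf (fun x => p x - q x) k = cf p k - cf q k.
  by rewrite /cf ipBl//; exact: L2_tr.
have sB (p q : point -> R) k (lp : L2 p) (lq : L2 q) : sf (fun x => p x - q x) k = sf p k - sf q k.
  by rewrite /sf ipBl//; exact: L2_tr.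
move=> k; split.
  rewrite (cB _ _ k d2 dh) (cfZ c k d1) (cB _ _ k df dg) !cf_wD//.
  by rewrite (sB _ _ k l2 lh) (sfZ c k l1) (sB _ _ k lf lg); ring.
rewrite (sB _ _ k d2 dh) (sfZ c k d1) (sB _ _ k df dg) !sf_wD//.
by rewrite (cB _ _ k l2 lh) (cfZ c k l1) (cB _ _ k lf lg); ring.
Qed.

(** Continuity and differentiability of curves in L^2 are stated with epsilons, for
    nrm is a seminorm only on functions, as opposed to classes of functions. *)
Definition l2cont (I : set R) (F : R -> point -> R) (t : R) :=
  forall e : R, 0 < e -> exists2 d : R, 0 < d & forall r, I r -> `|r - t| < d ->
    L2 (F r) /\ nrm (fun x => F r x - F t x) <= e.

Definition l2deriv (I : set R) (F : R -> point -> R) (t : R) (dF : point -> R) :=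
  forall e : R, 0 < e -> exists2 d : R, 0 < d & forall r, I r -> r != t ->
    `|r - t| < d ->
    L2 (F r) /\ nrm (fun x => (r - t)^-1 * (F r x - F t x) - dF x) <= e.

Lemma ip_sqr_cont (I : set R) F t : I t -> L2 (F t) -> l2cont I F t ->
  ip (F r) (F r) @[r --> within I (nbhs t)] --> ip (F t) (F t).
Proof.
move=> It lF cF; apply/cvgrPdist_le => /= e e0.
have n0 := nrm_ge0 (F t).
pose e1 := Num.min 1 (e / (1 + 2 * nrm (F t))).
have p0 : 0 < 1 + 2 * nrm (F t) by lra.
have e10 : 0 < e1 by rewrite lt_min ltr01 divr_gt0.
have [d d0 H] := cF e1 e10.
rewrite near_withinE; apply/nbhs_ballP; exists d => //= r; rewrite /ball /= distrC => rt Ir.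
have [lr nr] := H r Ir rt.
set D := fun x => F r x - F t x in nr.
have lD : L2 D by exact: L2B.
have FE : F r = (fun x => F t x + D x) by apply/funext => x; rewrite /D [RHS]addrC subrK.
have -> : ip (F t) (F t) - ip (F r) (F r) = - (2 * ip (F t) D + ip D D).
  have lS : L2 (fun x => F t x + D x) by exact: L2D.
  rewrite {1 2}FE (ipDl lF lD lS) (ipDr lF lD lF) (ipDr lF lD lD) (ipC D (F t)).
  by ring.
rewrite normrN; apply: le_trans (ler_normD _ _) _; rewrite normrM (ger0_norm (ler0n _ 2)).
have h1 := ip_CS lF lD; have h2 := ip_CS lD lD; have m0 := nrm_ge0 D.
move: nr; rewrite le_min => /andP[m1]; rewrite ler_pdivlMr//.
move: h1 h2 n0 m0 m1; move: `|ip _ _| `|ip _ _| (nrm (F t)) (nrm D) => a b n m.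
by move=> *; nra.
Qed.

Lemma ip_sqr_derive (I : set R) F t dF : nbhs t I -> L2 (F t) -> L2 dF ->
  l2deriv I F t dF ->
  is_derive t 1 (fun r => ip (F r) (F r)) (2 * ip (F t) dF).
Proof.
move=> It lF ldF dFt.
suff H : (fun h => h^-1 *: (((fun r => ip (F r) (F r)) \o shift t) (h *: 1) - ip (F t) (F t)))
    @ 0^' --> 2 * ip (F t) dF.
  by split; [exact: cvgP H|exact: (cvg_lim (@Rhausdorff R) H)].
apply/cvgrPdist_le => /= e e0.
have n0 := nrm_ge0 (F t); have k0 := nrm_ge0 dF.
pose e1 := Num.min 1 (e / (4 * (nrm (F t) + 1))).
have p0 : 0 < 4 * (nrm (F t) + 1) by lra.
have e10 : 0 < e1 by rewrite lt_min ltr01 divr_gt0.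
have [d d0 H] := dFt e1 e10.
have q0 : 0 < 2 * (nrm dF + 1) ^+ 2 by rewrite mulr_gt0// exprn_gt0// ltr_pwDr.
pose d' := Num.min d (e / (2 * (nrm dF + 1) ^+ 2)).
have d'0 : 0 < d' by rewrite lt_min d0 divr_gt0.
have /nbhs_ballP[d2 /= d20 Hd2] := It.
rewrite near_withinE; apply/nbhs_ballP; exists (Num.min d' d2).
  by rewrite /= lt_min d'0.
move=> h; rewrite /ball /= sub0r normrN lt_min => /andP[hd' hd2] h0.
have hd : `|h| < d by apply: lt_le_trans hd' _; rewrite ge_min lexx.
have he : `|h| <= e / (2 * (nrm dF + 1) ^+ 2).
  by apply: le_trans (ltW hd') _; rewrite ge_min lexx orbT.
rewrite [h *: 1]mulr1.
have Iht : I (h + t) by apply: Hd2; rewrite /ball /= opprD addrCA subrr addr0 normrN.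
have [||lr nr] := H (h + t) Iht; rewrite ?addrK//.
  by rewrite -subr_eq0 addrK.
rewrite addrK in nr; set q := fun x => h^-1 * (F (h + t) x - F t x).
have lq : L2 q by apply: L2Z; exact: L2B.
set D := fun x => h^-1 * (F (h + t) x - F t x) - dF x in nr.
have lD : L2 D by exact: L2B.
have FE : F (h + t) = (fun x => F t x + h * q x).
  by apply/funext => x; rewrite /q mulVKf// [RHS]addrC subrK.
have qE : q = (fun x => dF x + D x) by apply/funext => x; rewrite /D [RHS]addrC subrK.
have nq : nrm q <= nrm dF + 1.
  rewrite {1}qE; apply: le_trans (nrmD ldF lD) _; rewrite lerD2l.
  by apply: le_trans nr _; rewrite ge_min lexx.
have -> : 2 * ip (F t) dF - h^-1 * (ip (F (h + t)) (F (h + t)) - ip (F t) (F t)) =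
    - (2 * ip (F t) D + h * ip q q).
  have lhq := L2Z h lq; have lS := L2D lF lhq.
  rewrite {1 2}FE (ipDl lF lhq lS) (ipDr lF lhq lF) (ipDr lF lhq lhq).
  rewrite (ipZl h lq lF) (ipZl h lq lhq) (ipZr h lq lF) (ipZr h lq lq) (ipC q (F t)).
  have -> : ip (F t) q = ip (F t) dF + ip (F t) D by rewrite {1}qE (ipDr ldF lD lF).
  by field.
rewrite normrN; apply: le_trans (ler_normD _ _) _.
rewrite !normrM (ger0_norm (ler0n _ 2)) [leRHS](splitr e).
move: nr; rewrite le_min => /andP[_]; rewrite ler_pdivlMr// => nr.
have h1 := ip_CS lF lD; have h2 := ip_CS lq lq; have m0 := nrm_ge0 D; have q1 := nrm_ge0 q.
apply: lerD.
  move: h1 nr n0 m0; move: `|ip (F t) D| (nrm (F t)) (nrm D) => a n m.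
  by move=> *; nra.
have hq : `|ip q q| <= (nrm dF + 1) ^+ 2.
  by apply: le_trans h2 _; rewrite expr2; apply: ler_pM.
apply: (@le_trans _ _ (e / (2 * (nrm dF + 1) ^+ 2) * (nrm dF + 1) ^+ 2)).
  exact: ler_pM.
rewrite le_eqVlt; apply/orP; left; apply/eqP; field.
by rewrite lt0r_neq0// ltr_pwDr.
Qed.

Lemma is_derive_sum_seq (I : Type) (s : seq I) (phi : I -> R -> R) (d : I -> R) (t : R) :
  (forall i, is_derive t 1 (phi i) (d i)) ->
  is_derive t 1 (fun r => \sum_(i <- s) phi i r) (\sum_(i <- s) d i).
Proof.
move=> H; elim: s => [|i s IH].
  have -> : (fun r => \sum_(i <- [::]) phi i r) = cst 0 by apply/funext => r; rewrite big_nil.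
  by rewrite big_nil; exact: is_derive_cst.
have -> : (fun r => \sum_(j <- i :: s) phi j r) = (phi i + (fun r => \sum_(j <- s) phi j r)).
  by apply/funext => r; rewrite big_cons.
by rewrite big_cons; exact: is_deriveD.
Qed.

(** The function (G + A / C) exp (- C t) is nonincreasing. *)
Lemma gronwall (G dG : R -> R) (C A T : R) : 0 < C -> 0 <= A ->
  {within `[0, T], continuous G} ->
  (forall t, 0 < t < T -> is_derive t 1 G (dG t)) ->
  (forall t, 0 < t < T -> dG t <= C * G t + A) ->
  G 0 <= 0 -> forall t, 0 <= t <= T -> G t <= A / C * expR (C * T).
Proof.
move=> C0 A0 cG dGd dGle G0 t /andP[t0 tT].
pose H := ((fun r => expR (- C * r)) * (G + cst (A / C)))%R.
have dE (r : R) : is_derive r 1 (fun r => expR (- C * r)) (- C * expR (- C * r)).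
  have lin : is_derive r 1 (fun s : R => - C * s) (- C).
    have -> : (fun s : R => - C * s) = (- C) *: id by [].
    by apply: is_derive_eq; rewrite [LHS]mulr1.
  have := is_derive1_comp (is_derive_expR (- C * r)) lin.
  by move/is_derive_eq; apply; rewrite mulrC.
have dH r : 0 < r < T -> is_derive r 1 H
    (expR (- C * r) * (dG r - C * G r - A)).
  move=> rT; have h := is_deriveM (dE r) (is_deriveD (dGd r rT) (is_derive_cst (A / C) r 1)).
  apply: (is_derive_eq h).
  by rewrite /GRing.scale /= !fctE /cst addr0; field; rewrite lt0r_neq0.
have le0H : forall x, x \in `]0, T[%R -> derive1 H x <= 0.
  move=> x; rewrite in_itv /= => xT; have [_ e] := dH x xT; rewrite derive1E e.
  by apply: mulr_ge0_le0; [exact: expR_ge0|have := dGle x xT; lra].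
have dHd x : x \in `]0, T[%R -> derivable H x 1.
  by rewrite in_itv /= => xT; have [] := dH x xT.
have cH : {within `[0, T], continuous H}.
  apply/subspace_continuousP => x Ix.
  move/subspace_continuousP : cG => /(_ x Ix) cGx.
  apply: cvgM; last by apply: cvgD => //; exact: cvg_cst.
  have ce : {for x, continuous (fun r => expR (- C * r))}.
    by apply/differentiable_continuous/derivable1_diffP; have [] := dE x.
  exact: cvg_within_filter ce.
have T0 : 0 <= T by exact: le_trans tT.
have h0T : {in `[0, T]%R &, {homo H : x y /~ x <= y}} by exact: ler0_derive1_le_cc.
have Ht : H t <= H 0 by apply: h0T => //; rewrite in_itv /= ?lexx ?t0 ?tT.
have AC0 : 0 <= A / C by rewrite divr_ge0// ltW.
have {}Ht : expR (- C * t) * (G t + A / C) <= A / C.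
  apply: le_trans Ht _; rewrite /H /= !fctE mulr0 expR0 mul1r /=.
  by rewrite /cst; lra.
have eE : expR (C * t) * expR (- C * t) = 1 by rewrite -expRD mulNr subrr expR0.
have e1 : expR (C * t) <= expR (C * T) by rewrite ler_expR ler_wpM2l// ltW.
have h1 := ler_wpM2l (expR_ge0 (C * t)) Ht.
rewrite mulrA eE mul1r in h1.
have h2 := ler_wpM2l AC0 e1; rewrite (mulrC (A / C) (expR (C * t))) in h2.
lra.
Qed.

End EnergyInTime.

(** * Continuity in Sobolev spaces *)

Section Convergence.
Context {R : realType}.
Local Notation point := (R * R * R)%type.

Implicit Types (f g : point -> R) (u v w : @vfield R).

Lemma near_le_of_cvg0 (X : Type) (Fl : set_system X) (N : X -> \bar R) (e : R) :
  Filter Fl -> N r @[r --> Fl] --> 0%E -> 0 < e -> \forall r \near Fl, (N r <= e%:E)%E.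
Proof.
move=> FF Ncvg e0; apply: (Ncvg [set y | (y <= e%:E)%E]).
change (nbhs (0 : R) (fun r => (r%:E <= e%:E)%E)).
apply/nbhs_ballP; exists e => //= r; rewrite /ball /= sub0r normrN => re.
by rewrite lee_fin ltW// (le_lt_trans (ler_norm r)).
Qed.

Lemma hbound_leB p f (B C : R) : B <= C -> hbound p f B -> hbound p f C.
Proof. by move=> BC [lf fB]; split => // n; exact: le_trans (fB n) BC. Qed.

Lemma vHs_L2 (s : R) u : vHs s u -> forall i, L2 (u i).
Proof. by move=> hu i; case: (hu i). Qed.

Lemma vHs_hbound_ex (p : nat) u : vHs p%:R u -> exists B, forall i, hbound p (u i) B.
Proof.
move=> hu; have [Bu HBu] : {Bu : 'I_3 -> R | forall j, hbound p (u j) (Bu j)}.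
  exists (fun j => projT1 (cid (Hs_hbound_ex (hu j)))) => j.
  exact: projT2 (cid (Hs_hbound_ex (hu j))).
exists (\sum_(j < 3) Bu j) => i; apply: hbound_leB (HBu i).
by rewrite (bigD1 i)//= lerDl sumr_ge0// => j _; exact: hbound_ge0 (HBu j).
Qed.

Lemma cont_Hs_hbound (p : nat) (I : set R) (u : R -> @vfield R) t (e : R) :
  cont_Hs I p%:R u -> I t -> 0 < e ->
  exists2 d : R, 0 < d & forall r, I r -> `|r - t| < d ->
    forall i, hbound p (fun x => u r i x - u t i x) e.
Proof.
move=> cu It e0; have [hut Ncvg] := cu t It.
have : nbhs t (fun r => I r -> (vHs_norm_sqr p%:R (fun i x => u r i x - u t i x)%R <= e%:E)%E).
  exact: near_le_of_cvg0 (within_filter I _) Ncvg e0.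
move=> /nbhs_ballP[d /= d0 Hd].
exists d => // r Ir rt i; have [hur _] := cu r Ir.
apply: (vHs_hbound (u := fun i x => u r i x - u t i x)); last first.
  by apply: Hd => //; rewrite /ball /= distrC.
by move=> j; apply: L2B; [exact: vHs_L2 hur j|exact: vHs_L2 hut j].
Qed.

Lemma deriv_Hs_hbound (p : nat) (I : set R) (u du : R -> @vfield R) t (e : R) :
  C1_Hs I p%:R u du -> I t -> 0 < e ->
  exists2 d : R, 0 < d & forall r, I r -> r != t -> `|r - t| < d ->
    forall i, hbound p (fun x => (r - t)^-1 * (u r i x - u t i x) - du t i x) e.
Proof.
move=> [cu cdu dud] It e0; have [hut _] := cu t It; have [hdut _] := cdu t It.
have : nbhs t (fun r => r != t -> I r ->
    (vHs_norm_sqr p%:R (fun i x => (u r i x - u t i x) / (r - t) - du t i x)%R <= e%:E)%E).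
  exact: near_le_of_cvg0 (within_filter I _) (dud t It) e0.
move=> /nbhs_ballP[d /= d0 Hd].
exists d => // r Ir rt rtd i; have [hur _] := cu r Ir.
have -> : (fun x => (r - t)^-1 * (u r i x - u t i x) - du t i x) =
          (fun x => (u r i x - u t i x) / (r - t) - du t i x).
  by apply/funext => x; rewrite mulrC.
apply: (vHs_hbound (u := fun i x => (u r i x - u t i x) / (r - t) - du t i x)).
  move=> j; apply: L2B; last exact: vHs_L2 hdut j.
  have -> : (fun x => (u r j x - u t j x) / (r - t)) = (fun x => (r - t)^-1 * (u r j x - u t j x)).
    by apply/funext => x; rewrite mulrC.
  by apply: L2Z; apply: L2B; [exact: vHs_L2 hur j|exact: vHs_L2 hut j].
by apply: Hd => //; rewrite /ball /= distrC.
Qed.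

Lemma nrm_wDB f g j : H1 f -> H1 g ->
  nrm (fun x => wD j f x - wD j g x) = nrm (wD j (fun x => f x - g x)).
Proof.
move=> hf hg; apply/esym; apply: nrm_sub0_eq (wDB j hf hg).
  by apply: L2_wD; exact: H1B.
by apply: L2B; exact: L2_wD.
Qed.

Lemma le_sqr_hbound p f (e : R) : 0 <= e -> hbound p f (e ^+ 2) -> nrm f <= e.
Proof.
by move=> e0 /hbound_nrm h; rewrite -ler_sqr ?nnegrE ?nrm_ge0.
Qed.

Lemma le_sqr_hbound_wD f j (e : R) : 0 <= e -> hbound 1 f (e ^+ 2) -> nrm (wD j f) <= e.
Proof.
by move=> e0 /(nrm_wD_le j) h; rewrite -ler_sqr ?nnegrE ?nrm_ge0.
Qed.

Lemma l2cont_H1 (I : set R) (F : R -> point -> R) t : (forall r, I r -> H1 (F r)) -> I t ->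
  (forall e : R, 0 < e -> exists2 d : R, 0 < d & forall r, I r -> `|r - t| < d ->
     hbound 1 (fun x => F r x - F t x) e) ->
  l2cont I F t /\ forall j, l2cont I (fun r => wD j (F r)) t.
Proof.
move=> hF It cF; split=> [|j] e e0.
  have [d d0 H] := cF _ (exprn_gt0 2 e0); exists d => // r Ir rt.
  by split; [exact: H1_L2 (hF r Ir)|exact: le_sqr_hbound (ltW e0) (H r Ir rt)].
have [d d0 H] := cF _ (exprn_gt0 2 e0); exists d => // r Ir rt.
split; first exact: L2_wD (hF r Ir).
rewrite (nrm_wDB j (hF r Ir) (hF t It)).
exact: le_sqr_hbound_wD (ltW e0) (H r Ir rt).
Qed.

Lemma l2deriv_H1 (I : set R) (F : R -> point -> R) t dF :
  (forall r, I r -> H1 (F r)) -> I t -> H1 dF ->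
  (forall e : R, 0 < e -> exists2 d : R, 0 < d & forall r, I r -> r != t -> `|r - t| < d ->
     hbound 1 (fun x => (r - t)^-1 * (F r x - F t x) - dF x) e) ->
  l2deriv I F t dF /\ forall j, l2deriv I (fun r => wD j (F r)) t (wD j dF).
Proof.
move=> hF It hdF cF; split=> [|j] e e0.
  have [d d0 H] := cF _ (exprn_gt0 2 e0); exists d => // r Ir nrt rt.
  by split; [exact: H1_L2 (hF r Ir)|exact: le_sqr_hbound (ltW e0) (H r Ir nrt rt)].
have [d d0 H] := cF _ (exprn_gt0 2 e0); exists d => // r Ir nrt rt.
split; first exact: L2_wD (hF r Ir).
rewrite (nrm_wD_quotient (r - t)^-1 j (hF r Ir) (hF t It) hdF).
exact: le_sqr_hbound_wD (ltW e0) (H r Ir nrt rt).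
Qed.

Lemma voigt_energy_cvg (I : set R) alpha (w : R -> @vfield R) t :
  (forall r, I r -> H1v (w r)) -> I t ->
  (forall i, l2cont I (fun r => w r i) t) ->
  (forall i j, l2cont I (fun r => wD j (w r i)) t) ->
  voigt_energy alpha (w r) (w r) @[r --> within I (nbhs t)] --> voigt_energy alpha (w t) (w t).
Proof.
move=> hw It cw cDw; apply: cvgD.
  apply: cvg_sum_seq => i; apply: (ip_sqr_cont (F := fun r => w r i)) => //.
  exact: H1_L2 (hw t It i).
apply: cvgM; first exact: cvg_cst.
apply: cvg_sum_seq => i; apply: cvg_sum_seq => j.
apply: (ip_sqr_cont (F := fun r => wD j (w r i))) => //.
exact: L2_wD (hw t It i).
Qed.

Lemma voigt_energy_derive (I : set R) alpha (w : R -> @vfield R) dw t :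
  (forall r, I r -> H1v (w r)) -> nbhs t I -> H1v dw ->
  (forall i, l2deriv I (fun r => w r i) t (dw i)) ->
  (forall i j, l2deriv I (fun r => wD j (w r i)) t (wD j (dw i))) ->
  is_derive t 1 (fun r => voigt_energy alpha (w r) (w r)) (2 * voigt_energy alpha dw (w t)).
Proof.
move=> hw It hdw cw cDw; have It' : I t by exact: nbhs_singleton It.
have d1 : is_derive t 1 (fun r => \sum_(i < 3) ip (w r i) (w r i))
    (\sum_(i < 3) 2 * ip (w t i) (dw i)).
  apply: is_derive_sum_seq => i; apply: (ip_sqr_derive (F := fun r => w r i) It) => //.
    exact: H1_L2 (hw t It' i).
  exact: H1_L2 (hdw i).
have d2 : is_derive t 1 (fun r => \sum_(i < 3) \sum_(j < 3) ip (wD j (w r i)) (wD j (w r i)))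
    (\sum_(i < 3) \sum_(j < 3) 2 * ip (wD j (w t i)) (wD j (dw i))).
  apply: is_derive_sum_seq => i; apply: is_derive_sum_seq => j.
  apply: (ip_sqr_derive (F := fun r => wD j (w r i)) It) => //.
    exact: L2_wD (hw t It' i).
  exact: L2_wD (hdw i).
have d3 := is_deriveD d1 (is_deriveZ (alpha ^+ 2) d2).
have -> : 2 * voigt_energy alpha dw (w t) = \sum_(i < 3) 2 * ip (w t i) (dw i) +
    alpha ^+ 2 * (\sum_(i < 3) \sum_(j < 3) 2 * ip (wD j (w t i)) (wD j (dw i))).
  rewrite /voigt_energy mulrDr; congr (_ + _).
    by rewrite mulr_sumr; apply: eq_bigr => i _; rewrite (ipC (dw i)).
  rewrite mulrCA; congr (_ * _); rewrite mulr_sumr; apply: eq_bigr => i _.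
  by rewrite mulr_sumr; apply: eq_bigr => j _; rewrite (ipC (wD j (dw i))).
exact: d3.
Qed.

(** Continuity bounds v near each time, and [0, T] is compact. *)
Lemma hbound_compact (p : nat) (v : R -> @vfield R) (T T' : R) : T < T' ->
  cont_Hs `[0, T'[ p%:R v ->
  exists B, forall t, 0 <= t <= T -> forall i, hbound p (v t i) B.
Proof.
move=> TT' cv.
have IT t : 0 <= t <= T -> `[0, T'[%classic t.
  by move=> /andP[t0 tT]; rewrite /= in_itv /= t0 (le_lt_trans tT).
have /compact_near_coveringP/near_covering_withinP cov := @segment_compact R 0 T.
have [|M [_ HM]] := cov R (pinfty_nbhs R)
    (fun B t => forall i, hbound p (v t i) B) _ _; last first.
  exists (M + 1) => t tT; apply: (HM (M + 1)); first by rewrite ltrDl.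
  by rewrite /= in_itv.
move=> t /=; rewrite in_itv /= => tT.
have [hv _] := cv t (IT t tT); have [B HB] := vHs_hbound_ex hv.
have [d d0 Hd] := cont_Hs_hbound cv (IT t tT) ltr01.
exists ([set r | `|r - t| < d], [set b | 2 * 1 + 2 * B < b]).
  split; last by exists (2 * 1 + 2 * B); rewrite num_real.
  by apply/nbhs_ballP; exists d => // r; rewrite /ball /= distrC.
move=> [r b] [/= rt bB]; rewrite in_itv /= => rT i.
apply: (hbound_leB (ltW bB)).
have := hboundD (Hd r (IT r rT) rt i) (HB i).
by congr hbound; apply/funext => x; rewrite subrK.
Qed.

Lemma grad_L2normE u : grad_L2norm u ^+ 2 = \sum_(i < 3) \sum_(j < 3) nrm (wD j (u i)) ^+ 2.
Proof.
rewrite /grad_L2norm sqr_sqrtr.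
  apply: eq_bigr => i _; apply: eq_bigr => j _; rewrite nrm_sqr.
  by apply: eq_torus_int => x; rewrite expr2.
apply: sumr_ge0 => i _; apply: sumr_ge0 => j _; apply: Rintegral_ge0 => x _.
exact: sqr_ge0.
Qed.

Lemma nrm_wD0 f j : H1 f -> nrm f = 0 -> nrm (wD j f) = 0.
Proof.
move=> hf f0; have lf := H1_L2 hf; apply: fourier_coefs0; first exact: L2_wD.
have c0 k : cf f k = 0 by apply: nrm0_ip => //; exact: L2_tr.
have s0 k : sf f k = 0 by apply: nrm0_ip => //; exact: L2_tr.
by move=> k; rewrite cf_wD// sf_wD// c0 s0 !mulr0 oppr0.
Qed.

Lemma voigt_energy_eq0 alpha w : H1v w -> (forall i, nrm (w i) = 0) -> voigt_energy alpha w w = 0.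
Proof.
move=> hw w0; rewrite /voigt_energy big1 ?add0r => [|i _]; last by rewrite -nrm_sqr w0 expr0n.
rewrite big1 ?mulr0// => i _; rewrite big1// => j _.
by rewrite -nrm_sqr nrm_wD0 ?expr0n.
Qed.

End Convergence.

(** * Comparison of the two flows *)

Section Comparison.
Context {R : realType}.
Local Notation point := (R * R * R)%type.

(** What Gronwall's inequality yields for the energy of u - v after division by
    alpha^2; it does not depend on alpha. *)
Definition energy_bound (B D T : R) : R :=
  9 * D / (6 * Num.sqrt (53 * B) + 1) * expR ((6 * Num.sqrt (53 * B) + 1) * T).

Lemma quarter_sum (e : R) : 2 * (e / 4) + 2 * (e / 4) = e.
Proof. by field. Qed.

Lemma sqr_le_sum (x y z : R) : 0 <= x -> x <= y + z -> x ^+ 2 <= 2 * y ^+ 2 + 2 * z ^+ 2.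
Proof.
move=> x0 h; have h2 : x ^+ 2 <= (y + z) ^+ 2 by apply: lerXn2r; rewrite ?nnegrE ?(le_trans x0 h).
by have := sqr_ge0 (y - z); nra.
Qed.

Lemma sum2_affine (x : 'I_3 -> 'I_3 -> R) (B : R) :
  \sum_(i < 3) \sum_(j < 3) (2 * x i j + 2 * B) =
  2 * \sum_(i < 3) \sum_(j < 3) x i j + 18 * B.
Proof. by rewrite !big_ord_recl !big_ord0; ring. Qed.

Lemma grad_L2norm_le (u v : @vfield R) (B K : R) : H1v u -> (forall i, hbound 1 (v i) B) ->
  \sum_(i < 3) \sum_(j < 3) nrm (wD j (subv u v i)) ^+ 2 <= K ->
  grad_L2norm u ^+ 2 <= 2 * K + 18 * B.
Proof.
move=> hu vB hK; rewrite grad_L2normE.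
have hv i : H1 (v i) by exists B.
have h i j : nrm (wD j (u i)) ^+ 2 <= 2 * nrm (wD j (subv u v i)) ^+ 2 + 2 * B.
  have l1 := L2_wD j (hu i); have l2 := L2_wD j (hv i).
  have -> : nrm (wD j (subv u v i)) = nrm (fun x => wD j (u i) x - wD j (v i) x).
    by rewrite (nrm_wDB j (hu i) (hv i)).
  have := nrmD (L2B l1 l2) l2.
  have -> : (fun x => wD j (u i) x - wD j (v i) x + wD j (v i) x) = wD j (u i).
    by apply/funext => x; rewrite subrK.
  move=> /(sqr_le_sum (nrm_ge0 _)) h; apply: le_trans h _.
  by rewrite lerD2l ler_wpM2l// nrm_wD_le.
apply: (@le_trans _ _ (\sum_(i < 3) \sum_(j < 3)
    (2 * nrm (wD j (subv u v i)) ^+ 2 + 2 * B))).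
  by apply: ler_sum => i _; apply: ler_sum => j _; exact: h.
have -> : \sum_(i < 3) \sum_(j < 3) (2 * nrm (wD j (subv u v i)) ^+ 2 + 2 * B) =
   2 * \sum_(i < 3) \sum_(j < 3) nrm (wD j (subv u v i)) ^+ 2 + 18 * B.
  exact: sum2_affine.
by rewrite lerD2r ler_wpM2l.
Qed.

Variables (alpha T T' B D : R) (u0 : @vfield R) (u du v dv : R -> @vfield R).
Variables (p q : R -> point -> R).
Hypotheses (alpha0 : 0 < alpha) (T0 : 0 < T) (TT' : T < T').
Hypothesis uC1 : C1_Hs `[0, +oo[ 1%:R u du.
Hypothesis udf : forall (t : R), 0 <= t -> L2 (p t) /\ div_free (u t).
Hypothesis ueq : forall (t : R), 0 <= t -> forall (i : 'I_3) phi, test_fun phi ->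
  - alpha ^+ 2 * torus_int (fun x => du t i x * laplacian phi x)
  + torus_int (fun x => du t i x * phi x)
  + torus_int (fun x => advect (u t) i x * phi x)
  - torus_int (fun x => p t x * partial i phi x) = 0.
Hypothesis uini : forall i, ae_eq_fun (u 0 i) (u0 i).
Hypothesis vC1 : C1_Hs `[0, T'[ 2%:R v dv.
Hypothesis vdf : forall (t : R), 0 <= t < T' -> Hs 1%:R (q t) /\ div_free (v t).
Hypothesis veq : forall (t : R), 0 <= t < T' -> forall i : 'I_3,
  {ae vol, forall x, dv t i x + advect (v t) i x + wD i (q t) x = 0}.
Hypothesis vini : forall i, ae_eq_fun (v 0 i) (u0 i).
Hypothesis vB : forall (t : R), 0 <= t <= T -> forall i, hbound 3 (v t i) B.
Hypothesis dvD : forall (t : R), 0 <= t <= T -> forall i, hbound 2 (dv t i) D.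

Let C := 6 * Num.sqrt (53 * B) + 1.
Let w (t : R) := subv (u t) (v t).
Let dw (t : R) := subv (du t) (dv t).
Let G (t : R) := voigt_energy alpha (w t) (w t).

Let inU (t : R) : 0 <= t -> (`[0, +oo[%classic : set R) t.
Proof. by move=> t0; rewrite /= in_itv /= andbT. Qed.

Let inV (t : R) : 0 <= t <= T -> (`[0, T'[%classic : set R) t.
Proof. by move=> /andP[t0 tT]; rewrite /= in_itv /= t0 (le_lt_trans tT). Qed.

Let hu (t : R) : 0 <= t -> H1v (u t).
Proof.
move=> t0 i; have [cu _ _] := uC1; have [h _] := cu t (inU t0).
by have [K hK] := vHs_hbound_ex h; exists K.
Qed.

Let hdu (t : R) : 0 <= t -> H1v (du t).
Proof.
move=> t0 i; have [_ cdu _] := uC1; have [h _] := cdu t (inU t0).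
by have [K hK] := vHs_hbound_ex h; exists K.
Qed.

Let hv (t : R) : 0 <= t <= T -> H1v (v t).
Proof. by move=> tT i; exists B; apply: hbound_le (vB tT i). Qed.

Let hdv (t : R) : 0 <= t <= T -> H1v (dv t).
Proof. by move=> tT i; exists D; apply: hbound_le (dvD tT i). Qed.

Let hw (t : R) : 0 <= t <= T -> H1v (w t).
Proof. by move=> tT; apply: H1v_sub; [apply: hu; case/andP: tT|exact: hv]. Qed.

Let C0 : 0 < C.
Proof. by rewrite /C ltr_wpDl// mulr_ge0// sqrtr_ge0. Qed.

Let G_continuous : {within `[0, T], continuous G}.
Proof.
apply/subspace_continuousP => t; rewrite /= in_itv /= => tT.
have It : `[0, T]%classic t by rewrite /= in_itv.
have hwI r : `[0, T]%classic r -> H1v (w r) by rewrite /= in_itv /=; exact: hw.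
have cw i : l2cont `[0, T] (fun r => w r i) t /\
    forall j, l2cont `[0, T] (fun r => wD j (w r i)) t.
  apply: (l2cont_H1 (F := fun r => w r i)) => //; first by move=> r Ir; exact: hwI.
  move=> e e0; have e4 : 0 < e / 4 by rewrite divr_gt0.
  have [cu _ _] := uC1; have [cv _ _] := vC1.
  have t0 : 0 <= t by case/andP: tT.
  have [d1 d10 H1] := cont_Hs_hbound cu (inU t0) e4.
  have [d2 d20 H2] := cont_Hs_hbound cv (inV tT) e4.
  exists (Num.min d1 d2); first by rewrite lt_min d10.
  move=> r; rewrite /= in_itv /= => rT; rewrite lt_min => /andP[rd1 rd2].
  have r0 : 0 <= r by case/andP: rT.
  have h1 := H1 r (inU r0) rd1 i.
  have h2 : hbound 1 (fun x => v r i x - v t i x) (e / 4).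
    by apply: hbound_le (H2 r (inV rT) rd2 i).
  have := hboundB h1 h2; rewrite quarter_sum; congr hbound.
  by apply/funext => x; rewrite /w /subv; ring.
apply: voigt_energy_cvg => // [i|i j]; first by have [] := cw i.
by have [_] := cw i; exact.
Qed.

Let G_derive (t : R) : 0 < t < T -> is_derive t 1 G (2 * voigt_energy alpha (dw t) (w t)).
Proof.
move=> tT; have It : `]0, T[%classic t by rewrite /= in_itv.
have wk r : 0 < r < T -> 0 <= r <= T by move=> /andP[r0 rT]; rewrite !ltW.
have tT' := wk t tT; have t0 : 0 <= t by case/andP: tT'.
have hwI r : `]0, T[%classic r -> H1v (w r).
  by rewrite /= in_itv /= => rT; apply: hw; exact: wk.
have nI : nbhs t `]0, T[%classic by apply: near_in_itvoo; rewrite in_itv.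
have hdw : H1v (dw t) by apply: H1v_sub; [exact: hdu|exact: hdv].
have dwt i : l2deriv `]0, T[ (fun r => w r i) t (dw t i) /\
    forall j, l2deriv `]0, T[ (fun r => wD j (w r i)) t (wD j (dw t i)).
  apply: (l2deriv_H1 (F := fun r => w r i)) => //; first by move=> r Ir; exact: hwI.
  move=> e e0; have e4 : 0 < e / 4 by rewrite divr_gt0.
  have [d1 d10 H1] := deriv_Hs_hbound uC1 (inU t0) e4.
  have [d2 d20 H2] := deriv_Hs_hbound vC1 (inV tT') e4.
  exists (Num.min d1 d2); first by rewrite lt_min d10.
  move=> r; rewrite /= in_itv /= => /wk rT nrt; rewrite lt_min => /andP[rd1 rd2].
  have r0 : 0 <= r by case/andP: rT.
  have h1 := H1 r (inU r0) nrt rd1 i.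
  have h2 : hbound 1 (fun x => (r - t)^-1 * (v r i x - v t i x) - dv t i x) (e / 4).
    by apply: hbound_le (H2 r (inV rT) nrt rd2 i).
  have := hboundB h1 h2; rewrite quarter_sum; congr hbound.
  by apply/funext => x; rewrite /w /dw /subv; ring.
apply: (voigt_energy_derive _ hwI nI hdw) => [i|i j]; first by have [] := dwt i.
by have [_] := dwt i; exact.
Qed.

Let G_rate (t : R) : 0 < t < T -> 2 * voigt_energy alpha (dw t) (w t) <= C * G t + 9 * alpha ^+ 2 * D.
Proof.
move=> /andP[t0 tT]; have tT' : 0 <= t <= T by rewrite !ltW.
have t0' := ltW t0; have [lp dfu] := udf t0'.
have tV : 0 <= t < T' by rewrite t0' (lt_trans tT).
have [[Kq hq] dfv] : (exists K, hbound 1 (q t) K) /\ div_free (v t).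
  by have [h ?] := vdf tV; split => //; exact: Hs_hbound_ex h.
have hq1 : H1 (q t) by exists Kq.
apply: (energy_rate (hu t0') (hdu t0') lp dfu (ueq t0') (hv tT') hq1 dfv (veq tV)).
  by move=> i j; exact: hbound_wD (vB tT' i).
by move=> i; apply: hbound_le (dvD tT' i).
Qed.

Let G0 : G 0 = 0.
Proof.
have T00 : (0 : R) <= 0 <= T by rewrite lexx (ltW T0).
apply: voigt_energy_eq0; first exact: hw.
move=> i; apply: ae_nrm0; first by apply: H1_L2; exact: hu.
  by apply: H1_L2; exact: hv.
by apply: vol_aeS (vol_aeI (uini i) (vini i)) => x [-> ->].
Qed.

(** The energy of u - v bounds alpha^2 |grad (u - v)|^2, and is itself of order
    alpha^2. *)
Lemma voigt_grad_le t : 0 <= t <= T ->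
  grad_L2norm (u t) ^+ 2 <= 2 * energy_bound B D T + 18 * B.
Proof.
move=> tT; have a0 : 0 < alpha ^+ 2 by rewrite exprn_gt0.
have D0 : 0 <= D by apply: hbound_ge0 (dvD tT ord0).
have A0 : 0 <= 9 * alpha ^+ 2 * D by rewrite !mulr_ge0// ltW.
have G0' : G 0 <= 0 by rewrite G0.
have := gronwall C0 A0 G_continuous G_derive G_rate G0' tT.
have -> : 9 * alpha ^+ 2 * D / C * expR (C * T) = alpha ^+ 2 * energy_bound B D T.
  by rewrite /energy_bound -/C; field; exact: lt0r_neq0.
move=> GK; apply: grad_L2norm_le.
- by apply: hu; case/andP: tT.
- by move=> i; apply: hbound_le (vB tT i).
rewrite -(ler_pM2l a0); apply: le_trans GK.
rewrite /G /voigt_energy -[leLHS]add0r; apply: lerD.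
  by apply: sumr_ge0 => i _; rewrite -nrm_sqr sqr_ge0.
rewrite ler_pM2l//; apply: ler_sum => i _; apply: ler_sum => j _.
by rewrite nrm_sqr.
Qed.

End Comparison.

(** On ]0, d[ the supremum is at most d K^(1/2). *)
Lemma limf_esup_scale_le0 {R : realType} (N : R -> R -> R) (I : set R) (K : R) :
  (forall alpha, 0 < alpha -> forall t, I t -> N alpha t ^+ 2 <= K) ->
  (limf_esup (fun alpha : R => ereal_sup [set (alpha * N alpha t)%:E | t in I])
     (0%R^'+) <= 0)%E.
Proof.
move=> NK; apply/lee_addgt0Pr => e e0; rewrite add0e.
pose d := e / (Num.sqrt K + 1).
have K0 : 0 < Num.sqrt K + 1 by rewrite ltr_wpDl// sqrtr_ge0.
have d0 : 0 < d by rewrite divr_gt0.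
apply: (@le_trans _ _ (ereal_sup [set ereal_sup [set (alpha * N alpha t)%:E | t in I]
    | alpha in `]0, d[%classic])).
  apply: ereal_inf_lbound; exists `]0, d[%classic => //.
  apply: filterS2 (nbhs_right_gt 0) (nbhs_right_lt d0) => alpha a0 ad.
  by rewrite /= in_itv /= a0.
apply: ge_ereal_sup => _ [alpha + <-]; rewrite /= in_itv /= => /andP[a0 ad].
apply: ge_ereal_sup => _ [t It <-]; rewrite lee_fin.
have h : N alpha t <= Num.sqrt K.
  apply: le_trans (ler_norm _) _; rewrite -sqrtr_sqr ler_wsqrtr//.
  exact: NK.
apply: (@le_trans _ _ (alpha * (Num.sqrt K + 1))).
  by apply: ler_wpM2l; [exact: ltW|lra].
by rewrite -ler_pdivlMr// ltW.
Qed.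

Unset Implicit Arguments.

Theorem theorem3p1 (R : realType) (s : R) (u0 : @vfield R)
    (u : R -> R -> @vfield R) (T : R) :
  3 <= s -> vHs s u0 -> div_free u0 -> mean_zero u0 ->
  (forall alpha : R, 0 < alpha -> euler_voigt_solution alpha u0 (u alpha)) ->
  0 < T ->
  (0 < limf_esup (fun alpha : R =>
         ereal_sup [set (alpha * grad_L2norm (u alpha t))%:E
                   | t in `[0%R, T]]) (0%R^'+))%E ->
  (euler_Tmax u0 <= T%:E)%E.
Proof.
move=> _ _ _ _ voigt T0 pos; apply: ge_ereal_sup => _ [T' [T'0 [v sol]] <-].
rewrite lee_fin leNgt; apply/negP => TT'.
have [dv [q [cv vC1 vdf veq vini]]] := sol.
have [_ cdv _] := vC1.
have [B vB] := hbound_compact (p := 3) TT' cv.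
have [D dvD] := hbound_compact (p := 2) TT' cdv.
move: pos; rewrite ltNge => /negP; apply.
apply: (limf_esup_scale_le0 (K := 2 * energy_bound B D T + 18 * B)).
move=> alpha a0 t; rewrite /= in_itv /= => tT.
have [du [p [uC1 udf ueq uini]]] := voigt alpha a0.
exact: (voigt_grad_le a0 T0 TT' uC1 udf ueq uini vC1 vdf veq vini vB dvD tT).
Qed.
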